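(* Let $0<\alpha<2$ and $\vec H=(H_1,\dots,H_N)\in(0,1)^N$, and let $\widetilde Z^{\vec H}=\{\widetilde Z^{\vec H}(t),t\in\mathbb{R}_+^N\}$ be the harmonizable fractional stable sheet $$\widetilde Z^{\vec H}(t)=\mathrm{Re}\int_{\mathbb{R}^N}\prod_{j=1}^N\frac{e^{it_jx_j}-1}{|x_j|^{H_j+\frac1\alpha}}\ \widetilde Z_\alpha(dx),$$ where $\widetilde Z_\alpha$ is a complex-valued, rotationally invariant $\alpha$-stable random measure on $\mathbb{R}^N$ with Lebesgue control measure. Then (for a version of $\widetilde Z^{\vec H}$ with continuous sample paths, which exists) for any $\varepsilon>0$ $$\lim_{h\to0+}\ \sup_{\substack{s,t\in[0,1]^N\\0<|s-t|\le h}}\frac{\big|\widetilde Z^{\vec H}(s)-\widetilde Z^{\vec H}(t)\big|}{\sum_{j=1}^N|s_j-t_j|^{H_j}\,\Big|\log\big(\sum_{j=1}^N|s_j-t_j|^{H_j}\big)\Big|^{(2+\varepsilon)/\alpha}}=0\qquad\text{almost surely.}$$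
   Context: $\mathbb{R}_+=[0,\infty)$ and $|\cdot|$ is the Euclidean norm on $\mathbb{R}^N$. In the denominator the logarithmic factor multiplies the whole sum $\sum_{j}|s_j-t_j|^{H_j}$. The finite-dimensional distributions of $\widetilde Z^{\vec H}$ are symmetric $\alpha$-stable, determined as follows: with $h(t,x)=\prod_{j=1}^N\frac{e^{it_jx_j}-1}{|x_j|^{H_j+1/\alpha}}$, for all $t^1,\dots,t^m\in\mathbb{R}_+^N$ and $a_1,\dots,a_m\in\mathbb{R}$, $$\mathbb{E}\exp\Big(i\sum_{k=1}^m a_k\widetilde Z^{\vec H}(t^k)\Big)=\exp\Big(-\int_{\mathbb{R}^N}\Big|\sum_{k=1}^m a_kh(t^k,x)\Big|^\alpha dx\Big)$$ (the constant multiplying the integral depends only on the normalization of the random measure and is immaterial). A version of a random field is a random field on the same probability space that agrees with it almost surely at each fixed $t$. *)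

(* Defs.v *)
From HB Require Import structures.
From mathcomp Require Import all_boot all_order all_algebra.
From mathcomp Require Import complex.
From mathcomp Require Import all_classical all_reals all_analysis.

Set Implicit Arguments.
Unset Strict Implicit.
Unset Printing Implicit Defensive.

Import Order.TTheory GRing.Theory Num.Theory.
Import numFieldNormedType.Exports.

Local Open Scope classical_set_scope.
Local Open Scope ring_scope.

Section LebesgueMeasureRn.
Context {R : realType}.

Local Notation tupleR n := (n.-tuple (measurableTypeR R)).

Definition tcons n (xy : measurableTypeR R * tupleR n) : tupleR n.+1 :=
  [tuple of xy.1 :: xy.2].

Lemma measurable_tcons n : measurable_fun setT (@tcons n).
Proof. exact: measurable_cons. Qed.

Definition lebesgue_cons n (m : {sigma_finite_measure set (tupleR n) -> \bar R})
    : set (tupleR n.+1) -> \bar R :=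
  pushforward (lebesgue_measure \x m)%E (@tcons n).

Section lebesgue_cons_measure.
Variables (n : nat) (m : {sigma_finite_measure set (tupleR n) -> \bar R}).

Let lebesgue_cons0 : lebesgue_cons m set0 = 0%E.
Proof. by rewrite /lebesgue_cons /pushforward preimage_set0 measure0. Qed.

Let lebesgue_cons_ge0 A : (0 <= lebesgue_cons m A)%E.
Proof. by rewrite /lebesgue_cons /pushforward measure_ge0. Qed.

Let lebesgue_cons_sigma_additive : semi_sigma_additive (lebesgue_cons m).
Proof.
exact: (@measure_semi_sigma_additive _ _ _
  (measure_function_pushforward__canonical__measure_function_Measure
     (lebesgue_measure \x m)%E (@measurable_tcons n))).
Qed.

HB.instance Definition _ := isMeasure.Build _ _ _ (lebesgue_cons m)
  lebesgue_cons0 lebesgue_cons_ge0 lebesgue_cons_sigma_additive.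

Lemma lebesgue_cons_sigma_finite :
  sigma_finite setT (lebesgue_cons m).
Proof.
have /sigma_finiteP[F [FT ndF mF]] :=
  sigma_finiteT (@lebesgue_measure R).
have /sigma_finiteP[G [GT ndG mG]] := sigma_finiteT m.
pose u (z : tupleR n.+1) : measurableTypeR R * tupleR n :=
  (thead z, [tuple of behead z]).
have uK : u \o @tcons n = id.
  by apply/funext => -[x y]; congr pair; exact/val_inj.
have mu : measurable_fun setT u.
  by apply/measurable_fun_pairP; split;
    [exact: (measurable_tnth ord0)|exact: measurable_behead].
exists (fun k => u @^-1` (F k `*` G k)) => [|k].
  apply/esym/seteqP; split => // z _.
  have : (\bigcup_k F k) (u z).1 by rewrite -FT.
  have : (\bigcup_k G k) (u z).2 by rewrite -GT.
  move=> [k _ Gk] [l _ Fl]; exists (maxn l k) => //; split.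
    by move: Fl; exact/subsetPset/ndF/leq_maxl.
  by move: Gk; exact/subsetPset/ndG/leq_maxr.
have [mFk Fk] := mF k; have [mGk Gk] := mG k; split.
  by rewrite -[_ @^-1` _]setTI; apply: mu => //; exact: measurableX.
rewrite /lebesgue_cons /pushforward -comp_preimage uK preimage_id.
by rewrite product_measure1E//= lte_mul_pinfty// ge0_fin_numE.
Qed.

HB.instance Definition _ := Measure_isSigmaFinite.Build _ _ _
  (lebesgue_cons m) lebesgue_cons_sigma_finite.

End lebesgue_cons_measure.

Fixpoint lebesgue_measureN n : {sigma_finite_measure set (tupleR n) -> \bar R} :=
  if n is n'.+1 then lebesgue_cons (lebesgue_measureN n')
  else \d_[tuple].

Lemma lebesgue_measureN_box n (A : 'I_n -> set (measurableTypeR R)) :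
  (forall i, measurable (A i)) ->
  lebesgue_measureN n [set x | forall i, A i (tnth x i)] =
  (\prod_(i < n) lebesgue_measure (A i))%E.
Proof.
elim: n A => [A _|n IHn A mA].
  rewrite big_ord0 /= diracE mem_set//=; by case.
rewrite big_ord_recl -IHn// -product_measure1E//=; last first.
  rewrite (_ : [set x | _] = \bigcap_(i in [set: 'I_n])
     ((fun x : tupleR n => tnth x i) @^-1` A (lift ord0 i))); last first.
    by apply/seteqP; split => x /= xA i; [move=> _|]; exact: (xA i).
  apply: fin_bigcap_measurable => // i _.
  by rewrite -[_ @^-1` _]setTI; exact: measurable_tnth.
rewrite /lebesgue_cons /pushforward.
congr ((lebesgue_measure \x lebesgue_measureN n)%E _).
apply/seteqP; split => -[x y] /=.
  by move=> xyA; split => [|i]; [exact: (xyA ord0)|rewrite -(tnthS x); exact: xyA].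
move=> [xA yA] i; case: (unliftP ord0 i) => [j ->|-> //].
by rewrite tnthS.
Qed.

End LebesgueMeasureRn.

Section HarmonizableFractionalStableSheet.
Context {R : realType} {N : nat}.

Definition expi (theta : R) : R[i] := (cos theta +i* sin theta)%C.

(* [`|u|] on ['rV[R]_N] is the sup norm. *)
Definition enorm (u : 'rV[R]_N) : R :=
  Num.sqrt (\sum_(j < N) u ord0 j ^+ 2).

Definition orthant : set 'rV[R]_N := [set t | forall j, 0 <= t ord0 j].

Definition unit_cube : set 'rV[R]_N :=
  [set t | forall j, 0 <= t ord0 j <= 1].

Definition hfss_kernel (alpha : R) (H t : 'rV[R]_N)
    (x : N.-tuple (measurableTypeR R)) : R[i] :=
  \prod_(j < N) ((expi (t ord0 j * tnth x j) - 1) /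
    (`|tnth x j| `^ (H ord0 j + alpha^-1))%:C%C).

Definition anisotropic_dist (H s t : 'rV[R]_N) : R :=
  \sum_(j < N) `|s ord0 j - t ord0 j| `^ H ord0 j.

Context {d : measure_display} {Omega : measurableType d}
  {P : probability Omega R}.

Definition cexpectation (X : Omega -> R[i]) : R[i] :=
  (fine 'E_P[fun w => complex.Re (X w)] +i*
   fine 'E_P[fun w => complex.Im (X w)])%C.

(* Values of the fields outside the orthant are junk.  For [0 < alpha < 2] and
   [H] in [(0, 1)^N] the integral is finite, so taking it real-valued loses
   nothing. *)
Definition is_hfss (alpha : R) (H : 'rV[R]_N) (Z : 'rV[R]_N -> {RV P >-> R}) :=
  forall (m : nat) (t : 'I_m -> 'rV[R]_N) (a : 'I_m -> R),
    (forall k, orthant (t k)) ->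
    cexpectation (fun w => expi (\sum_(k < m) a k * Z (t k) w)) =
    (expR (- \int[lebesgue_measureN N]_x
       (ComplexField.Normc.normc
          (\sum_(k < m) (a k)%:C%C * hfss_kernel alpha H (t k) x) `^ alpha)))%:C%C.

Definition is_version (Y Z : 'rV[R]_N -> {RV P >-> R}) :=
  forall t, orthant t -> {ae P, forall w, Y t w = Z t w}.

Definition continuous_paths (Y : 'rV[R]_N -> {RV P >-> R}) :=
  forall w, {within orthant, continuous (fun t => Y t w)}.

(* Division by zero matters only where [anisotropic_dist H s t = 1], which
   does not occur for small [h]. *)
Definition modulus_ratio (alpha eps : R) (H : 'rV[R]_N) (f : 'rV[R]_N -> R)
    (h : R) : \bar R :=
  ereal_sup [set r | exists s t : 'rV[R]_N,
    [/\ unit_cube s, unit_cube t, 0 < enorm (s - t) <= h &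
      r = (`|f s - f t| /
        (anisotropic_dist H s t *
         `|ln (anisotropic_dist H s t)| `^ ((2 + eps) / alpha)))%:E]].

End HarmonizableFractionalStableSheet.

(* Main.v *)
Require Import Defs.
From HB Require Import structures.
From mathcomp Require Import all_boot all_order all_algebra.
From mathcomp Require Import complex.
From mathcomp Require Import all_classical all_reals all_analysis.
From mathcomp Require Import measurable_realfun zify ring lra.
Import Order.TTheory GRing.Theory Num.Theory.
Import numFieldNormedType.Exports.
Local Open Scope classical_set_scope.
Local Open Scope ring_scope.
Set Implicit Arguments.
Unset Strict Implicit.
Unset Printing Implicit Defensive.

(** The increments of the sheet over a finite family of pairs of points have
    kernels dominated by a common envelope [g], and their joint law is a weak
    limit of laws of finite sums [S = sum_l eps_l Y_l] of independent symmetric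
    jumps with [|Y_l| <= rho_l], where the [rho_l] form an [alpha]-stable cloud
    of scale [||g||_alpha].  Given the jump sizes, [S] is subgaussian with
    variance [Q = sum_l rho_l ^ 2], so that
    [P (max |S_i| > v) <= C (||g||_alpha / w) ^ alpha + 2 m exp (- v^2 / (8 w^2))]
    for a family of [m] increments.  This only involves the expectation
    functional of [(S, Q)], which is built from two-point jumps by
    convolutions, mixtures and limits.  Moving one coordinate across a mesh of
    the anisotropic grid of level [n] gives an envelope of norm at most a
    multiple of [2 ^- n]; with [w = 2 ^- n * n ^ (2 / alpha - 1 / 2)] and
    [v] a multiple of [w * sqrt n] the bounds are summable in [n], and
    Borel-Cantelli followed by chaining gives the modulus of continuity
    [tau * |log tau| ^ (2 / alpha)]. *)

(** * Finite expectation functionals *)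

(** The hypothesis gives characteristic functions only: there is no random measure and no jump
    series to condition on. A single increment has tails of order [v^-alpha], so at these thresholds
    a union bound over the exponentially many steps of a level would diverge. With a common envelope
    the large jumps are paid for once per level, and only the subgaussian part is multiplied by the
    number of steps. Conditioning is replaced by carrying, next to the characteristic function of
    [S], one Laplace transform of [Q], at [th = w^-2]. The stable exponent is reached by operations
    that preserve such pairs: jumps of size [1 / sqrt n] give a Gaussian with the same [Q], compound
    Poisson sums turn a quadratic form [u] into [u^(alpha/2)] through the integral of
    [r^(-1-b) (1 - exp (- r u))] over [r], and nonnegative combinations approach the integral over
    the frequencies. The exponent [2/alpha - 1/2] makes the probability of a large [Q] of order
    [n^-(2 - alpha/2)], summable because [alpha < 2]; the factor [sqrt n] pays for the number of
    steps. *)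

Section Elementary.
Context {R : realType}.

Lemma sqr_le_of_norm (x y : R) : `|x| <= y -> x ^+ 2 <= y ^+ 2.
Proof.
move=> xy; rewrite -(real_normK (num_real x)).
by rewrite lerXn2r// nnegrE (le_trans _ xy).
Qed.

(* The bound passes from [x / 2] to [x] because
   [cosh x = 2 cosh (x / 2) ^ 2 - 1] and [2 y ^ 2 - 1 <= y ^ 4]. *)
Lemma cosh_le_expR (x : R) : (expR x + expR (- x)) / 2 <= expR (2 * x ^+ 2).
Proof.
(* The bound [exp z <= 1 / (1 - z)] at [z = y] and [z = - y] gives the mean [1 / (1 - y^2)], at most
   [1 + 2 y^2] on this range. *)
have small y : `|y| <= 2^-1 :> R ->
    (expR y + expR (- y)) / 2 <= expR (2 * y ^+ 2).
  move=> y2.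
  have inv z : `|z| <= 2^-1 :> R -> expR z <= (1 - z)^-1.
    move=> z2; have z1 : 0 < 1 - z.
      by rewrite subr_gt0 (le_lt_trans (ler_norm _))// (le_lt_trans z2)// invf_lt1// ltr1n.
    rewrite -[z]opprK expRN opprK lef_pV2 ?posrE ?expR_gt0//.
    exact: expR_ge1Dx.
  have := inv _ y2; have := inv (- y); rewrite normrN => /(_ y2).
  move=> h1 h2; apply: (@le_trans _ _ (1 + 2 * y ^+ 2)); last exact: expR_ge1Dx.
  have := sqr_le_of_norm y2; rewrite exprVn => y4.
  apply: (@le_trans _ _ (((1 - y)^-1 + (1 - - y)^-1) / 2)); first by lra.
  have := y2; rewrite ler_norml => /andP[ya yb].
  have -> : ((1 - y)^-1 + (1 - - y)^-1) / 2 = (1 - y ^+ 2)^-1.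
    field; apply/and3P; split; apply/eqP; nra.
  rewrite -[leRHS]invrK lef_pV2 ?posrE ?invr_gt0; [|nra|nra].
  rewrite -[leLHS]mul1r ler_pdivrMr; nra.
have step y : (expR (y / 2) + expR (- (y / 2))) / 2 <= expR (2 * (y / 2) ^+ 2) ->
    (expR y + expR (- y)) / 2 <= expR (2 * y ^+ 2).
  move=> h.
  have e1 : expR y = expR (y / 2) ^+ 2.
    by rewrite -expRM_natl; congr expR; field.
  have e2 : expR (- y) = expR (- (y / 2)) ^+ 2.
    by rewrite -expRM_natl; congr expR; field.
  have e3 : expR (2 * y ^+ 2) = expR (2 * (y / 2) ^+ 2) ^+ 4.
    by rewrite -expRM_natl; congr expR; field.
  have e4 : expR (y / 2) * expR (- (y / 2)) = 1 by rewrite expRxMexpNx_1.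
  rewrite e1 e2 e3.
  set a := expR _ in h e4 *; set b := expR _ in h e4 *; set g := expR _ in h *.
  have a0 : 0 < a by exact: expR_gt0.
  have b0 : 0 < b by exact: expR_gt0.
  have -> : (a ^+ 2 + b ^+ 2) / 2 = 2 * ((a + b) / 2) ^+ 2 - 1.
    by rewrite -[X in _ - X]e4; field.
  have h2 : ((a + b) / 2) ^+ 2 <= g ^+ 2.
    by rewrite lerXn2r// nnegrE; [lra|rewrite (le_trans _ h)//; lra].
  have := sqr_ge0 (g ^+ 2 - 1); nra.
suff main n : forall y : R, `|y| <= 2^-1 * 2 ^+ n ->
    (expR y + expR (- y)) / 2 <= expR (2 * y ^+ 2).
  have [n hn] : exists n : nat, `|x| * 2 <= 2 ^+ n.
    exists (Num.trunc (`|x| * 2)).+1.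
    rewrite (le_trans (ltW (truncnS_gt _)))// -natrX ler_nat ltnW// ltn_expl//.
  by apply: (main n); rewrite mulrC ler_pdivlMr.
elim: n => [|n IH] y; first by rewrite expr0 mulr1; exact: small.
rewrite exprS => yn; apply: step; apply: IH.
rewrite normrM [`|2^-1|]ger0_norm// ler_pdivrMr//.
by rewrite (le_trans yn)// mulrCA mulrC.
Qed.

End Elementary.

Section FiniteFunctionals.
Context {R : realType} {m : nat}.
Notation V := 'rV[R]_m.
Implicit Types (L : (V -> R -> R) -> R) (F G : V -> R -> R) (a : V).

Definition dot (a y : V) : R := \sum_(i < m) a ord0 i * y ord0 i.

Lemma dotDr a y z : dot a (y + z) = dot a y + dot a z.
Proof. by rewrite /dot -big_split; apply: eq_bigr => i _; rewrite mxE mulrDr. Qed.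

Lemma dotDl a b y : dot (a + b) y = dot a y + dot b y.
Proof. by rewrite /dot -big_split; apply: eq_bigr => i _; rewrite mxE mulrDl. Qed.

Lemma dotZr a c y : dot a (c *: y) = c * dot a y.
Proof. by rewrite /dot mulr_sumr; apply: eq_bigr => i _; rewrite mxE mulrCA. Qed.

Lemma dotNr a y : dot a (- y) = - dot a y.
Proof. by rewrite -scaleN1r dotZr mulN1r. Qed.

Lemma dotNl a y : dot (- a) y = - dot a y.
Proof. by rewrite /dot -sumrN; apply: eq_bigr => i _; rewrite mxE mulNr. Qed.

Lemma dot0r a : dot a 0 = 0.
Proof. by rewrite -[X in dot _ X](scale0r 0) dotZr mul0r. Qed.

Lemma dot0l y : dot 0 y = 0.
Proof. by rewrite /dot big1// => i _; rewrite mxE mul0r. Qed.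

(* [L] stands for the expectation of [F (S, Q)] for a finitely supported
   symmetric random vector [S] and the sum [Q >= 0] of its squared jump bounds. *)
Record adm L : Prop := Adm {
  admD : forall F G, L (fun s q => F s q + G s q) = L F + L G;
  admZ : forall c F, L (fun s q => c * F s q) = c * L F;
  adm_ge0 : forall F, (forall s q, 0 <= q -> 0 <= F s q) -> 0 <= L F;
  adm1 : L (fun _ _ => 1) = 1;
  adm_sin : forall a, L (fun s _ => sin (dot a s)) = 0;
  adm_exp : forall i l, L (fun s q => expR (l * s ord0 i - 2 * l ^+ 2 * q)) <= 1 }.

Lemma adm_le L F G : adm L ->
  (forall s q, 0 <= q -> F s q <= G s q) -> L F <= L G.
Proof.
move=> aL FG; rewrite -subr_ge0.
rewrite -mulN1r -(admZ aL) -(admD aL); apply: (adm_ge0 aL) => s q q0.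
by rewrite mulN1r subr_ge0 FG.
Qed.

Lemma adm_cst L c : adm L -> L (fun _ _ => c) = c.
Proof.
by move=> aL; rewrite -[RHS]mulr1 -(adm1 aL) -(admZ aL); congr L;
  apply/funext => s; apply/funext => q; rewrite mulr1.
Qed.

Lemma adm_sum L (I : Type) (r : seq I) (F : I -> V -> R -> R) : adm L ->
  L (fun s q => \sum_(i <- r) F i s q) = \sum_(i <- r) L (F i).
Proof.
move=> aL; elim: r => [|i r IH].
  rewrite big_nil -[RHS](adm_cst 0 aL); congr L.
  by apply/funext => s; apply/funext => q; rewrite big_nil.
rewrite big_cons -IH -(admD aL); congr L.
by apply/funext => s; apply/funext => q; rewrite big_cons.
Qed.

Lemma adm_norm_le1 L F : adm L -> (forall s q, 0 <= q -> `|F s q| <= 1) -> `|L F| <= 1.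
Proof.
move=> aL F1; rewrite ler_norml; apply/andP; split.
  rewrite -(adm_cst (-1) aL); apply: (adm_le aL) => s q q0.
  by have := F1 s q q0; rewrite ler_norml => /andP[].
rewrite -(adm_cst 1 aL); apply: (adm_le aL) => s q q0.
by have := F1 s q q0; rewrite ler_norml => /andP[].
Qed.

(** Expectation over the sum of two independent pairs; iterating the functionals replaces the
    product measure. *)
Definition conv L1 L2 := fun F => L1 (fun s q => L2 (fun s' q' => F (s + s') (q + q'))).

(** The sine condition passes to the sum by the addition formula, the exponential one because its
    integrand factors over the summands. *)
Lemma adm_conv L1 L2 : adm L1 -> adm L2 -> adm (conv L1 L2).
Proof.
move=> a1 a2; split; rewrite /conv.
- move=> F G; rewrite -(admD a1); congr L1; apply/funext => s; apply/funext => q.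
  by rewrite -(admD a2).
- move=> c F; rewrite -(admZ a1); congr L1; apply/funext => s; apply/funext => q.
  by rewrite -(admZ a2).
- move=> F F0; apply: (adm_ge0 a1) => s q q0; apply: (adm_ge0 a2) => s' q' q'0.
  by apply: F0; exact: addr_ge0.
- rewrite -[RHS](adm1 a1); congr L1; apply/funext => s; apply/funext => q.
  exact: adm1.
- move=> a.
  rewrite (_ : (fun s q => _) = fun s _ =>
     L2 (fun s' _ => cos (dot a s')) * sin (dot a s)).
    by rewrite (admZ a1) (adm_sin a1) mulr0.
  apply/funext => s; apply/funext => q.
  rewrite (_ : (fun s' q' => _) = (fun s' _ => sin (dot a s) * cos (dot a s') +
    cos (dot a s) * sin (dot a s'))).
    by rewrite (admD a2) !(admZ a2) (adm_sin a2) mulr0 addr0 mulrC.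
  by apply/funext => s'; apply/funext => q'; rewrite dotDr sinD.
- move=> i l; apply: le_trans (adm_exp a1 i l); apply: (adm_le a1) => s q q0.
  rewrite (_ : (fun s' q' => _) = (fun (s' : V) q' =>
    expR (l * s ord0 i - 2 * l ^+ 2 * q) * expR (l * s' ord0 i - 2 * l ^+ 2 * q'))).
    by rewrite (admZ a2) -[leRHS]mulr1 ler_wpM2l ?expR_ge0// (adm_exp a2).
  apply/funext => s'; apply/funext => q'; rewrite -expRD mxE; congr expR; ring.
Qed.

Definition mix (p : R) L1 L2 := fun F => (1 - p) * L1 F + p * L2 F.

Lemma adm_mix p L1 L2 : 0 <= p <= 1 -> adm L1 -> adm L2 -> adm (mix p L1 L2).
Proof.
move=> /andP[p0 p1] a1 a2; have p1' : 0 <= 1 - p by rewrite subr_ge0.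
split; rewrite /mix.
- by move=> F G; rewrite (admD a1) (admD a2); ring.
- by move=> c F; rewrite (admZ a1) (admZ a2); ring.
- by move=> F F0; rewrite addr_ge0// mulr_ge0// ?(adm_ge0 a1)// (adm_ge0 a2).
- by rewrite (adm1 a1) (adm1 a2) !mulr1 subrK.
- by move=> a; rewrite (adm_sin a1) (adm_sin a2); ring.
- move=> i l; have := adm_exp a1 i l; have := adm_exp a2 i l.
  by move=> h1 h2; nra.
Qed.

Definition sym_jump (y : V) (rho : R) := fun F : V -> R -> R =>
  (F y (rho ^+ 2) + F (- y) (rho ^+ 2)) / 2.

(** The factor 2 in [adm_exp] comes from [cosh_le_expR]: a fair sign gives
    [cosh (l * y_i) <= exp (2 l^2 rho^2)]. *)
Lemma adm_sym_jump (y : V) (rho : R) : (forall i, `|y ord0 i| <= rho) -> adm (sym_jump y rho).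
Proof.
move=> yr; split; rewrite /sym_jump.
- by move=> F G; field.
- by move=> c F; field.
- by move=> F F0; rewrite divr_ge0// addr_ge0// F0// sqr_ge0.
- by field.
- by move=> a; rewrite dotNr sinN subrr mul0r.
- move=> i l.
  rewrite !expRD -mulrDl mulrAC mxE mulrN.
  rewrite -[leRHS](expRxMexpNx_1 (2 * l ^+ 2 * rho ^+ 2)) ler_wpM2r ?expR_ge0//.
  rewrite (le_trans (cosh_le_expR _))// ler_expR exprMn mulrA.
  rewrite ler_wpM2l ?(mulr_ge0 _ (sqr_ge0 _))//; apply: sqr_le_of_norm; exact: yr.
Qed.

Variable th : R.
Hypothesis th0 : 0 < th.

(* The index [None] stands for the Laplace transform of [Q] at [th]: it passes
   through all limits together with the characteristic function of [S]. *)
Definition test (o : option V) : V -> R -> R :=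
  if o is Some a then fun s _ => cos (dot a s) else fun _ q => expR (- (th * q)).

Lemma test_norm_le1 o s q : 0 <= q -> `|test o s q| <= 1.
Proof.
case: o => [a|] q0 /=; first exact: cos_max.
by rewrite ger0_norm ?expR_ge0// -expR0 ler_expR oppr_le0 mulr_ge0// ltW.
Qed.

(** The cross terms of the addition formula vanish by [adm_sin], so the cosines alone multiply as
    characteristic functions do. *)
Lemma conv_test L1 L2 o : adm L1 -> adm L2 ->
  conv L1 L2 (test o) = L1 (test o) * L2 (test o).
Proof.
move=> a1 a2; rewrite /conv mulrC -(admZ a1).
case: o => [a|] /=.
  rewrite (_ : (fun s q => _) = fun s q => L2 (fun s' _ => cos (dot a s')) * cos (dot a s))//.
  apply/funext => s; apply/funext => q.
  rewrite (_ : (fun s' q' => _) = (fun s' _ => cos (dot a s) * cos (dot a s') +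
    (- sin (dot a s)) * sin (dot a s'))).
    by rewrite (admD a2) !(admZ a2) (adm_sin a2) mulr0 addr0 mulrC.
  by apply/funext => s'; apply/funext => q'; rewrite dotDr cosD mulNr.
congr L1; apply/funext => s; apply/funext => q.
rewrite mulrC -(admZ a2); congr L2; apply/funext => s'; apply/funext => q'.
by rewrite mulrDr opprD expRD.
Qed.

(** Pointwise closure of the admissible functionals, seen through the tests. Approximating finitely
    many tests at a time avoids constructing any limit law. *)
Definition good (phi : option V -> R) := forall (A : seq (option V)) (e : R),
  0 < e -> exists2 L, adm L & forall o, o \in A -> `|L (test o) - phi o| <= e.

Lemma good_norm_le1 phi o : good phi -> `|phi o| <= 1.
Proof.
move=> gphi; apply/ler_addgt0Pr => e e0.
have [L aL /(_ o (mem_head _ _)) h] := gphi [:: o] e e0.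
have h1 : `|L (test o)| <= 1.
  by apply: (adm_norm_le1 aL) => s q q0; exact: test_norm_le1.
rewrite -[phi o](subKr (L (test o))) (le_trans (ler_normB _ _))//.
by rewrite lerD.
Qed.

Lemma good_ext phi psi : good phi -> phi =1 psi -> good psi.
Proof. by move=> gphi /funext <-. Qed.

Lemma good_lim (phi : nat -> option V -> R) psi : (forall n, good (phi n)) ->
  (forall o, phi n o @[n --> \oo] --> psi o) -> good psi.
Proof.
move=> gphi lphi A e e0.
have e20 : 0 < e / 2 by rewrite divr_gt0.
have /(_ A)[n hn] : forall B : seq (option V), exists n0, forall n, (n0 <= n)%N ->
    forall o, o \in B -> `|phi n o - psi o| <= e / 2.
  elim=> [|o B [n0 IH]]; first by exists 0%N.
  have /cvgrPdist_le/(_ _ e20)[n1 _ h1] := lphi o.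
  exists (maxn n0 n1) => n; rewrite geq_max => /andP[nn0 nn1] o'.
  rewrite inE => /orP[/eqP ->|]; last exact: IH.
  by rewrite distrC; exact: h1.
have [L aL hL] := gphi n A _ e20; exists L => // o oA.
rewrite -(subrK (phi n o) (L _)) -addrA (le_trans (ler_normD _ _))//.
by rewrite [leRHS]splitr lerD// ?hL// hn.
Qed.

Lemma good_jump (y : V) (rho : R) : (forall i, `|y ord0 i| <= rho) ->
  good (fun o => if o is Some a then cos (dot a y) else expR (- (th * rho ^+ 2))).
Proof.
move=> yr A e e0; exists (sym_jump y rho); first exact: adm_sym_jump.
move=> o _; rewrite (_ : _ - _ = 0) ?normr0 ?ltW//.
case: o => [a|] /=; rewrite /sym_jump /=; last by field.
by rewrite dotNr cosN; field.
Qed.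

Lemma good_one : good (fun=> 1).
Proof.
apply: (@good_ext _ _ (@good_jump 0 0 _)) => [i|[a|]].
- by rewrite mxE normr0.
- by rewrite dot0r cos0.
- by rewrite expr0n mulr0 oppr0 expR0.
Qed.

Lemma good_mul phi psi : good phi -> good psi -> good (fun o => phi o * psi o).
Proof.
move=> g1 g2 A e e0; have e20 : 0 < e / 2 by rewrite divr_gt0.
have [L1 a1 h1] := g1 A _ e20; have [L2 a2 h2] := g2 A _ e20.
exists (conv L1 L2); first exact: adm_conv.
move=> o oA; rewrite conv_test//.
rewrite (_ : _ - _ = (L1 (test o) - phi o) * L2 (test o) + phi o * (L2 (test o) - psi o)); last by ring.
rewrite (le_trans (ler_normD _ _))// [leRHS]splitr !normrM lerD//.
  rewrite -[leRHS]mulr1 ler_pM ?h1//.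
  by apply: (adm_norm_le1 a2) => s q q0; exact: test_norm_le1.
by rewrite -[leRHS]mul1r ler_pM ?h2//; exact: good_norm_le1.
Qed.

Lemma good_mix p phi psi : 0 <= p <= 1 -> good phi -> good psi ->
  good (fun o => (1 - p) * phi o + p * psi o).
Proof.
move=> p01 g1 g2 A e e0; have /andP[p0 p1] := p01.
have [L1 a1 h1] := g1 A _ e0; have [L2 a2 h2] := g2 A _ e0.
exists (mix p L1 L2); first exact: adm_mix.
move=> o oA; rewrite /mix.
rewrite (_ : _ - _ = (1 - p) * (L1 (test o) - phi o) + p * (L2 (test o) - psi o)); last by ring.
rewrite (le_trans (ler_normD _ _))// !normrM.
rewrite [`|1 - p|]ger0_norm ?subr_ge0// [`|p|]ger0_norm//.
have := h1 o oA; have := h2 o oA; nra.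
Qed.

Lemma good_exp n phi : good phi -> good (fun o => phi o ^+ n).
Proof.
move=> g; elim: n => [|n IH]; first by apply: good_ext good_one _ => o; rewrite expr0.
by apply: good_ext (good_mul g IH) _ => o; rewrite exprS.
Qed.

End FiniteFunctionals.

(** * Limits of powers and the cosine form of the central limit theorem *)

Section Limits.
Context {R : realType}.

Lemma norm_exprB (a b : R) n : `|a| <= 1 -> `|b| <= 1 ->
  `|a ^+ n - b ^+ n| <= n%:R * `|a - b|.
Proof.
move=> a1 b1; elim: n => [|n IH]; first by rewrite !expr0 subrr normr0 mul0r.
rewrite !exprS (_ : _ - _ = a * (a ^+ n - b ^+ n) + (a - b) * b ^+ n); last by ring.
rewrite (le_trans (ler_normD _ _))// [n.+1%:R]mulrS [leRHS]mulrDl mul1r addrC lerD//.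
  by rewrite normrM -[leRHS]mulr1 ler_wpM2l// normrX exprn_ile1.
by rewrite normrM -[leRHS]mul1r (le_trans _ (ler_wpM2l _ IH))// ler_wpM2r.
Qed.

Lemma norm_expR_opp_sub (a b : R) : 0 <= a -> 0 <= b ->
  `|expR (- a) - expR (- b)| <= `|a - b|.
Proof.
wlog ab : a b / a <= b => [wl a0 b0|a0 b0].
  have [|/ltW] := leP a b => h; first exact: wl.
  by rewrite distrC [leRHS]distrC; exact: wl.
rewrite ger0_norm ?subr_ge0 ?ler_expR ?lerN2//.
rewrite [leRHS]distrC [leRHS]ger0_norm ?subr_ge0//.
rewrite (_ : - b = - a + - (b - a)); last by ring.
rewrite expRD -[X in X - _]mulr1 -mulrBr -[leRHS]mul1r.
have := expR_ge1Dx (- (b - a)) => h.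
rewrite ler_pM ?expR_ge0//.
- by rewrite subr_ge0 -expR0 ler_expR oppr_le0 subr_ge0.
- by rewrite -expR0 ler_expR oppr_le0.
- lra.
Qed.

(** The bases [1 - t] and [exp (- t)] differ by at most [t^2]. The explicit rate serves both the
    Poisson and the Gaussian limit. *)
Lemma norm_one_sub_expn (t : R) n : 0 <= t <= 1 ->
  `|(1 - t) ^+ n - expR (- (n%:R * t))| <= n%:R * t ^+ 2.
Proof.
move=> /andP[t0 t1].
rewrite -mulrN expRM_natl (le_trans (norm_exprB _ _ _))//.
- by rewrite ger0_norm; lra.
- by rewrite ger0_norm ?expR_ge0// -expR0 ler_expR oppr_le0.
rewrite ler_wpM2l// distrC ger0_norm; last by rewrite subr_ge0; have := expR_ge1Dx (- t).
have h : expR (- t) <= (1 + t)^-1.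
  by rewrite expRN lef_pV2 ?posrE ?expR_gt0 ?expR_ge1Dx//; lra.
have : (1 + t)^-1 <= 1 - t + t ^+ 2.
  rewrite -[leLHS]mul1r ler_pdivrMr; last by lra.
  have : 0 <= t ^+ 3 by exact: exprn_ge0.
  by rewrite (_ : _ * _ = 1 + t ^+ 3); [lra|ring].
lra.
Qed.

Lemma cvg_invnS (c : R) : c / n.+1%:R @[n --> \oo] --> 0.
Proof. by rewrite -[X in _ --> X](mulr0 c); apply: cvgMr; exact: cvg_harmonic. Qed.

Lemma cvg_sin_div : (sin h / h : R) @[h --> 0^'] --> (1 : R).
Proof.
have /cvg_ex[l hl] : derivable (@sin R) 0 1 by exact: derivable_sin.
have dl : 'D_1 (@sin R) 0 = l by exact/cvg_lim.
have : 'D_1 (@sin R) 0 = 1 by rewrite derive_val cos0.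
rewrite dl => l1; rewrite l1 in hl.
apply: cvg_trans hl; apply: near_eq_cvg; near=> h => /=.
by rewrite sin0 subr0 addr0 mulrC /GRing.scale/= mulr1.
Unshelve. all: by end_near. Qed.

(** By the half-angle formula the cosine is [1 - T n / (n + 1)] with [T n] tending to [b^2 / 2]; its
    power is then compared with [exp (- T n)]. *)
Lemma cvg_cos_expn (b : R) :
  cos (b / Num.sqrt n.+1%:R) ^+ n.+1 @[n --> \oo] --> expR (- (b ^+ 2 / 2)).
Proof.
have [->|b0] := eqVneq b 0.
  rewrite expr0n mul0r oppr0 expR0; apply: cvg_near_cst; near=> n.
  by rewrite mul0r cos0 expr1n.
pose h n : R := b / 2 * (Num.sqrt n.+1%:R)^-1.
have sq n : Num.sqrt n.+1%:R ^+ 2 = n.+1%:R :> R by rewrite sqr_sqrtr.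
have sq0 n : Num.sqrt n.+1%:R != 0 :> R by rewrite gt_eqF// sqrtr_gt0.
have h0 n : h n != 0 by rewrite !mulf_neq0// ?invr_eq0.
have hcvg : h n @[n --> \oo] --> 0.
  rewrite -[X in _ --> X](mulr0 (b / 2)); apply: cvgMr.
  apply/cvgrPdist_le => e e0.
  have e20 : 0 < e ^+ 2 by rewrite exprn_gt0.
  have /cvgrPdist_le/(_ _ e20)[n0 _ hn0] := cvg_invnS 1.
  exists n0 => // n /hn0; rewrite !sub0r !normrN div1r.
  rewrite !ger0_norm ?invr_ge0 ?sqrtr_ge0// => H.
  by rewrite -(@ler_pXn2r _ 2)// ?nnegrE ?invr_ge0 ?sqrtr_ge0// ?(ltW e0)// exprVn sq.
have scvg : sin (h n) / h n @[n --> \oo] --> (1 : R).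
  have /cvgr_dnbhsP := cvg_sin_div; exact.
pose s n := sin (h n) / h n.
pose T n := b ^+ 2 / 2 * s n ^+ 2.
have cvgX2 (u : R^nat) (l : R) : u n @[n --> \oo] --> l -> u n ^+ 2 @[n --> \oo] --> l ^+ 2.
  by move=> ul; exact: cvgM.
have Tcvg : T n @[n --> \oo] --> b ^+ 2 / 2.
  rewrite -[X in _ --> X]mulr1; apply: cvgMr.
  by rewrite -[X in _ --> X](expr1n _ 2); exact: cvgX2.
have cosE n : cos (b / Num.sqrt n.+1%:R) = 1 - T n / n.+1%:R.
  have -> : b / Num.sqrt n.+1%:R = h n *+ 2.
    by rewrite mulr2n -mulrDl -splitr.
  rewrite cos_mulr2n cos2sin2 /T /s.
  rewrite -[in RHS](sq n) /h; have := sq0 n; set r := Num.sqrt _ => r0.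
  by field; rewrite r0 b0.
have Tn0 n : 0 <= T n by rewrite mulr_ge0 ?divr_ge0 ?sqr_ge0.
have ecvg : expR (- T n) @[n --> \oo] --> expR (- (b ^+ 2 / 2)).
  by apply: continuous_cvg; [exact: continuous_expR|exact: cvgN].
have dcvg : cos (b / Num.sqrt n.+1%:R) ^+ n.+1 - expR (- T n) @[n --> \oo] --> 0.
  have Tc : T n ^+ 2 / n.+1%:R @[n --> \oo] --> 0.
    rewrite -[X in _ --> X](mulr0 ((b ^+ 2 / 2) ^+ 2)); apply: cvgM; first exact: cvgX2.
    by have := cvg_invnS 1; under eq_fun do rewrite div1r.
  have Tc1 : T n / n.+1%:R @[n --> \oo] --> 0.
    rewrite -[X in _ --> X](mulr0 (b ^+ 2 / 2)); apply: cvgM => //.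
    by have := cvg_invnS 1; under eq_fun do rewrite div1r.
  apply/norm_cvg0P.
  apply: (squeeze_cvgr _ (cvg_cst 0) Tc).
  have /cvgrPdist_le/(_ _ ltr01) := Tc1; apply: filterS => n.
  rewrite sub0r normrN ger0_norm ?divr_ge0// => tn.
  rewrite normr_ge0/= cosE -[X in expR (- X)](divfK (_ : n.+1%:R != 0)) ?pnatr_eq0//.
  rewrite [X in expR (- X)]mulrC (le_trans (norm_one_sub_expn _ _)) ?divr_ge0//.
  move: (T n) (n.+1%:R) (lt0r_neq0 (ltr0Sn R n)) => x y y0.
  by rewrite le_eqVlt; apply/orP; left; apply/eqP; field.
rewrite -[X in _ --> X]add0r.
rewrite (_ : (fun n => _) = fun n => (cos (b / Num.sqrt n.+1%:R) ^+ n.+1 - expR (- T n)) + expR (- T n)).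
  exact: cvgD.
by apply/funext => n; rewrite subrK.
Unshelve. all: by end_near. Qed.

End Limits.

(** * Compound Poisson and Gaussian limits *)

Section GoodLimits.
Context {R : realType} {m : nat}.
Notation V := 'rV[R]_m.
Variable th : R.
Hypothesis th0 : 0 < th.
Notation good := (@good R m th).

(** Compound Poisson law of rate [w], as the limit of [n + K] independent trials, each drawing from
    [phi] with probability [p n] and adding nothing otherwise. *)
Lemma good_compound (phi : option V -> R) (w : R) : 0 <= w -> good phi ->
  good (fun o => expR (- (w * (1 - phi o)))).
Proof.
move=> w0 gphi.
(* [K > 2 w] forces [p n <= 1/2], hence [p n * (1 - phi o)] lies in [[0, 1]] even when [phi o] is
   close to [-1]. *)
pose K := (Num.trunc (2 * w)).+1.
have Kw : 2 * w < K%:R by rewrite /K truncnS_gt.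
pose p n : R := w / (n + K)%:R.
have nK n : 0 < (n + K)%:R :> R by rewrite ltr0n addnS.
have pn n : 0 <= p n /\ p n <= 2^-1.
  split; first by rewrite divr_ge0// ltW.
  by rewrite ler_pdivrMr// natrD; have : 0 <= n%:R :> R by []; lra.
apply: (@good_lim _ _ th (fun n o => ((1 - p n) * 1 + p n * phi o) ^+ (n + K))).
  move=> n; apply: good_exp => //; apply: good_mix => //; last exact: good_one.
  by have [-> /=] := pn n; lra.
move=> o.
have phi1 : `|phi o| <= 1 by exact: (good_norm_le1 th0 _ gphi).
have := phi1; rewrite ler_norml => /andP[phia phib].
apply/cvgrPdist_le => e e0.
have /cvgrPdist_le/(_ _ e0)[n0 _ h0] := cvg_invnS (4 * w ^+ 2).
exists n0 => // n /h0; rewrite sub0r normrN => h.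
pose t := p n * (1 - phi o).
have [p0 p2] := pn n.
have t01 : 0 <= t <= 1 by rewrite /t; apply/andP; split; nra.
rewrite distrC (_ : _ + _ = 1 - t); last by rewrite /t; ring.
rewrite (_ : w * _ = (n + K)%:R * t); last first.
  by rewrite /t /p; field; rewrite -natrD gt_eqF.
rewrite (le_trans (norm_one_sub_expn _ _))// (le_trans _ h)//.
rewrite ger0_norm ?divr_ge0 ?mulr_ge0 ?sqr_ge0//.
rewrite /t (_ : _ * _ = (w ^+ 2 * (1 - phi o) ^+ 2) / (n + K)%:R); last first.
  by rewrite /p; field; rewrite -natrD gt_eqF.
rewrite ler_pM ?invr_ge0//; first by rewrite mulr_ge0 ?sqr_ge0.
  by rewrite mulrC ler_wpM2r ?sqr_ge0//; nra.
by rewrite lef_pV2 ?posrE ?nK// ler_nat -addn1 leq_add2l.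
Qed.

(** Central limit theorem for [n + 1] jumps [y / sqrt (n + 1)]. Their squared bounds always add up
    to [rho^2], so the [None] component is constant along the sequence. *)
Lemma good_gauss (y : V) (rho : R) : (forall i, `|y ord0 i| <= rho) ->
  good (fun o => expR (- (if o is Some a then dot a y ^+ 2 / 2 else th * rho ^+ 2))).
Proof.
move=> yr.
pose c n : R := (Num.sqrt n.+1%:R)^-1.
apply: (@good_lim _ _ th (fun n o => (if o is Some a then cos (dot a (c n *: y))
    else expR (- (th * (c n * rho) ^+ 2))) ^+ n.+1)).
  move=> n; apply: good_exp => //; apply: good_jump => // i.
  by rewrite mxE normrM ger0_norm ?invr_ge0 ?sqrtr_ge0// ler_wpM2l ?invr_ge0 ?sqrtr_ge0.
case=> [a|].
  rewrite (_ : (fun n => _) = fun n => cos (dot a y / Num.sqrt n.+1%:R) ^+ n.+1).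
    exact: cvg_cos_expn.
  by apply/funext => n; rewrite dotZr mulrC.
rewrite (_ : (fun n => _) = fun n => expR (- (th * rho ^+ 2))); first exact: cvg_cst.
apply/funext => n; rewrite -expRM_natl; congr expR.
rewrite /c exprMn exprVn sqr_sqrtr//; field.
by rewrite ?nat1r ?natr1 pnatr_eq0.
Qed.

End GoodLimits.

(** * Fractional powers *)

Section FractionalPower.
Context {R : realType}.
Variables (b l : R).
Hypothesis b01 : 0 < b < 1.
Hypothesis l0 : 0 < l.

(** Integrand, in the variable [x = ln r], of the integral of [r^(-1-b) (1 - exp (- r u))] over
    [r > 0], which is a constant times [u^b]. *)
Definition pow_term (x u : R) : R := expR (- (b * x)) * (1 - expR (- (expR x * u))).

(** Symmetric partial sums over the lattice of mesh [l]. The lattice replaces the integral: for a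
    fixed [l] the full sum already scales like [u^b] when [u] is multiplied by [exp l]. *)
Definition pow_sum K (u : R) : R :=
  \sum_(0 <= k < K) (pow_term (k%:R * l) u + pow_term (- (k.+1%:R * l)) u).

Lemma pow_term_ge0 x u : 0 <= u -> 0 <= pow_term x u.
Proof.
move=> u0; rewrite mulr_ge0 ?expR_ge0// subr_ge0 -expR0 ler_expR oppr_le0.
by rewrite mulr_ge0 ?expR_ge0.
Qed.

Lemma pow_term_le x u v : u <= v -> pow_term x u <= pow_term x v.
Proof.
move=> uv; rewrite ler_wpM2l ?expR_ge0// lerB// ler_expR lerN2.
by rewrite ler_wpM2l ?expR_ge0.
Qed.

Lemma pow_term_scale x u : pow_term x (expR l * u) = expR (b * l) * pow_term (x + l) u.
Proof.
rewrite /pow_term [RHS]mulrA -[in RHS]expRD [expR (x + l)]expRD -[in RHS]mulrA.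
by congr (expR _ * _); ring.
Qed.

Lemma pow_term_le_pos k u : 0 <= u -> pow_term (k%:R * l) u <= expR (- (b * l)) ^+ k.
Proof.
move=> u0; rewrite -expRM_natl /pow_term (_ : - (b * (k%:R * l)) = k%:R * - (b * l)); last by ring.
by rewrite -[leRHS]mulr1 ler_wpM2l ?expR_ge0// gerBl expR_ge0.
Qed.

(** Here [1 - exp (- y) <= y] is used. Summability at this end rests on [b < 1], at the positive end
    on [0 < b]. *)
Lemma pow_term_le_neg k u : 0 <= u ->
  pow_term (- (k%:R * l)) u <= u * expR (- ((1 - b) * l)) ^+ k.
Proof.
move=> u0; rewrite -expRM_natl /pow_term.
have h := expR_ge1Dx (- (expR (- (k%:R * l)) * u)).
rewrite (_ : k%:R * - ((1 - b) * l) = - (b * - (k%:R * l)) + - (k%:R * l)); last by ring.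
rewrite [in leRHS]expRD mulrCA ler_wpM2l ?expR_ge0// [leRHS]mulrC; lra.
Qed.

Lemma pow_sum_homo u : 0 <= u -> {homo pow_sum^~ u : n k / (n <= k)%N >-> n <= k}.
Proof.
move=> u0; apply/nondecreasing_seqP => n; rewrite /pow_sum big_nat_recr//= lerDl.
by rewrite addr_ge0 ?pow_term_ge0.
Qed.

Lemma sum_geometric_le (q : R) K : 0 <= q < 1 -> \sum_(0 <= k < K) q ^+ k <= (1 - q)^-1.
Proof.
move=> /andP[q0 q1]; rewrite -[leRHS]mul1r ler_pdivlMr ?subr_gt0//.
rewrite big_mkord mulrC -[X in _ <= X]opprK -[X in X <= _]opprK lerN2 -mulNr opprB -subrX1.
by rewrite lerBrDl subrr exprn_ge0.
Qed.

Let q1_lt1 : 0 <= expR (- (b * l)) < 1.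
Proof.
have /andP[b0 b1] := b01.
by rewrite expR_ge0 -[X in _ < X]expR0 ltr_expR oppr_lt0 mulr_gt0.
Qed.

Let q2_lt1 : 0 <= expR (- ((1 - b) * l)) < 1.
Proof.
have /andP[b0 b1] := b01.
by rewrite expR_ge0 -[X in _ < X]expR0 ltr_expR oppr_lt0 mulr_gt0// subr_gt0.
Qed.

Lemma pow_sum_le K u : 0 <= u -> pow_sum K u <=
  (1 - expR (- (b * l)))^-1 + u * (1 - expR (- ((1 - b) * l)))^-1.
Proof.
move=> u0; rewrite /pow_sum big_split/=; apply: lerD.
  apply: le_trans (sum_geometric_le K q1_lt1).
  by apply: ler_sum => k _; exact: pow_term_le_pos.
apply: le_trans (ler_wpM2l u0 (sum_geometric_le K q2_lt1)).
rewrite mulr_sumr; apply: ler_sum => k _; apply: (le_trans (pow_term_le_neg k.+1 u0)).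
rewrite ler_wpM2l// exprS -[leRHS]mul1r ler_wpM2r ?exprn_ge0 ?expR_ge0//.
by have /andP[_ /ltW] := q2_lt1.
Qed.

Lemma is_cvg_pow_sum u : 0 <= u -> cvgn (pow_sum^~ u).
Proof.
move=> u0; apply: nondecreasing_is_cvgn; first exact: pow_sum_homo.
by eexists => _ [K _ <-]; exact: pow_sum_le.
Qed.

Definition pow_lim u := limn (pow_sum^~ u).

Lemma pow_lim_le u v : 0 <= u -> u <= v -> pow_lim u <= pow_lim v.
Proof.
move=> u0 uv; apply: ler_lim; [exact: is_cvg_pow_sum|apply: is_cvg_pow_sum|].
  exact: le_trans uv.
by apply: nearW => K; apply: ler_sum => k _; rewrite lerD// pow_term_le.
Qed.

Lemma pow_lim1_gt0 : 0 < pow_lim 1.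
Proof.
apply: (@lt_le_trans _ _ (pow_sum 1 1)); last first.
  by apply: nondecreasing_cvgn_le; [exact: pow_sum_homo|exact: is_cvg_pow_sum].
rewrite /pow_sum big_nat1 ltr_pwDl ?pow_term_ge0// /pow_term !mul0r mulr0 oppr0 expR0.
by rewrite !mul1r subr_gt0 -[ltRHS]expR0 ltr_expR oppr_lt0.
Qed.

Lemma pow_lim0 : pow_lim 0 = 0.
Proof.
rewrite /pow_lim (_ : pow_sum^~ 0 = fun=> 0); first exact: lim_cst.
apply/funext => K; rewrite /pow_sum big1// => k _.
by rewrite /pow_term !mulr0 oppr0 expR0 subrr !mulr0 addr0.
Qed.

(** Multiplying [u] by [exp l] shifts the lattice by one step, so that only two boundary terms are
    exchanged; they vanish in the limit. *)
Lemma pow_sum_scale K u : pow_sum K (expR l * u) =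
  expR (b * l) * (pow_sum K u + pow_term (K%:R * l) u - pow_term (- (K%:R * l)) u).
Proof.
rewrite /pow_sum; elim: K => [|K IH].
  by rewrite !big_geq// !mul0r oppr0 add0r subrr mulr0.
rewrite !big_nat_recr//= IH !pow_term_scale.
have -> : K%:R * l + l = K.+1%:R * l by rewrite -natr1 mulrDl mul1r.
have -> : - (K.+1%:R * l) + l = - (K%:R * l) by rewrite -natr1 mulrDl mul1r opprD subrK.
move: (pow_term (K%:R * l) u) (pow_term (- (K%:R * l)) u) => x y.
move: (pow_term (K.+1%:R * l) u) (pow_term (- (K.+1%:R * l)) u) => z t.
move: (expR _) (\sum_(_ <= _ < _) _) => c S; ring.
Qed.

Lemma pow_lim_scale u : 0 <= u -> pow_lim (expR l * u) = expR (b * l) * pow_lim u.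
Proof.
move=> u0; apply/cvg_lim => //.
rewrite (_ : pow_sum^~ _ = fun K => expR (b * l) *
    (pow_sum K u + pow_term (K%:R * l) u - pow_term (- (K%:R * l)) u)); last first.
  by apply/funext => K; rewrite pow_sum_scale.
apply: cvgMr; rewrite -[X in _ --> X]subr0 -[X in _ --> X - _]addr0.
apply: cvgB; first apply: cvgD; first exact: is_cvg_pow_sum.
- have : expR (- (b * l)) ^+ K @[K --> \oo] --> 0.
    by apply: cvg_expr; have /andP[h1 h2] := q1_lt1; rewrite ger0_norm.
  apply: (squeeze_cvgr _ (cvg_cst 0)).
  by apply: nearW => K; rewrite pow_term_ge0//= pow_term_le_pos.
- have : u * expR (- ((1 - b) * l)) ^+ K @[K --> \oo] --> 0.
    rewrite -[X in _ --> X](mulr0 u); apply: cvgMr; apply: cvg_expr.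
    by have /andP[h1 h2] := q2_lt1; rewrite ger0_norm.
  apply: (squeeze_cvgr _ (cvg_cst 0)).
  by apply: nearW => K; rewrite pow_term_ge0//= pow_term_le_neg.
Qed.

Lemma pow_lim_scalen n u : 0 <= u ->
  pow_lim (expR (n%:R * l) * u) = expR (n%:R * (b * l)) * pow_lim u.
Proof.
move=> u0; elim: n => [|n IH]; first by rewrite !mul0r expR0 !mul1r.
rewrite (_ : n.+1%:R * l = l + n%:R * l); last by rewrite -natr1; ring.
rewrite expRD -mulrA pow_lim_scale; last by rewrite mulr_ge0 ?expR_ge0.
rewrite IH mulrA -expRD.
by congr (expR _ * _); rewrite -natr1; ring.
Qed.

Lemma pow_lim_expz (j : int) : pow_lim (expR (j%:~R * l)) = expR (j%:~R * (b * l)) * pow_lim 1.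
Proof.
case: (intP j) => [|n|n].
- by rewrite !mul0r !expR0 mul1r.
- by have := pow_lim_scalen n.+1 ler01; rewrite mulr1.
- have := pow_lim_scalen n.+1 (expR_ge0 ((- n.+1%:Z)%:~R * l)).
  rewrite -expRD mulrNz !mulNr subrr expR0 => ->.
  by rewrite mulrA -expRD addrC subrr expR0 mul1r.
Qed.

(** Scaling is exact on the powers of [exp l]. Monotonicity between two consecutive ones costs a
    factor [exp (b * l)], which tends to 1 with the mesh. *)
Lemma pow_lim_bounds u : 0 <= u ->
  expR (- (b * l)) * u `^ b <= pow_lim u / pow_lim 1 <= expR (b * l) * u `^ b.
Proof.
rewrite le_eqVlt => /predU1P[<-|u0].
  have /andP[b0 _] := b01.
  by rewrite pow_lim0 mul0r powR0 ?mulr0 ?lexx// gt_eqF.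
have u0' := ltW u0.
have L1 := pow_lim1_gt0.
pose j := Num.floor (ln u / l).
have /andP[j1 j2] := floor_itv (ln u / l).
rewrite ler_pdivlMr// in j1; rewrite ltr_pdivrMr// in j2.
have uE : u = expR (ln u) by rewrite lnK.
have bE : u `^ b = expR (b * ln u) by rewrite /powR gt_eqF.
have /andP[b0 _] := b01.
rewrite ler_pdivlMr// ler_pdivrMr// bE.
have lo : pow_lim (expR (j%:~R * l)) <= pow_lim u.
  by apply: pow_lim_le; rewrite ?expR_ge0// [leRHS]uE ler_expR.
have hi : pow_lim u <= pow_lim (expR ((j + 1)%:~R * l)).
  by apply: pow_lim_le => //; rewrite [leLHS]uE ler_expR ltW.
apply/andP; split.
  apply: le_trans lo; rewrite pow_lim_expz ler_wpM2r ?(ltW L1)// -expRD ler_expR.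
  have := ler_wpM2l (ltW b0) (ltW j2); rewrite intrD mulr1z; lra.
apply: (le_trans hi); rewrite pow_lim_expz ler_wpM2r ?(ltW L1)// -expRD ler_expR.
by rewrite intrD mulr1z mulrDl mul1r addrC lerD2l mulrCA ler_wpM2l// ltW.
Qed.

End FractionalPower.

(** * Fractional powers of good exponents *)

Section GoodPower.
Context {R : realType} {m : nat}.
Notation V := 'rV[R]_m.
Variable th : R.
Hypothesis th0 : 0 < th.
Notation good := (@good R m th).

(** Subordination: the exponents [s * u], compounded over a discretised [b]-stable measure of [s]
    and normalised by the value at [u = 1], tend to [w * u^b] as the mesh shrinks. *)
Lemma good_powR (b : R) (u : option V -> R) : 0 < b < 1 -> (forall o, 0 <= u o) ->
  (forall s, 0 <= s -> good (fun o => expR (- (s * u o)))) ->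
  forall w, 0 <= w -> good (fun o => expR (- (w * u o `^ b))).
Proof.
move=> b01 u0 gu w w0.
have term x t : 0 <= t -> good (fun o => expR (- (t * pow_term b x (u o)))).
  move=> t0; have := @good_compound _ _ _ th0 _ (t * expR (- (b * x))) _ (gu _ (expR_ge0 x)).
  move=> /(_ (mulr_ge0 t0 (expR_ge0 _))) g.
  by apply: (good_ext g) => o; rewrite /pow_term mulrA.
have psum l K t : 0 <= t -> good (fun o => expR (- (t * pow_sum b l K (u o)))).
  move=> t0; elim: K => [|K IH].
    apply: (good_ext (good_one th)) => o.
    by rewrite /pow_sum big_geq// mulr0 oppr0 expR0.
  apply: (good_ext (good_mul th0 IH (good_mul th0 (term (K%:R * l) t t0) (term (- (K.+1%:R * l)) t t0)))) => o.
  by rewrite -!expRD /pow_sum big_nat_recr//=; congr expR; ring.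
have plim l t : 0 < l -> 0 <= t -> good (fun o => expR (- (t * pow_lim b l (u o)))).
  move=> l0 t0; apply: (good_lim (fun K => psum l K t t0)) => o.
  apply: continuous_cvg; first exact: continuous_expR.
  by apply: cvgN; apply: cvgMr; exact: is_cvg_pow_sum.
pose l n : R := n.+1%:R^-1.
have l0 n : 0 < l n by rewrite invr_gt0.
apply: (good_lim (fun n => plim (l n) (w / pow_lim b (l n) 1) (l0 n) _)).
  by move=> n; rewrite divr_ge0// ltW// pow_lim1_gt0.
move=> o; apply: continuous_cvg; first exact: continuous_expR.
apply: cvgN; rewrite (_ : (fun n => _) = fun n => w * (pow_lim b (l n) (u o) / pow_lim b (l n) 1)); last first.
  by apply/funext => n; rewrite mulrAC mulrA.
apply: cvgMr.
have expl (c : R) : expR (c * l n) * u o `^ b @[n --> \oo] --> u o `^ b.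
  rewrite -[X in _ --> X]mul1r; apply: cvgMl; rewrite -expR0.
  apply: continuous_cvg; first exact: continuous_expR.
  rewrite -[X in _ --> X](mulr0 c); apply: cvgMr; exact: cvg_harmonic.
have := expl (- b); have := expl b => h2 h1.
apply: (squeeze_cvgr _ h1 h2).
by apply: nearW => n; rewrite mulNr; exact: pow_lim_bounds.
Qed.

(** Two independent Gaussians along [p] and [q], the real and imaginary parts of a kernel value, are
    subordinated together. Each contributes [2 * s * g^2] to [Q], whence the 4 in the Laplace
    exponent. *)
Lemma good_quadratic_powR (b g : R) (p q : V) : 0 < b < 1 ->
  (forall i, `|p ord0 i| <= g) -> (forall i, `|q ord0 i| <= g) ->
  forall w, 0 <= w -> good (fun o => expR (- (w *
    (if o is Some a then dot a p ^+ 2 + dot a q ^+ 2 else 4 * th * g ^+ 2) `^ b))).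
Proof.
move=> b01 pg qg; apply: good_powR => //.
  by case=> [a|]; [rewrite addr_ge0 ?sqr_ge0|rewrite mulr_ge0 ?sqr_ge0// mulr_ge0 ?(ltW th0)].
move=> s s0; pose r := Num.sqrt (2 * s).
have r0 : 0 <= r by exact: sqrtr_ge0.
have rs : r ^+ 2 = 2 * s by rewrite sqr_sqrtr// mulr_ge0.
have gs (y : V) : (forall i, `|y ord0 i| <= g) ->
    good (fun o => expR (- (if o is Some a then dot a (r *: y) ^+ 2 / 2 else th * (r * g) ^+ 2))).
  move=> yg; apply: good_gauss => // i.
  by rewrite mxE normrM (ger0_norm r0) ler_wpM2l.
apply: (good_ext (good_mul th0 (gs p pg) (gs q qg))) => -[a|]; rewrite -expRD; congr expR.
  by rewrite !dotZr !exprMn rs; field.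
by rewrite !exprMn rs; ring.
Qed.

End GoodPower.

(** * Barycenters *)

Section Barycenter.
Context {R : realType} {d : measure_display} {T : measurableType d}.
Variables (mu : {measure set T -> \bar R}) (p : nat) (h : 'I_p -> T -> R).
Hypothesis ih : forall j, mu.-integrable setT (EFin \o h j).

Let I j := \int[mu]_x h j x.
Let comb (r : seq (R * T)) (j : 'I_p) := \sum_(z <- r) z.1 * h j z.2.
Let wf (r : seq (R * T)) := all (fun z => 0 <= z.1) r.
Let dist2 (v : 'I_p -> R) := \sum_j (v j - I j) ^+ 2.
Let D := [set dist2 (comb r) | r in [set r | wf r]].

Let D_lb : lbound D 0.
Proof. by move=> _ [r _ <-]; apply: sumr_ge0 => j _; exact: sqr_ge0. Qed.

Let D_inf : has_inf D.
Proof. by split; [exists (dist2 (comb [::])), [::]|exists 0]. Qed.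

Let D_le r : wf r -> inf D <= dist2 (comb r).
Proof. by move=> wr; apply: (ge_inf D_inf.2); exists r. Qed.

Lemma integrable_sumR (f : 'I_p -> T -> R) : (forall j, mu.-integrable setT (EFin \o f j)) ->
  mu.-integrable setT (EFin \o (fun x => \sum_j f j x)).
Proof.
move=> fi; have := integrable_sum measurableT (index_enum 'I_p) (P := xpredT) (fun j _ => fi j).
by apply: eq_integrable => // x _ /=; rewrite sumEFin.
Qed.

Lemma Rintegral_sum (f : 'I_p -> T -> R) : (forall j, mu.-integrable setT (EFin \o f j)) ->
  \int[mu]_x (\sum_j f j x) = \sum_j \int[mu]_x f j x.
Proof.
move=> fi; rewrite /Rintegral.
under eq_integral do rewrite -sumEFin.
rewrite integral_sum// -sum_fine// => j _.
by apply: integrable_fin_num => //; exact: fi.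
Qed.

Let H x := \sum_j `|h j x|.
Let IH := \int[mu]_x H x.

Let iH : mu.-integrable setT (EFin \o H).
Proof.
apply: (@integrable_sumR (fun j x => `|h j x|)) => j.
exact: integrable_norm.
Qed.

Let H0 x : 0 <= H x. Proof. by apply: sumr_ge0. Qed.

Let sumsq_le x : \sum_j h j x ^+ 2 <= H x ^+ 2.
Proof.
rewrite expr2 /H mulr_suml; apply: ler_sum => j _.
rewrite -real_normK ?num_real// expr2 ler_wpM2l//.
by rewrite (bigD1 j)//= lerDl sumr_ge0.
Qed.

Let dist2D (v w : 'I_p -> R) t : dist2 (fun j => v j + t * w j) =
  dist2 v + 2 * t * (\sum_j (v j - I j) * w j) + t ^+ 2 * \sum_j w j ^+ 2.
Proof.
rewrite /dist2 !mulr_sumr -!big_split/=; apply: eq_bigr => j _; ring.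
Qed.

(* First-order optimality of a near-minimizer [v] of the distance to [I] over
   the cone: moving towards [h x] or rescaling [v] gains almost nothing. *)
Let near_min e r : 0 < e -> e <= 1 -> wf r -> dist2 (comb r) < inf D + e ^+ 2 ->
  dist2 (comb r) <= e * (1 + inf D + \sum_j I j ^+ 2 + 1 + IH).
Proof.
move=> e0 e1 wr rD; set v := comb r in rD *.
have step1 x : - (e * H x) <= \sum_j (v j - I j) * h j x.
  have [Hx|Hx] := eqVneq (H x) 0.
    rewrite big1 ?Hx ?mulr0 ?oppr0// => j _.
    have /eqP : `|h j x| = 0.
      apply/eqP; rewrite eq_le normr_ge0 andbT -Hx /H (bigD1 j)//= lerDl.
      exact: sumr_ge0.
    by rewrite normr_eq0 => /eqP ->; rewrite mulr0.
  have Hx0 : 0 < H x by rewrite lt_neqAle eq_sym Hx H0.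
  (* [H x] bounds the Euclidean norm of [h x], so the displacement [t * h x] has length at most
     [e]. *)
  pose t := e / H x; have t0 : 0 < t by rewrite divr_gt0.
  have : inf D <= dist2 (fun j => v j + t * h j x).
    rewrite (_ : (fun j => _) = comb ((t, x) :: r)); last first.
      by apply/funext => j; rewrite /comb big_cons addrC.
    by apply: D_le; rewrite /wf /= ltW.
  rewrite dist2D => h1.
  have h2 := sumsq_le x; have t20 : 0 <= t ^+ 2 by exact: sqr_ge0.
  have h3 : t ^+ 2 * (\sum_j h j x ^+ 2) <= e ^+ 2.
    rewrite (le_trans (ler_wpM2l t20 h2))// -exprMn /t divfK//.
  set S := \sum_j (v j - I j) * h j x in h1 *.
  have h4 : 0 <= 2 * t * S + 2 * e ^+ 2 by lra.
  have h5 : t * H x = e by rewrite /t divfK.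
  have : 0 <= t * (S + e * H x) by rewrite mulrDr [t * (e * _)]mulrCA h5; lra.
  by rewrite pmulr_rge0//; lra.
have step2 : - (e * IH) <= \sum_j (v j - I j) * I j.
  rewrite -mulNr -RintegralZl//.
  have ivh j : mu.-integrable setT (EFin \o (fun x => (v j - I j) * h j x)).
    by apply: eq_integrable (integrableZl measurableT (v j - I j) (ih j)).
  have -> : \sum_j (v j - I j) * I j = \int[mu]_x \sum_j (v j - I j) * h j x.
    by rewrite Rintegral_sum//; apply: eq_bigr => j _; rewrite RintegralZl.
  apply: le_Rintegral => //.
  - by apply: eq_integrable (integrableZl measurableT (- e) iH).
  - exact: integrable_sumR.
  - by move=> x _; rewrite mulNr.
set v2 := \sum_j v j ^+ 2.
have step3 : \sum_j (v j - I j) * v j <= (e + e * v2) / 2.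
  have : inf D <= dist2 (fun j => v j + (- e) * v j).
    rewrite (_ : (fun j => _) = comb [seq ((1 - e) * z.1, z.2) | z <- r]); last first.
      apply/funext => j; rewrite /comb big_map /= /v /comb mulr_sumr -big_split.
      by apply: eq_bigr => z _; rewrite /=; ring.
    apply: D_le; rewrite /wf all_map; apply/allP => z zr /=.
    by rewrite mulr_ge0 ?subr_ge0//; move/allP : wr => /(_ z zr).
  rewrite dist2D -/v2 => h1.
  set S := \sum_j (v j - I j) * v j in h1 *.
  have : 0 <= e * (e + e * v2 - 2 * S) by lra.
  by rewrite pmulr_rge0//; lra.
have v2_le : v2 <= 2 * dist2 v + 2 * \sum_j I j ^+ 2.
  rewrite /v2 /dist2 !mulr_sumr -big_split/=; apply: ler_sum => j _.
  have := sqr_ge0 (v j - 2 * I j); lra.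
have -> : dist2 v = \sum_j (v j - I j) * v j - \sum_j (v j - I j) * I j.
  by rewrite /dist2 -sumrB; apply: eq_bigr => j _; ring.
have e21 : e ^+ 2 <= 1 by rewrite expr_le1// ltW.
have : e * v2 <= e * (2 * (inf D + 1) + 2 * \sum_j I j ^+ 2).
  by rewrite ler_wpM2l ?(ltW e0)//; lra.
move: (\sum_j I j ^+ 2) => I2; lra.
Qed.

(** [near_min] bounds the squared distance itself by a multiple of [e'], so the infimum over the
    cone is zero. A cone replaces the convex hull because [mu] may be infinite, and one list of
    points serves all [j], as simultaneous tests require. *)
Lemma barycenter (e : R) : 0 < e -> exists r : seq (R * T),
  (forall z, List.In z r -> 0 <= z.1) /\
  forall j, `|\sum_(z <- r) z.1 * h j z.2 - \int[mu]_x h j x| <= e.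
Proof.
move=> e0.
have infD0 : 0 <= inf D by apply: lb_le_inf; [exact: D_inf.1|exact: D_lb].
set C := 1 + inf D + \sum_j I j ^+ 2 + 1 + IH.
have C0 : 0 < C.
  have : 0 <= IH by apply: Rintegral_ge0.
  have : 0 <= \sum_j I j ^+ 2 by apply: sumr_ge0 => j _; exact: sqr_ge0.
  rewrite /C; lra.
pose e' := Num.min 1 (e ^+ 2 / C).
have e'0 : 0 < e' by rewrite lt_min ltr01 divr_gt0// exprn_gt0.
have [_ [r wr <-] rD] := inf_adherent (exprn_gt0 2 e'0) D_inf.
exists r; split.
  move=> z; rewrite /wf in wr; elim: r wr {rD} => //= y r IHr /andP[y0 wr] [<-//|zr].
  exact: IHr.
have e'1 : e' <= 1 by rewrite ge_min lexx.
have := near_min e'0 e'1 wr rD; rewrite -/C => h1 j.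
have h2 : dist2 (comb r) <= e ^+ 2.
  by rewrite (le_trans h1)// -ler_pdivlMr// ge_min lexx orbT.
rewrite -(@ler_pXn2r _ 2)// ?nnegrE ?(ltW e0)// real_normK ?num_real//.
rewrite (le_trans _ h2)// /dist2 (bigD1 j)//= lerDl.
by apply: sumr_ge0 => i _; exact: sqr_ge0.
Qed.

End Barycenter.

(** * Exponents given by integrals *)

Section GoodIntegral.
Context {R : realType} {m : nat}.
Notation V := 'rV[R]_m.
Variable th : R.
Hypothesis th0 : 0 < th.
Notation good := (@good R m th).

(** The finite list [A] of tests indexes the vector integrand of [barycenter], which replaces the
    integral by a finite sum of good exponents. *)
Lemma good_integral d (T : measurableType d) (mu : {measure set T -> \bar R})
    (k : option V -> T -> R) :
  (forall o x, 0 <= k o x) ->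
  (forall o, mu.-integrable setT (EFin \o k o)) ->
  (forall x w, 0 <= w -> good (fun o => expR (- (w * k o x)))) ->
  good (fun o => expR (- \int[mu]_x k o x)).
Proof.
move=> k0 ik gk A e e0; have e20 : 0 < e / 2 by rewrite divr_gt0.
have [r [r0 hr]] := barycenter (h := fun j : 'I_(size A) => k (tnth (in_tuple A) j))
  (fun j => ik _) e20.
have gr : good (fun o => expR (- \sum_(z <- r) z.1 * k o z.2)).
  elim: r r0 {hr} => [|z r IH] r0.
    by apply: (good_ext (good_one th)) => o; rewrite big_nil oppr0 expR0.
  have gz := gk z.2 z.1 (r0 z (or_introl erefl)).
  have gr := IH (fun y yr => r0 y (or_intror yr)).
  by apply: (good_ext (good_mul th0 gz gr)) => o; rewrite big_cons opprD expRD.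
have [L aL hL] := gr A _ e20; exists L => // o oA.
rewrite -(subrK (expR (- \sum_(z <- r) z.1 * k o z.2)) (L _)) -addrA.
rewrite (le_trans (ler_normD _ _))// [leRHS]splitr lerD ?hL//.
rewrite (le_trans (norm_expR_opp_sub _ _))//.
- elim: r r0 {hr gr hL} => [|z r IH] r0; first by rewrite big_nil.
  rewrite big_cons addr_ge0 ?mulr_ge0 ?r0//; first by left.
  by apply: IH => y yr; apply: r0; right.
- exact: Rintegral_ge0.
- have /tnthP[j ->] : o \in in_tuple A by [].
  exact: hr.
Qed.

End GoodIntegral.

(** * Tail estimate *)

Section CosineKernel.
Context {R : realType}.

(** A smoothed indicator whose expectation involves finitely many characteristic values. With
    [c x = (1 + cos (om * x)) / 2] and [k] of order [1 / (de * c v ^+ n)], the power [(1 - c^n)^k]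
    is small up to [v], while beyond [2 v] the kernel is at most [k * c^n]. Periodicity limits the
    control to [La]. *)
Lemma cosine_kernel (v La de : R) : 0 < v -> 2 * v < La -> 0 < de ->
  exists om n k, let ka x := 1 - (1 - ((1 + cos (om * x)) / 2) ^+ n) ^+ k in
  [/\ forall x, 0 <= ka x <= 1, forall x, `|x| <= v -> 1 - de <= ka x &
      forall x, 2 * v <= `|x| <= La -> ka x <= de].
Proof.
move=> v0 vL d0.
have L0 : 0 < La by lra.
pose om := pi / La; have om0 : 0 < om by rewrite divr_gt0 ?pi_gt0.
have omL : om * La = pi by rewrite divfK// gt_eqF.
pose c (x : R) := (1 + cos (om * x)) / 2.
have c01 x : 0 <= c x <= 1.
  by rewrite /c; have := cos_geN1 (om * x); have := cos_le1 (om * x); lra.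
have cN x : c `|x| = c x.
  have [->//|->] : `|x| = x \/ `|x| = - x by case: (ler0P x); [right|left].
  by rewrite /c mulrN cosN.
have itv x : 0 <= x <= La -> om * x \in `[0, pi]%R.
  by move=> /andP[x0 xL]; rewrite in_itv/= -omL (mulr_ge0 (ltW om0) x0)/= ler_pM2l.
have cle x y : 0 <= x <= La -> 0 <= y <= La -> x <= y -> c y <= c x.
  move=> xL yL; rewrite le_eqVlt => /predU1P[->//|xy].
  have : cos (om * y) < cos (om * x) by rewrite (ltr_cos (itv _ xL) (itv _ yL)) ltr_pM2l.
  by rewrite /c; lra.
have vL' : 0 <= v <= La by lra.
have v2L' : 0 <= 2 * v <= La by lra.
have c1 : 0 < c v.
  have : cos pi < cos (om * v).
    by rewrite (ltr_cos (itv _ vL')) ?in_itv/= ?pi_ge0 ?lexx// -omL ltr_pM2l//; lra.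
  by rewrite cospi /c; lra.
have c0 : c (2 * v) < c v.
  have : cos (om * (2 * v)) < cos (om * v).
    by rewrite (ltr_cos (itv _ vL') (itv _ v2L')) ltr_pM2l//; lra.
  by rewrite /c; lra.
have c00 := c01 (2 * v); have c11 := c01 v.
pose K := de^-1; have K0 : 0 < K by rewrite invr_gt0.
have eK : expR (- K) <= de.
  rewrite expRN -[leRHS]invrK lef_pV2 ?posrE ?expR_gt0 ?invr_gt0//.
  by rewrite (le_trans _ (expR_ge1Dx _))// lerDr.
(* The number [k * c v ^+ n] will be at most [K + 1], which does not depend on [n]; as
   [c (2 v) < c v], a large [n] beats it. *)
have [n hn] : exists n, (K + 1) * (c (2 * v) / c v) ^+ n <= de.
  have : (K + 1) * (c (2 * v) / c v) ^+ n @[n --> \oo] --> 0.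
    rewrite -[X in _ --> X](mulr0 (K + 1)); apply: cvgMr; apply: cvg_expr.
    have /andP[h1 _] := c00.
    by rewrite ger0_norm ?divr_ge0 ?(ltW c1)// ltr_pdivrMr// mul1r.
  move=> /cvgrPdist_le/(_ _ d0)[n _ /(_ n (leqnn n))].
  by rewrite sub0r normrN => h; exists n; rewrite (le_trans (ler_norm _)).
pose k := (Num.trunc (K / c v ^+ n)).+1.
have cn0 : 0 < c v ^+ n by rewrite exprn_gt0.
have k1 : K <= k%:R * c v ^+ n by rewrite -ler_pdivrMr// ltW// truncnS_gt.
have k2 : k%:R <= K / c v ^+ n + 1.
  by rewrite -natr1 lerD2r truncn_le divr_ge0 ?(ltW cn0) ?(ltW K0).
have cn x : 0 <= 1 - c x ^+ n <= 1.
  by have /andP[a b] := c01 x; rewrite subr_ge0 exprn_ile1//= gerBl exprn_ge0.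
have mn x y : 0 <= x -> x <= y -> x ^+ n <= y ^+ n.
  by move=> x0 xy; rewrite lerXn2r// nnegrE// (le_trans x0).
exists om, n, k => ka; split=> x; rewrite /ka -/(c x).
- have /andP[a b] := cn x.
  by rewrite subr_ge0 exprn_ile1//= gerBl exprn_ge0.
- move=> xv; have cx : c v ^+ n <= c x ^+ n.
    apply: mn; first exact: ltW.
    by rewrite -[c x]cN; apply: cle => //; rewrite normr_ge0/=; lra.
  rewrite lerD2l lerN2 (le_trans _ eK)//.
  apply: (@le_trans _ _ (expR (- c x ^+ n) ^+ k)).
    have /andP[a b] := cn x.
    by rewrite lerXn2r ?nnegrE ?expR_ge0//; have := expR_ge1Dx (- c x ^+ n).
  rewrite -expRM_natl ler_expR mulrN lerN2 (le_trans k1)// ler_wpM2l//.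
- move=> /andP[xv xL]; have cx : c x ^+ n <= c (2 * v) ^+ n.
    have /andP[? ?] := c01 x.
    apply: mn => //.
    by rewrite -[c x]cN; apply: cle => //; rewrite normr_ge0.
  have /andP[a b] := cn x.
  have := @norm_exprB _ 1 (1 - c x ^+ n) k; rewrite normr1 ger0_norm// => /(_ (lexx _) b).
  rewrite expr1n subKr => /(le_trans (ler_norm _)) /le_trans; apply.
  have /andP[a0 b0] := c01 x.
  rewrite ger0_norm ?exprn_ge0//.
  apply: le_trans hn.
  have /andP[h1 _] := c00.
  rewrite (le_trans (ler_wpM2l _ cx))// (le_trans (ler_wpM2r _ k2)) ?exprn_ge0//.
  rewrite [X in _ <= _ * X]exprMn exprVn [leRHS]mulrCA [leRHS]mulrC ler_wpM2r ?exprn_ge0//.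
  rewrite [leRHS]mulrDl mul1r lerD2l invf_ge1//.
  by have /andP[h2 h3] := c11; rewrite exprn_ile1.
Qed.

End CosineKernel.

(** * Cosine polynomials *)

Section CosineSpan.
Context {R : realType} {m : nat}.
Notation V := 'rV[R]_m.

Definition cospan (F : V -> R) := exists l : seq (R * V),
  F = fun s => \sum_(z <- l) z.1 * cos (dot z.2 s).

Lemma cospan_cos a : cospan (fun s => cos (dot a s)).
Proof. by exists [:: (1, a)]; apply/funext => s; rewrite big_seq1 mul1r. Qed.

Lemma cospan_cst c : cospan (fun=> c).
Proof.
by exists [:: (c, 0)]; apply/funext => s; rewrite big_seq1 dot0l cos0 mulr1.
Qed.

Lemma cospanD F G : cospan F -> cospan G -> cospan (fun s => F s + G s).
Proof. by move=> [l ->] [l' ->]; exists (l ++ l'); apply/funext => s; rewrite big_cat. Qed.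

(** Product-to-sum formula: frequencies are added and subtracted in pairs. *)
Lemma cospanM F G : cospan F -> cospan G -> cospan (fun s => F s * G s).
Proof.
move=> [l ->] [l' ->].
exists ([seq (z.1 * y.1 / 2, z.2 + y.2) | z <- l, y <- l'] ++
        [seq (z.1 * y.1 / 2, z.2 - y.2) | z <- l, y <- l']).
apply/funext => s; rewrite big_cat/= !big_allpairs_dep -big_split/= mulr_suml.
apply: eq_bigr => z _; rewrite -big_split/= mulr_sumr; apply: eq_bigr => y _ /=.
by rewrite !dotDl dotNl cosD cosB; field.
Qed.

Lemma cospanX F n : cospan F -> cospan (fun s => F s ^+ n).
Proof.
move=> cF; elim: n => [|n IH]; first exact: cospan_cst.
by under [X in cospan X]eq_fun do rewrite exprS; exact: cospanM.
Qed.

Lemma cospan_prod (I : Type) (r : seq I) (F : I -> V -> R) :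
  (forall i, cospan (F i)) -> cospan (fun s => \prod_(i <- r) F i s).
Proof.
move=> cF; elim: r => [|i r IH].
  by under [X in cospan X]eq_fun do rewrite big_nil; exact: cospan_cst.
by under [X in cospan X]eq_fun do rewrite big_cons; exact: cospanM.
Qed.

Lemma dot_delta (c : R) (i : 'I_m) s : dot (c *: delta_mx ord0 i) s = c * s ord0 i.
Proof.
rewrite /dot (bigD1 i)//= big1 ?addr0 => [|j ji]; rewrite !mxE eqxx/=.
  by rewrite eqxx mulr1.
by rewrite (negbTE ji) mulr0 mul0r.
Qed.

Lemma cospan_kernel om n k (i : 'I_m) :
  cospan (fun s => 1 - (1 - ((1 + cos (om * s ord0 i)) / 2) ^+ n) ^+ k).
Proof.
have N F : cospan F -> cospan (fun s => 1 - F s).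
  move=> cF; have := cospanD (cospan_cst 1) (cospanM (cospan_cst (-1)) cF).
  by under [X in cospan X]eq_fun do rewrite mulN1r.
apply: (N); apply: cospanX; apply: (N); apply: cospanX; apply: (cospanM _ (cospan_cst _)).
apply: cospanD; first exact: cospan_cst.
by under [X in cospan X]eq_fun do rewrite -dot_delta; exact: cospan_cos.
Qed.

End CosineSpan.

(** * From admissible functionals to probabilities *)

Section Tail.
Context {R : realType} {m : nat} {d : measure_display} {Omega : measurableType d}.
Notation V := 'rV[R]_m.
Variables (P : probability Omega R) (X : 'I_m -> Omega -> R).
Hypothesis mX : forall i, measurable_fun setT (X i).
Variable th : R.
Hypothesis th0 : 0 < th.
Variables (phi : V -> R) (c : R).
Hypothesis Xphi : forall a : V, \int[P]_w cos (\sum_i a ord0 i * X i w) = phi a.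
Hypothesis gphi : good th (fun o => if o is Some a then phi a else c).
Variables (v w : R).
Hypotheses (v0 : 0 < v) (w0 : 0 < w).

Definition tail_bound (x : R) :=
  (1 - x) / (1 - expR (- (th * w ^+ 2))) + 2 * m%:R * expR (- (v ^+ 2 / (8 * w ^+ 2))).

Let W0 : 0 < 1 - expR (- (th * w ^+ 2)).
Proof. by rewrite subr_gt0 -[ltRHS]expR0 ltr_expR oppr_lt0 mulr_gt0// exprn_gt0. Qed.

(** Pointwise, [1 - F] is at most [de] when no coordinate exceeds [v]. Otherwise either [q >= w^2]
    and the Laplace term is at least 1, or [q < w^2] and the exponential of a coordinate above [v]
    is. Applying [L] is Markov's inequality for all cases at once. *)
Lemma adm_tail (L : (V -> R -> R) -> R) (F : V -> R) (de : R) : adm L ->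
  (forall s, 0 <= F s) ->
  (forall s : V, (forall i, `|s ord0 i| <= v) -> 1 - de <= F s) -> 0 <= de ->
  1 - L (fun s _ => F s) <= tail_bound (L (test th None)) + de.
Proof.
move=> aL F0 Fd d0.
(* [la] minimises [- la * v + 2 * la^2 * w^2], with minimum [- v^2 / (8 * w^2)]. *)
pose la := v / (4 * w ^+ 2); pose C := expR (- (la * v) + 2 * la ^+ 2 * w ^+ 2).
pose G (s : V) (q : R) := (1 - expR (- (th * q))) / (1 - expR (- (th * w ^+ 2))) +
  \sum_i (C * expR (la * s ord0 i - 2 * la ^+ 2 * q) +
          C * expR (- la * s ord0 i - 2 * (- la) ^+ 2 * q)) + de.
have w20 : 0 < w ^+ 2 by rewrite exprn_gt0.
have la0 : 0 < la by rewrite divr_gt0// mulr_gt0.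
have CE : C = expR (- (v ^+ 2 / (8 * w ^+ 2))).
  by rewrite /C /la; congr expR; field; rewrite gt_eqF.
have FG s q : 0 <= q -> 1 - F s <= G s q.
  move=> q0; rewrite /G.
  have t1 : 0 <= (1 - expR (- (th * q))) / (1 - expR (- (th * w ^+ 2))).
    by rewrite divr_ge0 ?(ltW W0)// subr_ge0 -expR0 ler_expR oppr_le0 mulr_ge0 ?(ltW th0).
  have t2 i : 0 <= C * expR (la * s ord0 i - 2 * la ^+ 2 * q) +
          C * expR (- la * s ord0 i - 2 * (- la) ^+ 2 * q).
    by rewrite addr_ge0// mulr_ge0 ?expR_ge0.
  have t3 : 0 <= \sum_i (C * expR (la * s ord0 i - 2 * la ^+ 2 * q) +
          C * expR (- la * s ord0 i - 2 * (- la) ^+ 2 * q)) by exact: sumr_ge0.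
  have [sv|] := pselect (forall i, `|s ord0 i| <= v).
    by have := Fd s sv; lra.
  move=> /existsNP[i /negP]; rewrite -ltNge => vs.
  have h1 : 1 <= (1 - expR (- (th * q))) / (1 - expR (- (th * w ^+ 2))) +
    \sum_i (C * expR (la * s ord0 i - 2 * la ^+ 2 * q) +
          C * expR (- la * s ord0 i - 2 * (- la) ^+ 2 * q)).
    have [wq|qw] := leP (w ^+ 2) q.
      apply: ler_wpDr => //; rewrite ler_pdivlMr// mul1r lerD2l lerN2 ler_expR lerN2.
      by rewrite ler_pM2l.
    apply: (@le_trans _ _ (\sum_i (C * expR (la * s ord0 i - 2 * la ^+ 2 * q) +
          C * expR (- la * s ord0 i - 2 * (- la) ^+ 2 * q)))); last by rewrite lerDr.
    rewrite (bigD1 i)//=.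
    apply: (@le_trans _ _ (C * expR (la * s ord0 i - 2 * la ^+ 2 * q) +
          C * expR (- la * s ord0 i - 2 * (- la) ^+ 2 * q))); last first.
      by rewrite lerDl sumr_ge0.
    have la2 : la ^+ 2 * q <= la ^+ 2 * w ^+ 2 by rewrite ler_wpM2l ?sqr_ge0// ltW.
    rewrite sqrrN /C -!expRD.
    have e1 x : 0 <= x -> 1 <= expR x by move=> x0; rewrite -expR0 ler_expR.
    have [s0|s0] := leP 0 (s ord0 i).
      rewrite ler_wpDr ?expR_ge0// e1//.
      rewrite ger0_norm// in vs.
      have : la * v <= la * s ord0 i by rewrite ler_pM2l// ltW.
      lra.
    rewrite ler_wpDl ?expR_ge0// e1//.
    rewrite ltr0_norm// in vs.
    have : la * v <= la * - s ord0 i by rewrite ler_pM2l// ltW.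
    lra.
  by have := F0 s; lra.
have -> : 1 - L (fun s _ => F s) = L (fun s _ => 1 - F s).
  rewrite (_ : (fun s _ => 1 - F s) = (fun s q => 1 + (-1) * F s)).
    by rewrite (admD aL) (admZ aL) (adm1 aL) mulN1r.
  by apply/funext => s; apply/funext => q; rewrite mulN1r.
apply: (le_trans (adm_le aL FG)).
rewrite /G (admD aL) (adm_cst _ aL) lerD2r (admD aL) /tail_bound lerD//.
  rewrite (_ : (fun s q => _) = (fun s q => (1 - expR (- (th * w ^+ 2)))^-1 * (1 + (-1) * test th None s q))).
    by rewrite (admZ aL) (admD aL) (admZ aL) (adm1 aL) mulN1r mulrC.
  by apply/funext => s; apply/funext => q; rewrite mulN1r mulrC.
rewrite adm_sum//.
apply: (@le_trans _ _ (\sum_(i < m) (C + C))).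
  apply: ler_sum => i _; rewrite (admD aL) !(admZ aL) lerD//.
    by rewrite -[leRHS]mulr1 ler_wpM2l ?expR_ge0// (adm_exp aL).
  by rewrite -[leRHS]mulr1 ler_wpM2l ?expR_ge0// (adm_exp aL).
by rewrite sumr_const card_ord -CE -mulr_natr; lra.
Qed.

Definition rvec (om : Omega) : V := \row_i X i om.

Lemma measurable_dot_rvec (a : V) : measurable_fun setT (fun om => dot a (rvec om)).
Proof.
rewrite /dot; apply: measurable_sum => i; apply: measurable_funM; first exact: measurable_cst.
by under eq_fun do rewrite mxE; exact: mX.
Qed.

Lemma integrable_bounded (f : Omega -> R) (M : R) : measurable_fun setT f ->
  (forall om, `|f om| <= M) -> P.-integrable setT (EFin \o f).
Proof.
move=> mf fM; apply: (@le_integrable _ _ _ P setT measurableT _ (EFin \o cst M)) => //.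
- exact/measurable_EFinP.
- by move=> om _ /=; rewrite lee_fin (le_trans (fM om))// ler_norm.
- exact: finite_measure_integrable_cst.
Qed.

Lemma integrable_cos_rvec (a : V) :
  P.-integrable setT (EFin \o (fun om => cos (dot a (rvec om)))).
Proof.
apply: (@integrable_bounded _ 1) => [|om]; last exact: cos_max.
have mcos : measurable_fun setT (@cos R).
  by apply: continuous_measurable_fun; exact: continuous_cos.
exact: measurableT_comp mcos (measurable_dot_rvec a).
Qed.

Lemma Rintegral_cospan (l : seq (R * V)) :
  P.-integrable setT (EFin \o (fun om => \sum_(z <- l) z.1 * cos (dot z.2 (rvec om)))) /\
  \int[P]_om (\sum_(z <- l) z.1 * cos (dot z.2 (rvec om))) = \sum_(z <- l) z.1 * phi z.2.
Proof.
elim: l => [|z l [IH1 IH2]].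
  under eq_fun do rewrite big_nil; split; first exact: integrable0.
  by rewrite Rintegral_cst// mul0r big_nil.
have iz : P.-integrable setT (EFin \o (fun om => z.1 * cos (dot z.2 (rvec om)))).
  by apply: eq_integrable (integrableZl measurableT z.1 (integrable_cos_rvec z.2)).
split.
  under eq_fun do rewrite big_cons.
  by apply: eq_integrable (integrableD measurableT iz IH1).
under eq_Rintegral do rewrite big_cons.
rewrite RintegralD// IH2 RintegralZl//; last exact: integrable_cos_rvec.
rewrite big_cons -Xphi; congr (_ * _ + _); apply: eq_Rintegral => om _.
by congr cos; apply: eq_bigr => i _; rewrite mxE.
Qed.

(** The expectation of a cosine polynomial under [X] and its value under a close [L] involve the
    same finitely many frequencies, so [adm_tail] transfers from [L] to [X]. *)
Let expectation_lower (F : V -> R) de : cospan F -> (forall s, 0 <= F s) ->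
  (forall s : V, (forall i, `|s ord0 i| <= v) -> 1 - de <= F s) -> 0 <= de ->
  1 - \int[P]_om F (rvec om) <= tail_bound c + de.
Proof.
move=> [l FE] F0 Fd d0.
have EF : \int[P]_om F (rvec om) = \sum_(z <- l) z.1 * phi z.2.
  by rewrite FE; exact: (Rintegral_cospan l).2.
pose S := \sum_(z <- l) `|z.1|; have S0 : 0 <= S by exact: sumr_ge0.
set i0 := (1 - expR (- (th * w ^+ 2)))^-1; have i00 : 0 < i0 by rewrite invr_gt0.
apply/ler_addgt0Pr => e e0.
(* The error on the tests is multiplied by [S], the sum of the absolute coefficients, and by [i0] in
   the Laplace term. *)
pose e' := e / (S + i0); have Si : 0 < S + i0 by rewrite ltr_wpDl.
have e'0 : 0 < e' by rewrite divr_gt0.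
have [L aL hL] := gphi (None :: [seq Some z.2 | z <- l]) e'0.
have h1 := adm_tail aL F0 Fd d0.
have h2 := hL None (mem_head _ _); rewrite /= in h2.
have h3 : `|L (fun s _ => F s) - \sum_(z <- l) z.1 * phi z.2| <= S * e'.
  have -> : L (fun s _ => F s) = \sum_(z <- l) z.1 * L (test th (Some z.2)).
    rewrite FE (_ : (fun s _ => _) = (fun s q => \sum_(z <- l) (fun z s q => z.1 * test th (Some z.2) s q) z s q))//.
    by rewrite adm_sum//; apply: eq_bigr => z _; rewrite (admZ aL).
  rewrite -sumrB (le_trans (ler_norm_sum _ _ _))// /S mulr_suml.
  rewrite !big_seq; apply: ler_sum => z zl; rewrite -mulrBr normrM ler_wpM2l//.
  by apply: hL; rewrite inE; apply/orP; right; apply/mapP; exists z.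
have h4 : tail_bound (L (test th None)) <= tail_bound c + e' * i0.
  rewrite /tail_bound -/i0 addrAC lerD2r -mulrDl ler_wpM2r ?(ltW i00)//.
  by move: h2; rewrite ler_norml => /andP[? ?]; rewrite /=; lra.
have h5 : S * e' + e' * i0 = e by rewrite mulrC -mulrDr divfK// gt_eqF.
rewrite EF; move: h3; rewrite ler_norml => /andP[? ?].
lra.
Qed.

(** The upper cut-off is forced by the periodicity of the cosine kernel; [tail_estimate] removes it
    by monotone convergence. *)
Definition exceed (x y : R) := [set om | [exists i, x < `|X i om| <= y]].

Lemma measurable_exceed x y : measurable (exceed x y).
Proof.
rewrite /exceed (_ : [set _ | _] = \bigcup_(i in [set: 'I_m]) (fun om => `|X i om|) @^-1` `]x, y]).
  apply: fin_bigcup_measurable => // i _.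
  have mn : measurable_fun setT (fun om => `|X i om|) by apply: measurableT_comp => //; exact: mX.
  by rewrite -[_ @^-1` _]setTI; apply: mn => //; exact: measurable_itv.
apply/seteqP; split => om /=.
  by move=> /existsP[i h]; exists i => //=; rewrite in_itv.
by move=> [i _ /=]; rewrite in_itv => h; apply/existsP; exists i.
Qed.

Lemma prob_exceed_le (La : R) : 2 * v < La -> fine (P (exceed (2 * v) La)) <= tail_bound c.
Proof.
move=> vL; have mE := measurable_exceed (2 * v) La.
have : 0 <= fine (P (exceed (2 * v) La)) <= 1.
  rewrite fine_ge0//= -lee_fin fineK; last exact: fin_num_measure.
  exact: probability_le1.
set p := fine _ => p01.
suff H de : 0 < de -> p <= tail_bound c + (m%:R + 1) * de.
  apply/ler_addgt0Pr => e e0.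
  have m1 : 0 < m%:R + 1 :> R by rewrite natr1 ltr0n.
  have := H (e / (m%:R + 1)); rewrite divr_gt0// => /(_ isT).
  by rewrite mulrC divfK// gt_eqF.
wlog d1 : de / de <= 1 => [wl d0|d0].
  have [|/ltW de1] := leP de 1; first by move=> ?; exact: wl.
  rewrite (le_trans (wl 1 (lexx _) ltr01))// lerD2l ler_wpM2l//.
have [om [n [k]]] := cosine_kernel v0 vL d0.
set ka := fun x : R => _; move=> [k01 k1 k2].
(* All factors lie in [[0, 1]], so the product is at most [de] as soon as one coordinate has modulus
   in [[2 v, La]], and at least [1 - m * de] when none exceeds [v]. *)
pose F (s : V) := \prod_i ka (s ord0 i).
have cF : cospan F by apply: cospan_prod => i; exact: cospan_kernel.
have F01 s : 0 <= F s <= 1.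
  rewrite prodr_ile1 => [|i _]; last exact: k01.
  by rewrite andbT; apply: prodr_ge0 => i _; have /andP[] := k01 (s ord0 i).
have F1 (s : V) : (forall i, `|s ord0 i| <= v) -> 1 - m%:R * de <= F s.
  move=> sv.
  have : (1 - de) ^+ m <= F s.
    rewrite -[X in _ ^+ X]card_ord -prodr_const; apply: ler_prod => i _.
    by rewrite subr_ge0 d1/= k1.
  apply: le_trans.
  have := @norm_exprB _ 1 (1 - de) m; rewrite normr1 ger0_norm ?subr_ge0// lexx expr1n.
  rewrite gerBl (ltW d0) subKr [`|de|]ger0_norm ?(ltW d0)// => /(_ isT isT).
  by move=> /(le_trans (ler_norm _)); lra.
have h1 := expectation_lower cF (fun s => proj1 (andP (F01 s))) F1 (mulr_ge0 (ler0n _ _) (ltW d0)).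
have [l FE] := cF.
have iF : P.-integrable setT (EFin \o (fun om => F (rvec om))).
  by rewrite FE; exact: (Rintegral_cospan l).1.
have iI : P.-integrable setT (EFin \o (fun om => 1 - (1 - de) * \1_(exceed (2 * v) La) om)).
  apply: (@integrable_bounded _ 1).
    apply: measurable_funB; first exact: measurable_cst.
    by apply: measurable_funM; [exact: measurable_cst|exact: measurable_indic].
  move=> o; rewrite indicE; case: (_ \in _); rewrite ?mulr1 ?mulr0 ?subr0 ?normr1//.
  by rewrite subKr ger0_norm ?(ltW d0).
have : \int[P]_o F (rvec o) <= 1 - (1 - de) * p.
  apply: (@le_trans _ _ (\int[P]_o (1 - (1 - de) * \1_(exceed (2 * v) La) o))).
    apply: le_Rintegral => // o _.
    rewrite indicE; case: (boolP (_ \in _)) => [|_]; last first.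
      by rewrite mulr0 subr0; have /andP[] := F01 (rvec o).
    rewrite inE mulr1 subKr => /existsP[i /andP[vi iL]].
    rewrite /F (bigD1 i)//= -[leRHS]mulr1 ler_pM//.
    - by have /andP[] := k01 (rvec o ord0 i).
    - by apply: prodr_ge0 => j _; have /andP[] := k01 (rvec o ord0 j).
    - by apply: k2; rewrite mxE iL (ltW vi).
    - by apply: prodr_ile1 => j _; exact: k01.
  rewrite RintegralB//.
  - rewrite Rintegral_cst// RintegralZl//.
    + rewrite [X in _ - _ * X]/Rintegral integral_indic// setIT.
      rewrite [X in X - _ <= _](_ : _ = 1)// mul1r.
      by have /(congr1 fine) := probability_setT P.
    + exact: integrable_indic.
  - exact: finite_measure_integrable_cst.
  - apply: (@integrable_bounded _ 1).
      by apply: measurable_funM; [exact: measurable_cst|exact: measurable_indic].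
    move=> o; rewrite indicE; case: (_ \in _); rewrite ?mulr1 ?mulr0 ?normr0//.
    by rewrite ger0_norm ?subr_ge0// gerBl ltW.
have := p01 => /andP[p0 p1].
have : de * p <= de * 1 by rewrite ler_pM2l.
lra.
Qed.

Definition above (x : R) := [set om | [exists i, x < `|X i om|]].

Lemma tail_estimate : (P (above (2 * v)) <= (tail_bound c)%:E)%E.
Proof.
pose A n := exceed (2 * v) (2 * v + n.+1%:R).
have -> : above (2 * v) = \bigcup_n A n.
  apply/seteqP; split => om /=.
    move=> /existsP[i h]; exists (Num.trunc `|X i om|) => //; rewrite /A/=.
    apply/existsP; exists i; rewrite h/= (le_trans (ltW (truncnS_gt _)))// lerDr.
    by rewrite mulr_ge0 ?(ltW v0).
  by move=> [n _ /existsP[i /andP[h _]]]; apply/existsP; exists i.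
have mA n : measurable (A n) by exact: measurable_exceed.
have hA : {homo A : n k / (n <= k)%N >-> (n <= k)%O}.
  move=> n k nk; apply/subsetPset => om /= /existsP[i /andP[h1 h2]].
  by apply/existsP; exists i; rewrite h1 (le_trans h2)// lerD2l ler_nat ltnS.
have cvA : (P \o A) n @[n --> \oo] --> P (\bigcup_n A n).
  by apply: nondecreasing_cvg_mu => //; exact: bigcup_measurable.
rewrite -(cvg_lim _ cvA)//; apply: lime_le; first by apply: cvgP cvA.
apply: nearW => n /=; rewrite -[P _]fineK ?fin_num_measure// lee_fin.
by apply: prob_exceed_le; rewrite ltrDl.
Qed.

End Tail.

(** * Envelope of the kernel *)

Section Envelope1.
Context {R : realType}.
Variables (al H : R).
Hypotheses (al0 : 0 < al) (H01 : 0 < H < 1).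

(** Bounds one factor of a kernel increment, [|exp (i a x) - exp (i b x)| / |x|^(H + 1/al)] with
    [|a - b| <= de]. *)
Definition envelope1 (de x : R) : R := Num.min 2 (de * `|x|) / `|x| `^ (H + al^-1).

Lemma envelope1_ge0 de x : 0 <= de -> 0 <= envelope1 de x.
Proof. by move=> d0; rewrite divr_ge0 ?powR_ge0// le_min ler0n mulr_ge0. Qed.

Lemma measurable_envelope1 de : measurable_fun setT (envelope1 de).
Proof.
have mn : measurable_fun setT (fun x : R => `|x|) by exact: normr_measurable.
rewrite /envelope1; apply: measurable_funM.
  apply: measurable_minr; first exact: measurable_cst.
  by apply: measurable_funM => //; exact: measurable_cst.
have -> : (fun x : R => (`|x| `^ (H + al^-1))^-1) = (fun x => `|x| `^ (- (H + al^-1))).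
  by apply/funext => x; rewrite powRN.
by apply: (measurableT_comp (measurable_powR _) mn).
Qed.

Let ga := al * H.

Let ga0 : 0 < ga. Proof. by have /andP[? _] := H01; rewrite mulr_gt0. Qed.

Let ga_lt : ga < al.
Proof. by have /andP[_ ?] := H01; rewrite -[ltRHS]mulr1 ltr_pM2l. Qed.

Lemma envelope1_powR de x : 0 < de -> x != 0 -> envelope1 de x `^ al =
  Num.min 2 (expR (ln (de * `|x|))) `^ al * expR ((ga + 1) * (ln de - ln (de * `|x|))).
Proof.
move=> d0 x0; have nx : 0 < `|x| by rewrite normr_gt0.
have dx : 0 < de * `|x| by rewrite mulr_gt0.
have m0 : 0 <= Num.min 2 (de * `|x|) by rewrite le_min ler0n ltW.
rewrite /envelope1 -powRN powRM ?powR_ge0// lnK ?posrE//; congr (_ * _).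
rewrite lnM ?posrE// -powRrM /powR gt_eqF//; congr expR.
by rewrite /ga; field; rewrite gt_eqF.
Qed.

Let box (de : R) (x : R) : set R := `[- (expR x / de), expR x / de].

Let outer (de : R) k : R := 2 `^ al * expR ((ga + 1) * (ln de - k%:R)).
Let inner (de : R) k : R := expR (- (al * k%:R)) * expR ((ga + 1) * (ln de + k.+1%:R)).
(** Annuli are enlarged to full intervals; since the lengths are geometric in [k], this costs only a
    constant factor. *)
Let layer (de : R) k (x : R) : R :=
  outer de k * \1_(box de k.+1%:R) x + inner de k * \1_(box de (- k%:R)) x.

Let layer_ge0 de k x : 0 <= layer de k x.
Proof. by rewrite addr_ge0 ?mulr_ge0 ?expR_ge0 ?powR_ge0// indicE. Qed.

Let mbox de x : measurable (box de x). Proof. exact: measurable_itv. Qed.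

Let mlayer de k : measurable_fun setT (layer de k).
Proof.
by apply: measurable_funD; apply: measurable_funM;
  [exact: measurable_cst|exact: measurable_indic|exact: measurable_cst|exact: measurable_indic].
Qed.

(* The annulus [e^k <= de |x| < e^(k+1)], [k] an integer, contributes the
   [k]-th term of one of the two geometric series. *)
Let envelope1_le_layer de x : 0 < de -> exists k, envelope1 de x `^ al <= layer de k x.
Proof.
move=> d0; have [->|x0] := eqVneq x 0.
  exists 0%N; rewrite /envelope1 normr0 mulr0 (_ : Num.min 2 0 = 0) ?mul0r; last first.
    by apply/min_idPr.
  by rewrite powR0 ?gt_eqF.
have nx : 0 < `|x| by rewrite normr_gt0.
have dx : 0 < de * `|x| by rewrite mulr_gt0.
rewrite envelope1_powR//; set L := ln (de * `|x|).
have eL : expR L = de * `|x| by rewrite lnK.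
have g1 : 0 <= ga + 1 by rewrite addr_ge0 ?(ltW ga0).
have inbox y : L <= y -> \1_(box de y) x = 1 :> R.
  move=> Ly; rewrite indicE mem_set// /box /= in_itv/= -ler_norml.
  by rewrite ler_pdivlMr// mulrC -eL ler_expR.
have m0 : 0 <= Num.min 2 (expR L) by rewrite le_min ler0n expR_ge0.
have [L0|L0] := leP 0 L.
- exists (Num.trunc L); have /andP[k1 k2] := truncn_itv L0.
  apply: (@le_trans _ _ (outer de (Num.trunc L))); last first.
    rewrite /layer (inbox (Num.trunc L).+1%:R (ltW k2)) mulr1 lerDl mulr_ge0 ?indicE//.
    by rewrite mulr_ge0 ?expR_ge0.
  rewrite ler_pM ?powR_ge0 ?expR_ge0//.
    by rewrite ge0_ler_powR ?nnegrE ?(ltW al0)// ge_min lexx.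
  by rewrite ler_expR ler_wpM2l// lerD2l lerN2.
- have L0' : 0 <= - L by rewrite oppr_ge0 ltW.
  exists (Num.trunc (- L)); have /andP[k1 k2] := truncn_itv L0'.
  set k := Num.trunc (- L) in k1 k2 *.
  have k3 : L <= - k%:R by rewrite lerNr.
  apply: (@le_trans _ _ (inner de k)); last first.
    rewrite /layer (inbox _ k3) mulr1 lerDr mulr_ge0 ?indicE//.
    by rewrite mulr_ge0 ?expR_ge0 ?powR_ge0.
  rewrite ler_pM ?powR_ge0 ?expR_ge0//.
    rewrite -mulrN mulrC expRM ge0_ler_powR ?nnegrE ?(ltW al0) ?expR_ge0//.
    by rewrite ge_min ler_expR k3 orbT.
  by rewrite ler_expR ler_wpM2l// lerD2l ltW.
Qed.

Let mu_box de x : 0 < de ->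
  lebesgue_measure (box de x) = (2 * expR (x - ln de))%:E.
Proof.
move=> d0; rewrite lebesgue_measure_itv/= expRB lnK ?posrE//.
have e0 : 0 < expR x / de by rewrite divr_gt0 ?expR_gt0.
rewrite lte_fin ifT -?EFinB; last by rewrite (lt_trans _ e0)// oppr_lt0.
by congr EFin; rewrite opprK mulr2n mulrDl mul1r.
Qed.

Definition envelope1_cst : R :=
  2 `^ al * 2 * expR 1 * (1 - expR (- ga))^-1 +
  2 * expR (ga + 1) * (1 - expR (- (al - ga)))^-1.

Let q1 : 0 <= expR (- ga) < 1.
Proof. by rewrite expR_ge0 -[X in _ < X]expR0 ltr_expR oppr_lt0. Qed.

Let q2 : 0 <= expR (- (al - ga)) < 1.
Proof. by rewrite expR_ge0 -[X in _ < X]expR0 ltr_expR oppr_lt0 subr_gt0. Qed.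

Lemma envelope1_cst_ge0 : 0 <= envelope1_cst.
Proof.
have /andP[_ h1] := q1; have /andP[_ h2] := q2.
by rewrite addr_ge0// !mulr_ge0 ?powR_ge0 ?expR_ge0 ?invr_ge0// subr_ge0 ltW.
Qed.

Let integral_layer de k : 0 < de ->
  (\int[lebesgue_measure]_x (layer de k x)%:E =
  (de `^ ga * (2 `^ al * 2 * expR 1 * expR (- ga) ^+ k +
               2 * expR (ga + 1) * expR (- (al - ga)) ^+ k))%:E)%E.
Proof.
move=> d0.
have int1 c x : 0 <= c ->
    (\int[lebesgue_measure]_y (c * \1_(box de x) y)%:E = (c * (2 * expR (x - ln de)))%:E)%E.
  move=> c0; under eq_integral do rewrite EFinM.
  rewrite ge0_integralZl_EFin//.
  - rewrite integral_indic//; last exact: mbox.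
    rewrite EFinM -(mu_box x d0); congr (_ * lebesgue_measure _)%E; exact: setIT.
  - by apply/measurable_EFinP/measurable_indic; exact: mbox.
have m1 (c x : R) : measurable_fun setT (fun y : R => c * \1_(box de x) y : R).
  apply: measurable_funM; first exact: measurable_cst.
  by apply: measurable_indic; exact: mbox.
rewrite /layer; under eq_integral do rewrite EFinD.
rewrite ge0_integralD//.
- rewrite !int1 ?mulr_ge0 ?powR_ge0 ?expR_ge0//; congr EFin.
  rewrite -!expRM_natl [de `^ _]/powR gt_eqF// mulrDr /outer /inner.
  congr (_ + _).
    rewrite [LHS](_ : _ = 2 `^ al * 2 * (expR ((ga + 1) * (ln de - k%:R)) * expR (k.+1%:R - ln de))); last by ring.
    rewrite [RHS](_ : _ = 2 `^ al * 2 * (expR (ga * ln de) * expR 1 * expR (k%:R * - ga))); last by ring.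
    by congr (_ * _); rewrite -!expRD; congr expR; rewrite -natr1; ring.
  rewrite [LHS](_ : _ = 2 * (expR (- (al * k%:R)) * expR ((ga + 1) * (ln de + k.+1%:R)) * expR (- k%:R - ln de))); last by ring.
  rewrite [RHS](_ : _ = 2 * (expR (ga * ln de) * expR (ga + 1) * expR (k%:R * - (al - ga)))); last by ring.
  by congr (_ * _); rewrite -!expRD; congr expR; rewrite -natr1; ring.
- by move=> x _; rewrite lee_fin mulr_ge0 ?indicE// mulr_ge0 ?powR_ge0 ?expR_ge0.
- by apply/measurable_EFinP; exact: m1.
- by move=> x _; rewrite lee_fin mulr_ge0 ?indicE// mulr_ge0 ?powR_ge0 ?expR_ge0.
- by apply/measurable_EFinP; exact: m1.
Qed.

(** The power of [de] is the one given by the substitution [y = de * x]. The outer series converges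
    because [al * H > 0], the inner one because [al * H < al]. *)
Lemma integral_envelope1_le de : 0 < de ->
  (\int[lebesgue_measure]_x (envelope1 de x `^ al)%:E <= (envelope1_cst * de `^ (al * H))%:E)%E.
Proof.
move=> d0.
apply: (@le_trans _ _ (\int[lebesgue_measure]_x (\sum_(0 <= k <oo) (layer de k x)%:E))%E).
  apply: ge0_le_integral => //.
  - by move=> x _; rewrite lee_fin powR_ge0.
  - apply/measurable_EFinP.
    exact: (measurableT_comp (measurable_powR _) (measurable_envelope1 de)).
  - apply: ge0_emeasurable_sum => [k x _ _|k _]; first by rewrite lee_fin.
    by apply/measurable_EFinP; exact: mlayer.
  move=> x _; have [k hk] := envelope1_le_layer x d0.
  have h n : (0 <= n)%N -> xpredT n -> (0 <= (layer de n x)%:E)%E.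
    by move=> _ _; rewrite lee_fin; exact: layer_ge0.
  apply: le_trans (nneseries_lim_ge k.+1 h).
  rewrite big_nat_recr//= (le_trans (y := (layer de k x)%:E)) ?lee_fin//.
  by rewrite leeDr// sume_ge0// => i _; rewrite lee_fin.
rewrite integral_nneseries//; last 2 first.
  - by move=> k; apply/measurable_EFinP; exact: mlayer.
  - by move=> k x _; rewrite lee_fin.
apply: lime_le.
  by apply: is_cvg_nneseries => k _ _; rewrite integral_ge0// => x _; rewrite lee_fin.
apply: nearW => K /=; under eq_bigr do rewrite integral_layer//.
rewrite sumEFin lee_fin -mulr_sumr mulrC ler_wpM2r ?powR_ge0// big_split/= -!mulr_sumr.
by rewrite lerD// ler_wpM2l ?sum_geometric_le// !mulr_ge0 ?powR_ge0 ?expR_ge0.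
Qed.

End Envelope1.

(** * Integrals of products over the coordinates *)

Section ProductIntegral.
Context {R : realType}.

Lemma integral_prod_tnth N (f : 'I_N -> R -> R) :
  (forall j x, 0 <= f j x) -> (forall j, measurable_fun setT (f j)) ->
  (\int[Defs.lebesgue_measureN N]_x (\prod_(j < N) f j (tnth x j))%:E =
   \prod_(j < N) \int[lebesgue_measure]_x (f j x)%:E)%E.
Proof.
elim: N f => [|N IH] f f0 mf.
  rewrite big_ord0 /= integral_dirac//; last first.
    by under eq_fun do rewrite big_ord0; exact: measurable_cst.
  by rewrite big_ord0 diracT mul1e.
have mprod n (g : 'I_n -> R -> R) : (forall j, measurable_fun setT (g j)) ->
    measurable_fun setT (fun x : n.-tuple (measurableTypeR R) => \prod_(j < n) g j (tnth x j)).
  move=> mg; apply: measurable_prod => j _.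
  exact: (measurableT_comp (mg j) (measurable_tnth j)).
rewrite big_ord_recl -(IH _ (fun j => f0 _) (fun j => mf _))/= /lebesgue_cons ge0_integral_pushforward//; last 2 first.
- by apply/measurable_EFinP; exact: mprod.
- by move=> x xT; rewrite lee_fin prodr_ge0.
rewrite preimage_setT.
rewrite (_ : (fun x => _) = (fun z : measurableTypeR R * N.-tuple (measurableTypeR R) =>
  (f ord0 z.1 * \prod_(j < N) f (lift ord0 j) (tnth z.2 j))%:E)); last first.
  apply/funext => -[x y] /=; rewrite big_ord_recl; congr ((_ * _)%:E).
  by apply: eq_bigr => j _; rewrite /tcons /= tnthS.
rewrite fubini_tonelli1/=; last 2 first.
- apply/measurable_EFinP; apply: measurable_funM.
    exact: (measurableT_comp (mf ord0) measurable_fst).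
  exact: (measurableT_comp (mprod _ _ (fun j => mf (lift ord0 j))) measurable_snd).
- by move=> z; rewrite lee_fin mulr_ge0// prodr_ge0.
rewrite /fubini_F /=.
under eq_integral => x _.
  under eq_integral do rewrite EFinM.
  rewrite ge0_integralZl_EFin//; last 2 first.
  - by move=> y _; rewrite lee_fin prodr_ge0.
  - by apply/measurable_EFinP; exact: (mprod _ (fun j => f (lift ord0 j)) (fun j => mf _)).
  over.
rewrite /= ge0_integralZr//.
- by apply/measurable_EFinP; exact: mf.
- by move=> x _; rewrite lee_fin.
- by apply: integral_ge0 => y _; rewrite lee_fin prodr_ge0.
- exact: measurable_tcons.
Qed.

End ProductIntegral.

(** * Increments of the kernel *)

Section Kernel.
Context {R : realType}.
Notation normc := ComplexField.Normc.normc.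

Lemma normcE (z : R[i]) : normc z = Num.sqrt (complex.Re z ^+ 2 + complex.Im z ^+ 2).
Proof. by case: z. Qed.

Lemma norm_sin_le (x : R) : `|sin x| <= `|x|.
Proof.
wlog x0 : x / 0 <= x => [wl|].
  have [|/ltW] := leP 0 x; first exact: wl.
  by rewrite -oppr_ge0 => /wl; rewrite sinN !normrN.
have := @MVT_segment R sin cos 0 x x0.
move=> /(_ (fun y _ => is_derive_sin y)) [|c _].
  by apply: continuous_subspaceT => y; exact: continuous_sin.
rewrite sin0 !subr0 => ->; rewrite normrM -[leRHS]mul1r ler_wpM2r//; exact: cos_max.
Qed.

(** The squared chord is [2 - 2 cos (a - b) = 4 sin^2 ((a - b) / 2)]. *)
Lemma normc_expiB (a b : R) : normc (expi a - expi b) <= Num.min 2 `|a - b|.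
Proof.
rewrite normcE /expi /=.
have -> : (cos a - cos b) ^+ 2 + (sin a - sin b) ^+ 2 = 2 - 2 * cos (a - b).
  rewrite cosB; have := cos2Dsin2 a; have := cos2Dsin2 b => h1 h2.
  rewrite (_ : _ + _ = (cos a ^+ 2 + sin a ^+ 2) + (cos b ^+ 2 + sin b ^+ 2)
    - 2 * (cos a * cos b + sin a * sin b)); last by ring.
  by rewrite h1 h2; ring.
rewrite le_min; apply/andP; split.
  rewrite -(@ler_pXn2r _ 2)// ?nnegrE ?sqrtr_ge0// sqr_sqrtr; have := cos_geN1 (a - b).
    by move=> ?; lra.
  by have := cos_le1 (a - b); lra.
rewrite -(@ler_pXn2r _ 2)// ?nnegrE ?sqrtr_ge0// sqr_sqrtr; last first.
  by have := cos_le1 (a - b); lra.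
set u := a - b.
have -> : cos u = 1 - 2 * sin (u / 2) ^+ 2.
  rewrite [in LHS](_ : u = (u / 2) *+ 2); last by rewrite mulr2n -splitr.
  by rewrite cos_mulr2n cos2sin2 mulrnDl mulNrn; ring.
have := norm_sin_le (u / 2) => h.
have := sqr_le_of_norm h; rewrite real_normK ?num_real// => h2.
have : `|u / 2| ^+ 2 = `|u| ^+ 2 / 4.
  by rewrite !real_normK ?num_real//; field.
by rewrite !real_normK ?num_real// in h2 *; lra.
Qed.

Lemma normc_real (c : R) : 0 <= c -> normc c%:C%C = c.
Proof. by move=> c0; rewrite /= expr0n addr0 sqrtr_sqr ger0_norm. Qed.

Lemma normc_prod (I : Type) (r : seq I) (Q : pred I) (F : I -> R[i]) :
  normc (\prod_(i <- r | Q i) F i) = \prod_(i <- r | Q i) normc (F i).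
Proof.
by apply: (big_morph _ (@ComplexField.Normc.normcM R)); exact: ComplexField.Normc.normc1.
Qed.

Lemma normc_expiB_le (a b x de p : R) : `|a - b| <= de ->
  normc ((expi (a * x) - expi (b * x)) / (`|x| `^ p)%:C%C) <=
  Num.min 2 (de * `|x|) / `|x| `^ p.
Proof.
move=> abd; rewrite ComplexField.Normc.normcM ComplexField.Normc.normcV normc_real ?powR_ge0//.
rewrite ler_wpM2r ?invr_ge0 ?powR_ge0// (le_trans (normc_expiB _ _))//.
by rewrite le_min !ge_min lexx/= -mulrBl normrM ler_wpM2r ?orbT.
Qed.

Variables (N : nat) (al : R) (H : 'rV[R]_N).

Definition envelope (de : 'I_N -> R) (x : N.-tuple (measurableTypeR R)) : R :=
  \prod_(k < N) envelope1 al (H ord0 k) (de k) (tnth x k).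

(** When only coordinate [j] moves, the other factors come out and the [-1] cancels in factor [j].
    The common factors are themselves increments from 0, of length at most [T]. This is why chaining
    moves one coordinate at a time. *)
Lemma kernel_diff_le (T de : R) (s t : 'rV[R]_N) (j : 'I_N) x :
  (forall k, 0 <= s ord0 k <= T) -> (forall k, 0 <= t ord0 k <= T) ->
  (forall k, k != j -> s ord0 k = t ord0 k) -> `|t ord0 j - s ord0 j| <= de ->
  normc (hfss_kernel al H t x - hfss_kernel al H s x) <=
  envelope (fun k => if k == j then de else T) x.
Proof.
move=> sT tT st std; rewrite /hfss_kernel /envelope.
rewrite (bigD1 j)//= [X in _ - X](bigD1 j)//= [leRHS](bigD1 j)//= eqxx.
rewrite [X in _ - _ * X](eq_bigr (fun k => (expi (t ord0 k * tnth x k) - 1) /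
    (`|tnth x k| `^ (H ord0 k + al^-1))%:C%C)); last by move=> k kj; rewrite st.
rewrite -mulrBl -mulrBl opprB addrA subrK ComplexField.Normc.normcM normc_prod.
have n0 (z : R[i]) : 0 <= normc z by rewrite normcE sqrtr_ge0.
rewrite ler_pM//.
- by apply: prodr_ge0 => k _; exact: n0.
- exact: normc_expiB_le.
apply: ler_prod => k kj; rewrite n0 (negbTE kj)/=.
have /andP[a b] := tT k.
have /(normc_expiB_le (tnth x k) (H ord0 k + al^-1)) : `|t ord0 k - 0| <= T by rewrite subr0 ger0_norm.
by rewrite mul0r {2}/expi cos0 sin0.
Qed.

Lemma measurable_envelope de : measurable_fun setT (envelope de).
Proof.
apply: measurable_prod => k _.
exact: (measurableT_comp (measurable_envelope1 _ _ _) (measurable_tnth k)).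
Qed.

Lemma envelope_ge0 de x : (forall k, 0 <= de k) -> 0 <= envelope de x.
Proof. by move=> d0; apply: prodr_ge0 => k _; exact: envelope1_ge0. Qed.

Hypothesis al0 : 0 < al.
Hypothesis H01 : forall k, 0 < H ord0 k < 1.

(** The maximum with 1 absorbs the missing power of [T] at the moving coordinate, so that one
    constant serves every [j]. *)
Definition envelope_cst (T : R) : R :=
  \prod_(k < N) (envelope1_cst al (H ord0 k) * Num.max 1 (T `^ (al * H ord0 k))).

Lemma integral_envelope_le (T de : R) (j : 'I_N) : 0 < T -> 0 < de ->
  (\int[Defs.lebesgue_measureN N]_x
    (envelope (fun k => if k == j then de else T) x `^ al)%:E <=
   (envelope_cst T * de `^ (al * H ord0 j))%:E)%E.
Proof.
move=> T0 d0; set dk := fun k : 'I_N => if k == j then de else T.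
have dk0 k : 0 < dk k by rewrite /dk; case: ifP.
have -> : (\int[Defs.lebesgue_measureN N]_x (envelope dk x `^ al)%:E =
    \int[Defs.lebesgue_measureN N]_x
      (\prod_(k < N) (envelope1 al (H ord0 k) (dk k) (tnth x k) `^ al))%:E)%E.
  apply: eq_integral => x _; congr EFin; rewrite /envelope.
  have := fun k => envelope1_ge0 al (H ord0 k) (tnth x k) (ltW (dk0 k)).
  move=> h; elim: (index_enum _) => [|k r IH]; first by rewrite !big_nil powR1.
  by rewrite !big_cons powRM ?h ?prodr_ge0// IH.
rewrite (integral_prod_tnth (f := fun k y => envelope1 al (H ord0 k) (dk k) y `^ al)); last 2 first.
- by move=> k x; exact: powR_ge0.
- by move=> k; exact: (measurableT_comp (measurable_powR _) (measurable_envelope1 _ _ _)).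
pose c k := envelope1_cst al (H ord0 k) * dk k `^ (al * H ord0 k).
apply: (@le_trans _ _ (\prod_(k < N) (c k)%:E)%E).
  apply: (@proj2 (0 <= \prod_(k < N) \int[lebesgue_measure]_x (envelope1 al (H ord0 k) (dk k) x `^ al)%:E)%E).
  elim/big_ind2 : _ => [|a b a' b' [a0 ab] [b0 bb]|k _]; first by rewrite lee01.
    by split; [exact: mule_ge0|exact: lee_pmul].
  split; first by apply: integral_ge0 => x _; rewrite lee_fin powR_ge0.
  exact: integral_envelope1_le.
rewrite prodEFin lee_fin /envelope_cst (bigD1 j)//= [X in _ <= X * _](bigD1 j)//=.
have c0 k := envelope1_cst_ge0 al0 (H01 k).
rewrite {1}/c /dk eqxx -!mulrA.
rewrite ler_wpM2l ?c0// [leRHS]mulrA [leRHS]mulrC ler_wpM2l ?powR_ge0//.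
rewrite -[leLHS]mul1r ler_pM//.
- by apply: prodr_ge0 => k _; rewrite mulr_ge0 ?c0 ?powR_ge0.
- by rewrite le_max lexx.
apply: ler_prod => k kj; rewrite /c /dk (negbTE kj) mulr_ge0 ?c0 ?powR_ge0//=.
by rewrite ler_wpM2l ?c0// le_max lexx orbT.
Qed.

Definition cmeasurable d (T : measurableType d) (F : T -> R[i]) :=
  measurable_fun setT (fun x => complex.Re (F x)) /\
  measurable_fun setT (fun x => complex.Im (F x)).

Lemma cmeasurable_kernel (t : 'rV[R]_N) : cmeasurable (hfss_kernel al H t).
Proof.
have mM d (T : measurableType d) (F G : T -> R[i]) : cmeasurable F -> cmeasurable G ->
    cmeasurable (fun x => F x * G x).
  move=> [F1 F2] [G1 G2]; split.
    rewrite (_ : (fun x => _) = (fun x => complex.Re (F x) * complex.Re (G x) -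
        complex.Im (F x) * complex.Im (G x))).
      by apply: measurable_funB; exact: measurable_funM.
    by apply/funext => x; case: (F x) (G x) => a b [].
  rewrite (_ : (fun x => _) = (fun x => complex.Re (F x) * complex.Im (G x) +
      complex.Im (F x) * complex.Re (G x))).
    by apply: measurable_funD; exact: measurable_funM.
  by apply/funext => x; case: (F x) (G x) => a b [].
rewrite /hfss_kernel.
elim: (index_enum _) => [|k r IH].
  under [X in cmeasurable X]eq_fun do rewrite big_nil.
  by split; exact: measurable_cst.
under [X in cmeasurable X]eq_fun do rewrite big_cons.
apply: (mM) => //.
have mk := measurable_tnth k (T := measurableTypeR R) (n := N).
have mtk : measurable_fun setT (fun x : N.-tuple (measurableTypeR R) => t ord0 k * tnth x k).
  by apply: measurable_funM; [exact: measurable_cst|exact: mk].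
have mexp : cmeasurable (fun x : N.-tuple (measurableTypeR R) => expi (t ord0 k * tnth x k) - 1).
  split => /=; apply: measurable_funB; try exact: measurable_cst.
    by apply: (measurableT_comp _ mtk); apply: continuous_measurable_fun; exact: continuous_cos.
  by apply: (measurableT_comp _ mtk); apply: continuous_measurable_fun; exact: continuous_sin.
apply: (mM _ _ _ _ mexp).
under [X in cmeasurable X]eq_fun do rewrite -fmorphV -powRN.
split => /=; last exact: measurable_cst.
apply: (measurableT_comp (measurable_powR _)).
by apply: measurableT_comp => //; exact: mk.
Qed.

End Kernel.

(** * Tails of the increments of the field *)

Section FieldTail.
Context {R : realType} {N : nat} {d : measure_display} {Omega : measurableType d}.
Notation normc := ComplexField.Normc.normc.
Variables (P : probability Omega R) (al : R) (H : 'rV[R]_N) (Z : 'rV[R]_N -> {RV P >-> R}).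
Hypotheses (al02 : 0 < al < 2) (H01 : forall j, 0 < H ord0 j < 1).
Hypothesis hZ : is_hfss al H Z.

Let al0 : 0 < al. Proof. by have /andP[] := al02. Qed.

(** [2^al] stems from the 4 in [good_quadratic_powR], and [1 - exp (-1)] from the choice
    [th * w^2 = 1]. *)
Definition tail_cst (T : R) : R := 2 `^ al * envelope_cst al H T / (1 - expR (-1)).

(** The defining formula is used at the [2 m] endpoints, with coefficients [a] and [- a]. *)
Lemma cos_increments m (s t : 'I_m -> 'rV[R]_N) (a : 'rV[R]_m) :
  (forall i, orthant (s i)) -> (forall i, orthant (t i)) ->
  \int[P]_w cos (\sum_i a ord0 i * (Z (t i) w - Z (s i) w)) =
  expR (- \int[Defs.lebesgue_measureN N]_x
     (normc (\sum_i (a ord0 i)%:C%C * (hfss_kernel al H (t i) x - hfss_kernel al H (s i) x)) `^ al)).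
Proof.
move=> os ot.
pose u (k : 'I_(m + m)) := match fintype.split k with inl i => t i | inr i => s i end.
pose b (k : 'I_(m + m)) := match fintype.split k with inl i => a ord0 i | inr i => - a ord0 i end.
have ul i : fintype.split (lshift m i) = inl i :> 'I_m + 'I_m by exact: (unsplitK (inl i)).
have ur i : fintype.split (rshift m i) = inr i :> 'I_m + 'I_m by exact: (unsplitK (inr i)).
have ou k : orthant (u k) by rewrite /u; case: fintype.split.
have /(congr1 (@complex.Re R)) /= := hZ b ou.
rewrite unlock => hE.
transitivity (\int[P]_w cos (\sum_(k < m + m) b k * Z (u k) w)).
  apply: eq_Rintegral => w _; congr cos.
  rewrite big_split_ord/= -big_split/=; apply: eq_bigr => i _.
  by rewrite /b /u ul ur mulNr mulrBr.
rewrite /Rintegral hE /Rintegral; congr (expR (- fine _)).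
apply: eq_integral => x _; congr (EFin (normc _ `^ _)).
rewrite big_split_ord/= -big_split/=; apply: eq_bigr => i _.
by rewrite /b /u ul ur mulrBr rmorphN/= mulNr.
Qed.

(** The term with [de] is the cost of a large [Q], common to all increments; only the Gaussian term
    carries their number [m]. *)
Lemma increments_tail (T de v w : R) m (s t : 'I_m -> 'rV[R]_N) (j : 'I_N) :
  0 < T -> 0 < de -> 0 < v -> 0 < w ->
  (forall i k, 0 <= s i ord0 k <= T) -> (forall i k, 0 <= t i ord0 k <= T) ->
  (forall i k, k != j -> s i ord0 k = t i ord0 k) ->
  (forall i, `|t i ord0 j - s i ord0 j| <= de) ->
  (P (above (fun i om => (Z (t i) om - Z (s i) om)%R) (2 * v)%R) <=
   (tail_cst T * (de `^ (al * H ord0 j) / w `^ al) +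
    2 * m%:R * expR (- (v ^+ 2 / (8 * w ^+ 2))))%:E)%E.
Proof.
move=> T0 d0 v0 w0 sT tT st std.
have w20 : 0 < w ^+ 2 by rewrite exprn_gt0.
pose th := (w ^+ 2)^-1; have th0 : 0 < th by rewrite invr_gt0.
pose f i x := hfss_kernel al H (t i) x - hfss_kernel al H (s i) x.
pose G := envelope al H (fun k => if k == j then de else T).
have G0 x : 0 <= G x by apply: envelope_ge0 => k; case: ifP; rewrite ltW.
have fG i x : normc (f i x) <= G x by exact: (kernel_diff_le _ _ _ (sT i) (tT i) (st i) (std i)).
pose p x : 'rV[R]_m := \row_i complex.Re (f i x).
pose q x : 'rV[R]_m := \row_i complex.Im (f i x).
have pG x i : `|p x ord0 i| <= G x.
  rewrite mxE (le_trans _ (fG i x))// normcE -sqrtr_sqr ler_wsqrtr// lerDl sqr_ge0//.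
have qG x i : `|q x ord0 i| <= G x.
  rewrite mxE (le_trans _ (fG i x))// normcE -sqrtr_sqr ler_wsqrtr// lerDr sqr_ge0//.
(* One integrand for both exponents: the characteristic function of the increments at [Some a], the
   Laplace transform of [Q] at [None]. *)
pose k (o : option 'rV[R]_m) x : R :=
  (if o is Some a then dot a (p x) ^+ 2 + dot a (q x) ^+ 2 else 4 * th * G x ^+ 2) `^ (al / 2).
have kS a x : k (Some a) x = normc (\sum_i (a ord0 i)%:C%C * f i x) `^ al.
  have -> : \sum_i (a ord0 i)%:C%C * f i x = (dot a (p x) +i* dot a (q x))%C.
    rewrite /dot; elim/big_ind3 : _ => //= [x1 y1 z1 x2 y2 z2 -> ->//|i _].
    by rewrite !mxE; case: (f i x) => y z; simpc.
  by rewrite normcE/= -powR12_sqrt ?addr_ge0 ?sqr_ge0// -powRrM mulrC.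
have kN x : k None x = (2 / w) `^ al * G x `^ al.
  rewrite /k (_ : 4 * th * G x ^+ 2 = (2 / w * G x) ^+ 2); last first.
    by rewrite /th; field; rewrite gt_eqF.
  have h0 : 0 <= 2 / w * G x by rewrite mulr_ge0 ?divr_ge0 ?(ltW w0).
  by rewrite -powR_mulrn// -powRrM mulrCA divff ?mulr1// powRM ?divr_ge0 ?(ltW w0).
have mf i : cmeasurable (f i).
  have [t1 t2] := cmeasurable_kernel al H (t i).
  have [s1 s2] := cmeasurable_kernel al H (s i).
  split.
    rewrite (_ : (fun x => _) = (fun x => complex.Re (hfss_kernel al H (t i) x) -
      complex.Re (hfss_kernel al H (s i) x))); first exact: measurable_funB.
    by apply/funext => x; rewrite /f raddfB.
  rewrite (_ : (fun x => _) = (fun x => complex.Im (hfss_kernel al H (t i) x) -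
    complex.Im (hfss_kernel al H (s i) x))); first exact: measurable_funB.
  by apply/funext => x; rewrite /f raddfB.
have mG : measurable_fun setT G by exact: measurable_envelope.
have mk o : measurable_fun setT (k o).
  apply: (measurableT_comp (measurable_powR _)).
  case: o => [a|]; last first.
    by apply: measurable_funM; [exact: measurable_cst|exact: measurable_funX].
  apply: measurable_funD; apply: measurable_funX; apply: measurable_sum => i;
    apply: measurable_funM; (try exact: measurable_cst).
    by under eq_fun do rewrite mxE; have [] := mf i.
  by under eq_fun do rewrite mxE; have [] := mf i.
have k0 o x : 0 <= k o x by exact: powR_ge0.
have IG := integral_envelope_le al0 H01 j T0 d0; rewrite -/G in IG.
have mGa : measurable_fun setT (fun x => G x `^ al) by exact: (measurableT_comp (measurable_powR _)).
have iG : (Defs.lebesgue_measureN N).-integrable setT (EFin \o (fun x => G x `^ al)).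
  apply/integrableP; split; first exact/measurable_EFinP.
  under eq_integral do rewrite /= ger0_norm ?powR_ge0//.
  exact: (le_lt_trans IG (ltry _)).
have ik o : (Defs.lebesgue_measureN N).-integrable setT (EFin \o k o).
  (* Each dot product is at most the sum of the [|a_i|] times [G x]; the 2 accounts for the real and
     imaginary parts. *)
  pose B : R := if o is Some a then (2 * (\sum_i `|a ord0 i|) ^+ 2) `^ (al / 2) else (2 / w) `^ al.
  have B0 : 0 <= B by rewrite /B; clear B; case: o => [a|]; exact: powR_ge0.
  apply: (@le_integrable _ _ _ _ setT measurableT _ (EFin \o (fun x => B * G x `^ al))).
  - exact/measurable_EFinP.
  - move=> x _ /=; rewrite lee_fin !ger0_norm ?mulr_ge0 ?powR_ge0//.
    rewrite /B; clear B B0; case: o => [a|]; last by rewrite kN.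
    have -> : (2 * (\sum_i `|a ord0 i|) ^+ 2) `^ (al / 2) * G x `^ al = (2 * (\sum_i `|a ord0 i|) ^+ 2 * G x ^+ 2) `^ (al / 2).
      rewrite [RHS]powRM ?(mulr_ge0 _ (sqr_ge0 _)) ?sqr_ge0//; congr (_ * _).
      by rewrite -powR_mulrn// -powRrM mulrCA divff ?mulr1.
    have bd (y : 'rV[R]_m) : (forall i, `|y ord0 i| <= G x) -> dot a y ^+ 2 <= (\sum_i `|a ord0 i|) ^+ 2 * G x ^+ 2.
      move=> yG; rewrite -exprMn; apply: sqr_le_of_norm.
      rewrite (le_trans (ler_norm_sum _ _ _))// mulr_suml; apply: ler_sum => i _.
      by rewrite normrM ler_wpM2l.
    apply: ge0_ler_powR; rewrite ?nnegrE ?divr_ge0 ?(ltW al0)//.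
    + by rewrite addr_ge0 ?sqr_ge0.
    + by apply: mulr_ge0; [apply: mulr_ge0|]; rewrite ?sqr_ge0.
    + by have := bd _ (pG x); have := bd _ (qG x); lra.
  - by apply: eq_integrable (integrableZl measurableT B iG).
have al2 : 0 < al / 2 < 1 by have /andP[? ?] := al02; apply/andP; split; lra.
have gk : good th (fun o => expR (- \int[Defs.lebesgue_measureN N]_x k o x)).
  apply: good_integral => // x.
  have := good_quadratic_powR th0 al2 (pG x) (qG x) => g c c0.
  by apply: (good_ext (g c c0)) => -[a|].
pose phi (a : 'rV[R]_m) := expR (- \int[Defs.lebesgue_measureN N]_x k (Some a) x).
pose c := expR (- \int[Defs.lebesgue_measureN N]_x k None x).
have gphi : good th (fun o => if o is Some a then phi a else c).
  by apply: (good_ext gk) => -[a|].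
have mX i : measurable_fun setT (fun om => Z (t i) om - Z (s i) om).
  by apply: measurable_funB; exact: measurable_funPT.
have Xphi (a : 'rV[R]_m) : \int[P]_om cos (\sum_i a ord0 i * (Z (t i) om - Z (s i) om)) = phi a.
  rewrite cos_increments => [|i l|i l]; last 2 first.
  - by have /andP[] := sT i l.
  - by have /andP[] := tT i l.
  by rewrite /phi; congr (expR (- _)); apply: eq_Rintegral => x _; rewrite kS.
apply: (le_trans (tail_estimate mX th0 Xphi gphi v0 w0)).
rewrite lee_fin /tail_bound lerD2r /th mulVf ?gt_eqF// /tail_cst.
have e1 : 0 < 1 - expR (-1) :> R by rewrite subr_gt0 -[ltRHS]expR0 ltr_expR oppr_lt0.
rewrite [leRHS]mulrAC ler_wpM2r ?invr_ge0 ?(ltW e1)//.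
rewrite /c.
have -> : \int[Defs.lebesgue_measureN N]_x k None x =
    (2 / w) `^ al * \int[Defs.lebesgue_measureN N]_x (G x `^ al).
  by under eq_Rintegral do rewrite kN; rewrite RintegralZl.
set J := \int[_]_x _.
have JG : J <= envelope_cst al H T * de `^ (al * H ord0 j).
  rewrite -lee_fin (le_trans _ IG)// fineK//.
  exact: integrable_fin_num.
have q0 : 0 <= 2 / w by rewrite divr_ge0 ?(ltW w0).
apply: (@le_trans _ _ ((2 / w) `^ al * J)).
  by have := expR_ge1Dx (- ((2 / w) `^ al * J)); lra.
rewrite (le_trans (ler_wpM2l (powR_ge0 _ _) JG))//.
rewrite powRM ?invr_ge0 ?(ltW w0)// -powR_inv1 ?(ltW w0)// -powRrM mulN1r powRN.
by rewrite le_eqVlt; apply/orP; left; apply/eqP; ring.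
Qed.

End FieldTail.

(** * Chaining on anisotropic grids *)

Section Level.
Context {R : realType}.
Variable h : R.
Hypothesis h01 : 0 < h < 1.

Let h0 : 0 < h. Proof. by have /andP[] := h01. Qed.

(* The least integer above [n / h], so that [mesh n `^ h] is
   comparable to [2 ^- n]. *)
Definition level (n : nat) : nat := (Num.trunc (n%:R / h)).+1.

(** Bounds the number of binary digits gained in a coordinate between consecutive levels. *)
Definition level_step : nat := (Num.trunc h^-1).+1.

Definition mesh (n : nat) : R := (2 ^+ level n)^-1.

Lemma mesh_gt0 n : 0 < mesh n. Proof. by rewrite invr_gt0 exprn_gt0. Qed.

Lemma level_bounds n : n%:R <= (level n)%:R * h <= n.+1%:R.
Proof.
have nh0 : 0 <= n%:R / h by rewrite divr_ge0 ?(ltW h0).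
have /andP[k1 k2] := truncn_itv nh0.
rewrite -ler_pdivrMr// (ltW k2)/= /level -natr1 mulrDl mul1r -natr1.
rewrite ler_pdivlMr// in k1; have /andP[_ h1] := h01.
by rewrite lerD// ltW.
Qed.

Lemma level_leS n : (level n <= level n.+1)%N.
Proof. by rewrite ltnS le_truncn// ler_wpM2r ?invr_ge0 ?(ltW h0)// ler_nat. Qed.

Lemma levelS_le n : (level n.+1 <= level n + level_step)%N.
Proof.
have nh0 : 0 <= n%:R / h by rewrite divr_ge0 ?(ltW h0).
have nh1 : 0 <= n.+1%:R / h by rewrite divr_ge0 ?(ltW h0).
have ih0 : 0 <= h^-1 by rewrite invr_ge0 (ltW h0).
have /andP[_ k2] := truncn_itv nh0; have /andP[_ l2] := truncn_itv ih0.
have /andP[m1 _] := truncn_itv nh1.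
rewrite /level /level_step addSn ltnS -ltnS -(ltr_nat R) (le_lt_trans m1)//.
by rewrite -addSn natrD -[n.+1%:R]natr1 mulrDl mul1r ltrD.
Qed.

Lemma mesh_powR n : mesh n `^ h = expR (- ((level n)%:R * h * ln 2)).
Proof.
rewrite /mesh -powR_mulrn// -powRN -powRrM /powR gt_eqF//; congr expR; ring.
Qed.

Lemma mesh_powR_le n : mesh n `^ h <= expR (- (n%:R * ln 2)).
Proof.
have /andP[k1 _] := level_bounds n.
by rewrite mesh_powR ler_expR lerN2 ler_wpM2r// ln_ge0// ler1n.
Qed.

Lemma mesh_powR_ge n : expR (- (n.+1%:R * ln 2)) <= mesh n `^ h.
Proof.
have /andP[_ k1] := level_bounds n.
by rewrite mesh_powR ler_expR lerN2 ler_wpM2r// ln_ge0// ler1n.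
Qed.

(** The index [n + 1] absorbs the rounding in [level]: the mesh may be as small as
    [2^-((n + 1) / h)]. *)
Lemma le_mesh n x : 0 <= x -> x `^ h <= expR (- (n.+1%:R * ln 2)) -> x <= mesh n.
Proof.
move=> x0 xn; rewrite leNgt; apply/negP => mx.
have : mesh n `^ h < x `^ h.
  by rewrite gt0_ltr_powR// nnegrE ltW// mesh_gt0.
by rewrite ltNge (le_trans xn (mesh_powR_ge n)).
Qed.

End Level.

(** * Paths and chaining in the grids *)

Section Grid.
Context {R : realType} {N : nat}.
Variables (H : 'rV[R]_N) (T : nat).
Hypothesis H01 : forall j, 0 < H ord0 j < 1.
Notation lev j n := (level (H ord0 j) n).
Implicit Types (i : 'I_N -> nat) (s t : 'rV[R]_N).

Definition cube : set 'rV[R]_N := [set t | forall j, 0 <= t ord0 j <= T%:R].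

Definition grid n i : 'rV[R]_N := \row_j ((i j)%:R / 2 ^+ lev j n).

Definition floor_index n t : 'I_N -> nat := fun j => Num.trunc (t ord0 j * 2 ^+ lev j n).

Definition grid_floor n t := grid n (floor_index n t).

Definition in_box n i := forall k, (i k <= T * 2 ^ lev k n)%N.

Definition incr i (j : 'I_N) : 'I_N -> nat := fun k => (i k + (k == j))%N.

(** Subtraction being truncated, the summand is the distance between [i k] and [i' k]. *)
Definition idist i i' := (\sum_k ((i k - i' k) + (i' k - i k)))%N.

Lemma idist_sym i i' : idist i i' = idist i' i.
Proof. by apply: eq_bigr => k _; rewrite addnC. Qed.

Variables (f : 'rV[R]_N -> R) (b : nat -> R).
Hypothesis b0 : forall n, 0 <= b n.

Definition steps_bounded n := forall i j, in_box n i -> in_box n (incr i j) ->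
  `|f (grid n (incr i j)) - f (grid n i)| <= b n.

Lemma grid_lipschitz n i i' : steps_bounded n -> in_box n i -> in_box n i' ->
  `|f (grid n i) - f (grid n i')| <= (idist i i')%:R * b n.
Proof.
move=> sb; move: {2}(idist i i') (leqnn (idist i i')) => D.
elim: D i i' => [|D IH] i i' dD bi bi'.
  have -> : i = i'.
    apply/funext => k; have : ((i k - i' k) + (i' k - i k) <= idist i i')%N.
      by rewrite /idist (bigD1 k)//= leq_addr.
    lia.
  by rewrite subrr normr0 mulr_ge0.
have [ii|] := pselect (i = i'); first by rewrite ii subrr normr0 mulr_ge0.
move=> nii; have [k /eqP ik] : exists k, i k <> i' k.
  by apply/existsNP => ee; apply: nii; exact/funext.
clear nii.
(* Always raising the smaller of the two indices keeps the path inside the box, since the new value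
   is at most the larger one. *)
wlog lt_ik : i i' dD bi bi' ik / (i k < i' k)%N => [wl|].
  move: ik; rewrite neq_ltn => /orP[ik|ik]; first by apply: wl => //; rewrite ltn_eqF.
  rewrite distrC idist_sym; apply: wl => //; first by rewrite idist_sym.
  by rewrite ltn_eqF.
have dI : idist i i' = (idist (incr i k) i').+1.
  rewrite /idist (bigD1 k)//= [in RHS](bigD1 k)//= /incr eqxx addn1.
  rewrite [in RHS](eq_bigr (fun l => ((i l - i' l) + (i' l - i l))%N)).
    by move: (\sum_(_ | _) _)%N => S; lia.
  by move=> l /negbTE ->; rewrite addn0.
have bI : in_box n (incr i k).
  move=> l; rewrite /incr; case: eqP => [->|_]; last by rewrite addn0.
  by rewrite addn1 (leq_trans lt_ik).
rewrite -(subrKA (f (grid n (incr i k)))) (le_trans (ler_normD _ _))//.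
rewrite dI -nat1r mulrDl mul1r lerD//; first by rewrite distrC sb.
by apply: IH => //; rewrite -ltnS -dI.
Qed.


Lemma floor_index_itv n t k : 0 <= t ord0 k ->
  (floor_index n t k)%:R <= t ord0 k * 2 ^+ lev k n < (floor_index n t k).+1%:R.
Proof. by move=> t0; apply: truncn_itv; rewrite mulr_ge0 ?exprn_ge0. Qed.

Lemma in_box_floor n t : cube t -> in_box n (floor_index n t).
Proof.
move=> tT k; have /andP[t0 tk] := tT k; have /andP[h _] := floor_index_itv n t0.
by rewrite -(ler_nat R) (le_trans h)// natrM natrX ler_wpM2r ?exprn_ge0.
Qed.

Definition refine n i : 'I_N -> nat := fun k => (i k * 2 ^ (lev k n.+1 - lev k n))%N.

Lemma grid_refine n i : grid n.+1 (refine n i) = grid n i.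
Proof.
apply/rowP => k; rewrite !mxE natrM natrX -mulrA; congr (_ * _).
have h := level_leS (H01 k) n.
rewrite -[in X in _ / X](subnK h) exprD invfM mulrA divff ?mul1r//.
Qed.

Lemma in_box_refine n i : in_box n i -> in_box n.+1 (refine n i).
Proof.
move=> bi k; have h := level_leS (H01 k) n.
by rewrite /refine -[in leqRHS](subnK h) addnC expnD mulnA leq_mul2r bi orbT.
Qed.

Definition max_step : nat := \max_k 2 ^ level_step (H ord0 k).

(** Both points lie in the same cell of level [n], which the next level cuts into at most [max_step]
    parts per coordinate. *)
Lemma idist_refine n t : cube t ->
  (idist (refine n (floor_index n t)) (floor_index n.+1 t) <= N * max_step)%N.
Proof.
move=> tT; rewrite /idist -[N in (_ <= N * _)%N]card_ord -sum_nat_const.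
apply: leq_sum => k _.
have h := level_leS (H01 k) n; have h2 := levelS_le (H01 k) n.
have /andP[t0 _] := tT k.
have /andP[a1 a2] := floor_index_itv n t0.
have /andP[b1 b2] := floor_index_itv n.+1 t0.
rewrite /refine; set a := floor_index n t k in a1 a2 *.
set c := floor_index n.+1 t k in b1 b2 *.
pose D := (lev k n.+1 - lev k n)%N.
have eD : 2 ^+ lev k n.+1 = 2 ^+ lev k n * 2 ^+ D :> R by rewrite -exprD subnKC.
rewrite eD mulrA in b1 b2.
have p0 : 0 < 2 ^+ D :> R by rewrite exprn_gt0.
have r1 : (a * 2 ^ D < c.+1)%N.
  rewrite -(ltr_nat R) (le_lt_trans _ b2)// natrM natrX ler_wpM2r// ltW//.
have r2 : (c < a.+1 * 2 ^ D)%N.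
  by rewrite -(ltr_nat R) (le_lt_trans b1)// natrM natrX ltr_pM2r.
have r3 : (2 ^ D <= max_step)%N.
  apply: leq_trans (leq_bigmax k); rewrite leq_exp2l// /D; lia.
rewrite -/D; rewrite mulSn in r2.
move: (2 ^ D)%N (a * 2 ^ D)%N r1 r2 r3 => p q; lia.
Qed.

Definition near_at n s t := forall k, `|s ord0 k - t ord0 k| <= mesh (H ord0 k) n.

Lemma idist_floor n s t : cube s -> cube t -> near_at n s t ->
  (idist (floor_index n s) (floor_index n t) <= N)%N.
Proof.
move=> sT tT st; rewrite /idist -[N in (_ <= N)%N]card_ord -sum1_card.
apply: leq_sum => k _.
have /andP[s0 _] := sT k; have /andP[t0 _] := tT k.
have /andP[a1 a2] := floor_index_itv n s0.
have /andP[b1 b2] := floor_index_itv n t0.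
set a := floor_index n s k in a1 a2 *; set c := floor_index n t k in b1 b2 *.
have p0 : 0 < 2 ^+ lev k n :> R by rewrite exprn_gt0.
have : `|s ord0 k * 2 ^+ lev k n - t ord0 k * 2 ^+ lev k n| <= 1.
  by rewrite -mulrBl normrM (gtr0_norm p0) -ler_pdivlMr// mul1r; exact: st.
rewrite ler_norml => /andP[d1 d2].
have r1 : (a < c.+2)%N.
  by rewrite -(ltr_nat R) -[c.+2%:R]natr1; lra.
have r2 : (c < a.+2)%N.
  by rewrite -(ltr_nat R) -[a.+2%:R]natr1; lra.
lia.
Qed.

Lemma grid_floor_telescope n M t : cube t ->
  (forall m, (n < m)%N -> steps_bounded m) -> (n <= M)%N ->
  `|f (grid_floor M t) - f (grid_floor n t)| <=
  (N * max_step)%:R * \sum_(n <= m < M) b m.+1.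
Proof.
move=> tT sb nM; rewrite -(subnKC nM); elim: (M - n)%N => [|k IH].
  by rewrite addn0 subrr normr0 big_geq// mulr0.
rewrite addnS big_nat_recr ?leq_addr//= mulrDr.
rewrite -(subrKA (f (grid_floor (n + k) t))) (le_trans (ler_normD _ _))// addrC lerD//.
(* A coarse grid point is also a point of the next grid, so one telescoping term is a path of fine
   steps. *)
rewrite /grid_floor -[grid (n + k) _]grid_refine.
rewrite distrC (le_trans (grid_lipschitz _ _ _))//.
- by apply: sb; rewrite ltnS leq_addr.
- exact/in_box_refine/in_box_floor.
- exact: in_box_floor.
- by rewrite ler_wpM2r// ler_nat idist_refine.
Qed.

Variable S : R.
Hypothesis sumb : forall n M, \sum_(n <= m < M) b m.+1 <= S * b n.

(** At most [N] steps join the two floors at level [n]; each endpoint adds one tail of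
    refinements. *)
Definition chain_cst : R := N%:R + 2 * ((N * max_step)%:R * S).

Lemma grid_floor_dist n M t : cube t ->
  (forall m, (n <= m)%N -> steps_bounded m) -> (n <= M)%N ->
  `|f (grid_floor M t) - f (grid_floor n t)| <= (N * max_step)%:R * S * b n.
Proof.
move=> tT sb nM; rewrite (le_trans (grid_floor_telescope tT _ nM))//.
  by move=> m nm; apply: sb; exact: ltnW.
by rewrite -mulrA ler_wpM2l.
Qed.

Lemma is_cvg_grid_floor n0 t : cube t -> (forall m, (n0 <= m)%N -> steps_bounded m) ->
  b n @[n --> \oo] --> 0 -> cvgn (fun M => f (grid_floor M t)).
Proof.
move=> tT sb bl; apply/cauchy_cvgP/cauchy_exP => e e0.
have : (N * max_step)%:R * S * b n @[n --> \oo] --> 0.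
  by rewrite -[X in _ --> X](mulr0 ((N * max_step)%:R * S)); apply: cvgMr.
move=> /cvgrPdist_lt/(_ _ e0)[n1 _ h1].
pose n := maxn n0 n1; exists (f (grid_floor n t)); exists n => // M /= nM.
rewrite /ball/= distrC (le_lt_trans (grid_floor_dist tT _ nM))//.
  by move=> m nm; apply: sb; rewrite (leq_trans _ nm)// leq_maxl.
have := h1 n (leq_maxr _ _); rewrite sub0r normrN; exact: le_lt_trans (ler_norm _).
Qed.

(** Limits along the floors appear instead of values of [f], whose continuity is unknown. The bound
    thus applies both to the constructed version and to a given continuous one. *)
Lemma chaining n s t ls lt : cube s -> cube t ->
  (forall m, (n <= m)%N -> steps_bounded m) -> near_at n s t ->
  f (grid_floor M s) @[M --> \oo] --> ls -> f (grid_floor M t) @[M --> \oo] --> lt ->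
  `|ls - lt| <= chain_cst * b n.
Proof.
move=> sT tT sb st cs ct.
have lim u lu : cube u -> f (grid_floor M u) @[M --> \oo] --> lu ->
    `|lu - f (grid_floor n u)| <= (N * max_step)%:R * S * b n.
  move=> uT cu; apply/ler_addgt0Pr => e e0.
  move/cvgrPdist_le : cu => /(_ _ e0)[M0 _ hM].
  have := hM (maxn n M0) (leq_maxr _ _).
  have := grid_floor_dist uT sb (leq_maxl n M0) => h1 h2.
  rewrite -(subrKA (f (grid_floor (maxn n M0) u))) (le_trans (ler_normD _ _))//.
  by rewrite addrC lerD.
have h1 := lim _ _ sT cs; have h2 := lim _ _ tT ct.
have h3 : `|f (grid_floor n s) - f (grid_floor n t)| <= N%:R * b n.
  rewrite (le_trans (grid_lipschitz (sb n (leqnn n)) (in_box_floor n sT) (in_box_floor n tT)))//.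
  by rewrite ler_wpM2r// ler_nat idist_floor.
rewrite (_ : ls - lt = (ls - f (grid_floor n s)) + (f (grid_floor n s) - f (grid_floor n t))
  - (lt - f (grid_floor n t))); last by ring.
rewrite (le_trans (ler_normB _ _))// /chain_cst.
have := ler_normD (ls - f (grid_floor n s)) (f (grid_floor n s) - f (grid_floor n t)).
rewrite mulrDl -mulrA mulr_natl mulr2n; lra.
Qed.

End Grid.

(** * Summability of the scales *)

Section PowerSums.
Context {R : realType}.

(* Telescoping: [(n+1)^-p] is at most a multiple of [n^-(p-1) - (n+1)^-(p-1)]. *)
Lemma sum_powR_le (p : R) (K : nat) : 1 < p ->
  \sum_(0 <= n < K) (n.+2%:R `^ p)^-1 <= (p - 1)^-1.
Proof.
move=> p1; set a := p - 1; have a0 : 0 < a by rewrite subr_gt0.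
have step n : (n.+2%:R `^ p)^-1 <= a^-1 * (n.+1%:R `^ (- a) - n.+2%:R `^ (- a)) :> R.
  have n2 : 0 < n.+2%:R :> R by [].
  rewrite -powRN /powR !gt_eqF//.
  set x := ln n.+1%:R; set y := ln n.+2%:R.
  have ex : expR x = n.+1%:R by rewrite lnK ?posrE.
  have ey : expR y = n.+2%:R by rewrite lnK ?posrE.
  have yx : n.+2%:R^-1 <= y - x.
    have := expR_ge1Dx (x - y); rewrite expRB ex ey => h.
    have : n.+1%:R / n.+2%:R = 1 - n.+2%:R^-1 :> R.
      by rewrite -[n.+1%:R](addrK 1) natr1 mulrBl divff ?mul1r// gt_eqF.
    move=> e; move: h; rewrite e; move: (_^-1) => z hz; lra.
  rewrite ler_pdivlMl// (_ : - p * y = - a * y - y); last by rewrite /a; ring.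
  rewrite expRB ey (_ : - a * x = - a * y + a * (y - x)); last by ring.
  rewrite expRD -[X in _ <= _ - X]mulr1 -mulrBr mulrCA ler_wpM2l ?expR_ge0//.
  by apply: (le_trans (ler_wpM2l (ltW a0) yx)); rewrite lerBrDl expR_ge1Dx.
apply: (@le_trans _ _ (a^-1 * (1 - K.+1%:R `^ (- a)))).
  elim: K => [|K IH]; first by rewrite big_geq// powR1 subrr mulr0.
  rewrite big_nat_recr//= (le_trans (lerD IH (step K)))// -mulrDr.
  by rewrite le_eqVlt; apply/orP; left; apply/eqP; congr (_ * _); ring.
by rewrite -[leRHS]mulr1 ler_wpM2l ?invr_ge0 ?(ltW a0)// gerBl powR_ge0.
Qed.

Variable q : R.
Hypothesis q0 : 0 < q.

(** For [q = 2 / alpha] and large [n], of the order of [tau * |log tau|^(2 / alpha)] at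
    [tau = 2^-n]. *)
Definition scale_bound (n : nat) : R := n.+1%:R `^ q / 2 ^+ n.

Lemma scale_bound_gt0 n : 0 < scale_bound n.
Proof. by rewrite divr_gt0 ?powR_gt0 ?exprn_gt0. Qed.

Let ln2 : 0 < ln 2 :> R. Proof. by rewrite ln_gt0// ltr1n. Qed.

Let ra := expR (- (ln 2 / 2)) : R.

Let ra01 : 0 <= ra < 1.
Proof. by rewrite expR_ge0 -[X in _ < X]expR0 ltr_expR oppr_lt0 divr_gt0. Qed.

Lemma scale_bound_geometric : exists C : R, 0 <= C /\ forall n, scale_bound n <= C * ra ^+ n.
Proof.
(* Since [q * c = ln 2 / 2], the inequality [ln y <= y - 1] at [y = c * (n + 1)] bounds [(n + 1)^q]
   by a multiple of [2^(n / 2)]. *)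
pose c := ln 2 / 2 / q; have c0 : 0 < c by rewrite !divr_gt0.
exists (expR (ln 2 / 2 - q * (1 + ln c))); split; first exact: expR_ge0.
move=> n; rewrite /scale_bound /ra -expRM_natl -expRD.
have -> : (2 ^+ n)^-1 = expR (- (n%:R * ln 2)) :> R.
  by rewrite expRN expRM_natl lnK ?posrE.
rewrite /powR gt_eqF// -expRD ler_expR.
have h : ln (c * n.+1%:R) <= c * n.+1%:R - 1.
  by rewrite lerBrDl (le_trans (expR_ge1Dx _))// lnK// posrE mulr_gt0.
rewrite lnM ?posrE// in h.
have qc : q * (c * n.+1%:R) = ln 2 / 2 * n.+1%:R by rewrite /c; field; rewrite gt_eqF.
have := ler_wpM2l (ltW q0) h; rewrite mulrBr qc -natr1; lra.
Qed.

Lemma cvg_scale_bound : scale_bound n @[n --> \oo] --> 0.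
Proof.
have [C [C0 hC]] := scale_bound_geometric.
have : C * ra ^+ n @[n --> \oo] --> 0.
  rewrite -[X in _ --> X](mulr0 C); apply: cvgMr; apply: cvg_expr.
  by have /andP[? ?] := ra01; rewrite ger0_norm.
apply: (squeeze_cvgr _ (cvg_cst 0)).
by apply: nearW => n; rewrite (ltW (scale_bound_gt0 n))/=.
Qed.

(** As [n + r + 2 <= (n + 1) * (r + 2)], the scales are submultiplicative, and a tail is at most its
    first scale times a geometric series. *)
Lemma sum_scale_bound : exists S : R, 0 <= S /\ forall n M, \sum_(n <= m < M) scale_bound m.+1 <= S * scale_bound n.
Proof.
have [C [C0 hC]] := scale_bound_geometric.
have /andP[r0 r1] := ra01.
have i0 : 0 <= (1 - ra)^-1 by rewrite invr_ge0 subr_ge0 ltW.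
exists (C * (1 - ra)^-1); split; first exact: mulr_ge0.
move=> n M; have [Mn|nM] := leqP M n.
  by rewrite big_geq// mulr_ge0 ?mulr_ge0// ltW// scale_bound_gt0.
apply: (@le_trans _ _ (\sum_(0 <= r < M - n) scale_bound n * (C * ra ^+ r))).
  rewrite -{1}[n]add0n big_addn; apply: ler_sum => r _.
  apply: (@le_trans _ _ (scale_bound n * scale_bound r.+1)).
    rewrite /scale_bound mulrACA -invfM -exprD addnS addnC.
    rewrite ler_pM2r ?invr_gt0 ?exprn_gt0// -powRM// ge0_ler_powR ?nnegrE ?mulr_ge0 ?(ltW q0)//.
    by rewrite -natrM ler_nat; lia.
  rewrite ler_wpM2l ?(ltW (scale_bound_gt0 n))// (le_trans (hC _))// ler_wpM2l//.
  by rewrite exprS -[leRHS]mul1r ler_wpM2r ?exprn_ge0// ltW.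
rewrite -mulr_sumr mulrC ler_wpM2r ?(ltW (scale_bound_gt0 n))// -mulr_sumr ler_wpM2l//.
exact: sum_geometric_le.
Qed.

End PowerSums.

(** * Borel-Cantelli *)

Section BorelCantelli.
Context {R : realType} {N : nat} {d : measure_display} {Omega : measurableType d}.
Variables (P : probability Omega R) (al : R) (H : 'rV[R]_N) (Z : 'rV[R]_N -> {RV P >-> R}).
Hypotheses (al02 : 0 < al < 2) (H01 : forall j, 0 < H ord0 j < 1).
Hypothesis hZ : is_hfss al H Z.

Let al0 : 0 < al. Proof. by have /andP[] := al02. Qed.

Let be : R := 2 / al.
Let be0 : 0 < be. Proof. by rewrite divr_gt0. Qed.

Let p : R := 2 - al / 2.
Let p1 : 1 < p. Proof. by have /andP[_ ?] := al02; rewrite /p; lra. Qed.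

(* The envelope of the jumps may exceed its scale [2 ^- n] by the factor
   [(n+1)^(2/al - 1/2)] with summable probability [(n+1)^-p]. *)
Let w (n : nat) : R := n.+1%:R `^ (2 / al - 2^-1) / 2 ^+ n.

Let w0 n : 0 < w n. Proof. by rewrite divr_gt0 ?powR_gt0 ?exprn_gt0. Qed.

Variables (T la : R).
Hypotheses (T0 : 0 < T) (la0 : 0 <= la).

(** [la] is the exponential growth rate of the number of increments per level; this constant leaves
    a factor [exp (- (n + 1))] after the union bound. *)
Definition step_cst : R := 16 * (la + 1).

Definition step_bound (n : nat) : R := step_cst * scale_bound be n.

Lemma step_cst_gt0 : 0 < step_cst. Proof. by rewrite mulr_gt0 ?ltr_wpDl. Qed.

Let v (n : nat) : R := 8 * (la + 1) * scale_bound be n.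

Let v0 n : 0 < v n.
Proof. by rewrite mulr_gt0 ?scale_bound_gt0// mulr_gt0 ?ltr_wpDl. Qed.

Let v2E n : 2 * v n = step_bound n.
Proof. by rewrite /v /step_bound /step_cst; ring. Qed.

(** [v n] is [8 * (la + 1) * sqrt (n + 1)] times [w n], so the quotient equals
    [8 * (la + 1)^2 * (n + 1)]. *)
Let gauss_exponent n : (la + 1) * n.+1%:R <= v n ^+ 2 / (8 * w n ^+ 2).
Proof.
have n1 : 0 < n.+1%:R :> R by [].
have -> : v n = 8 * (la + 1) * (Num.sqrt n.+1%:R * w n).
  rewrite /v /scale_bound /w; congr (_ * _); rewrite mulrA; congr (_ / _).
  rewrite -powR12_sqrt// -powRD; last by rewrite (gt_eqF n1) implybT.
  by congr (_ `^ _); rewrite /be; ring.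
have wn0 : w n != 0 by rewrite gt_eqF.
move: (w n) wn0 => y y0.
have -> : (8 * (la + 1) * (Num.sqrt n.+1%:R * y)) ^+ 2 / (8 * y ^+ 2) =
    8 * (la + 1) ^+ 2 * Num.sqrt n.+1%:R ^+ 2 by field.
rewrite sqr_sqrtr//.
have l1 : 1 <= la + 1 by rewrite lerDr.
have l2 : 0 <= la + 1 by rewrite addr_ge0.
by rewrite ler_wpM2r// expr2 mulrA ler_peMl// (le_trans l1)// ler_peMl// ler1n.
Qed.

(** [mesh^H <= 2^-n] cancels the dyadic part of [w n], and [(2 / al - 1/2) * al = p]. *)
Let mesh_ratio j n :
  mesh (H ord0 j) n `^ (al * H ord0 j) / w n `^ al <= (n.+1%:R `^ p)^-1.
Proof.
have n1 : 0 < n.+1%:R :> R by [].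
have p20 : 0 < 2 ^+ n :> R by rewrite exprn_gt0.
rewrite ler_pdivrMr ?powR_gt0// [leRHS]mulrC [al * _]mulrC powRrM.
have -> : w n `^ al / n.+1%:R `^ p = ((2 ^+ n)^-1) `^ al.
  rewrite /w powRM ?powR_ge0 ?invr_ge0 ?(ltW p20)// -powRrM.
  rewrite (_ : (2 / al - 2^-1) * al = p); last by rewrite /p; field; rewrite gt_eqF.
  by rewrite mulrAC divff ?mul1r// gt_eqF ?powR_gt0.
rewrite ge0_ler_powR ?nnegrE ?powR_ge0 ?invr_ge0 ?(ltW p20) ?(ltW al0)//.
rewrite (le_trans (mesh_powR_le (H01 j) n))//.
by rewrite expRN expRM_natl lnK ?posrE.
Qed.

Variables (j : 'I_N) (m : nat -> nat).
Variables (s t : forall n, 'I_(m n) -> 'rV[R]_N).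
Hypothesis m_le : forall n, (m n)%:R <= expR (n.+1%:R * la).
Hypothesis sT : forall n i k, 0 <= @s n i ord0 k <= T.
Hypothesis tT : forall n i k, 0 <= @t n i ord0 k <= T.
Hypothesis st : forall n i k, k != j -> @s n i ord0 k = @t n i ord0 k.
Hypothesis std : forall n i, `|@t n i ord0 j - @s n i ord0 j| <= mesh (H ord0 j) n.

Definition large_step (n : nat) : set Omega :=
  above (fun i om => Z (@t n i) om - Z (@s n i) om) (step_bound n).

(** The maximum makes the constant nonnegative without a sign proof for [tail_cst]. *)
Let tc := Num.max 0 (tail_cst al H T).

Lemma large_step_prob n :
  (P (large_step n) <= (tc * (n.+1%:R `^ p)^-1 + 2 * expR (- 1) ^+ n.+1)%:E)%E.
Proof.
rewrite /large_step -v2E.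
have := increments_tail al02 H01 hZ T0 (mesh_gt0 _ n) (v0 n) (w0 n)
  (@sT n) (@tT n) (@st n) (@std n).
move=> /le_trans; apply.
rewrite lee_fin lerD//.
  apply: (@le_trans _ _ (tc * (mesh (H ord0 j) n `^ (al * H ord0 j) / w n `^ al))).
    by rewrite ler_wpM2r ?divr_ge0 ?powR_ge0// le_max lexx orbT.
  by rewrite ler_wpM2l// le_max lexx.
rewrite -mulrA ler_wpM2l//.
apply: (@le_trans _ _ (expR (n.+1%:R * la) * expR (- ((la + 1) * n.+1%:R)))).
  by rewrite ler_pM ?expR_ge0// ler_expR lerN2.
by rewrite -expRD -expRM_natl ler_expR le_eqVlt; apply/orP; left; apply/eqP; ring.
Qed.

Lemma measurable_large_step n : measurable (large_step n).
Proof.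
rewrite /large_step /above (_ : [set _ | _] = \bigcup_(i in [set: 'I_(m n)])
    (fun om => `|Z (@t n i) om - Z (@s n i) om|) @^-1` `]step_bound n, +oo[).
  apply: fin_bigcup_measurable => // i _.
  have mn : measurable_fun setT (fun om => `|Z (@t n i) om - Z (@s n i) om|).
    by apply: measurableT_comp => //; apply: measurable_funB; exact: measurable_funPT.
  by rewrite -[_ @^-1` _]setTI; apply: mn => //; exact: measurable_itv.
apply/seteqP; split => om /=.
  by move=> /existsP[i h]; exists i => //=; rewrite in_itv/= andbT.
by move=> [i _ /=]; rewrite in_itv/= andbT => h; apply/existsP; exists i.
Qed.

Lemma large_step_lim_sup : P (lim_sup_set large_step) = 0.
Proof.
apply: lim_sup_set_cvg0; first exact: measurable_large_step.
pose u n : R := tc * (n.+1%:R `^ p)^-1 + 2 * expR (- 1) ^+ n.+1.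
have tc0 : 0 <= tc by rewrite le_max lexx.
have u0 n : 0 <= u n by rewrite addr_ge0 ?mulr_ge0 ?invr_ge0 ?powR_ge0 ?exprn_ge0 ?expR_ge0.
apply: (@le_lt_trans _ _ (\sum_(0 <= n <oo) (u n)%:E)%E).
  by apply: lee_nneseries => [n _ _|n _]; [exact: measure_ge0|exact: large_step_prob].
have e1 : 0 <= expR (- 1 : R) < 1.
  by rewrite expR_ge0 -[X in _ < X]expR0 ltr_expR oppr_lt0 ltr01.
apply: (@le_lt_trans _ _ (tc * (1 + (p - 1)^-1) + 2 * (1 - expR (-1))^-1)%:E); last exact: ltry.
apply: lime_le; first by apply: is_cvg_nneseries => n _ _; rewrite lee_fin.
apply: nearW => K /=; rewrite sumEFin lee_fin /u big_split/= -!mulr_sumr lerD ?ler_wpM2l//.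
  case: K => [|K]; first by rewrite big_geq// addr_ge0// invr_ge0 subr_ge0 ltW.
  (* The term [n = 0] is split off because [sum_powR_le] starts at the base 2. *)
  rewrite big_nat_recl//= powR1 invr1 lerD2l; exact: sum_powR_le.
apply: le_trans (sum_geometric_le K e1); apply: ler_sum => n _.
have /andP[h1 h2] := e1.
by rewrite exprS -[leRHS]mul1r ler_wpM2r ?exprn_ge0// ltW.
Qed.

End BorelCantelli.

(** * Enumeration of the grid steps *)

Section GridSteps.
Context {R : realType} {N : nat}.
Variables (H : 'rV[R]_N) (T : nat).

Definition level_growth : nat := \max_k (level_step (H ord0 k)).+1.

Definition box_size n : nat := (T * 2 ^ (level_growth * n.+1))%N.

Definition box_index n : finType := {ffun 'I_N -> 'I_(box_size n).+1}.

(** One finite index type serves all coordinates although their levels differ. Clamping sends the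
    surplus indices to the boundary of the true box, where a step may degenerate to length 0. *)
Definition clamp n (i : 'I_N -> nat) : 'I_N -> nat :=
  fun k => minn (i k) (T * 2 ^ level (H ord0 k) n).

Definition box_start n (x : 'I_#|box_index n|) : 'rV[R]_N :=
  grid H n (clamp n (fun k => (enum_val x : box_index n) k)).

Definition box_end j n (x : 'I_#|box_index n|) : 'rV[R]_N :=
  grid H n (clamp n (incr (fun k => (enum_val x : box_index n) k) j)).

(** [(T + 1) * 2^level_growth] to the power [n + 1] bounds the number of indices per coordinate at
    level [n]. *)
Definition growth_rate : R := ln ((((T + 1) * 2 ^ level_growth) ^ N)%N%:R).

Let base0 : (0 < ((T + 1) * 2 ^ level_growth) ^ N)%N.
Proof. by rewrite expn_gt0 muln_gt0 expn_gt0 addn1. Qed.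

Lemma growth_rate_ge0 : 0 <= growth_rate.
Proof. by rewrite ln_ge0// ler1n. Qed.

Lemma card_box_index_le n : #|box_index n|%:R <= expR (n.+1%:R * growth_rate).
Proof.
rewrite expRM_natl lnK ?posrE ?ltr0n// -natrX ler_nat.
have leq_e a b k : (a <= b -> a ^ k <= b ^ k)%N.
  by move=> ab; case: k => // k; rewrite leq_exp2r.
rewrite card_ffun !card_ord -expnM [(N * _)%N]mulnC expnM; apply: leq_e.
rewrite /box_size expnMn -expnM.
have : (0 < 2 ^ (level_growth * n.+1))%N by rewrite expn_gt0.
have : (T + 1 <= (T + 1) ^ n.+1)%N by rewrite -[leqLHS]expn1 leq_pexp2l// addn1.
move: (2 ^ _)%N ((T + 1) ^ n.+1)%N => x y h1 h2.
by apply: (@leq_trans ((T + 1) * x)); [lia|rewrite leq_mul2r h1 orbT].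
Qed.

Lemma grid_clamp_cube n i k : 0 <= grid H n (clamp n i) ord0 k <= T%:R.
Proof.
rewrite mxE divr_ge0 ?exprn_ge0//= ler_pdivrMr ?exprn_gt0//.
by rewrite -natrX -natrM ler_nat geq_minr.
Qed.

Lemma box_start_end_eq j n (x : 'I_#|box_index n|) k : k != j ->
  box_start x ord0 k = box_end j x ord0 k.
Proof. by move=> /negbTE kj; rewrite !mxE /clamp /incr kj addn0. Qed.

Lemma box_start_end_dist j n (x : 'I_#|box_index n|) :
  `|box_end j x ord0 j - box_start x ord0 j| <= mesh (H ord0 j) n.
Proof.
rewrite !mxE /clamp /incr eqxx addn1 -mulrBl normrM /mesh.
have p0 : 0 < 2 ^+ level (H ord0 j) n :> R by rewrite exprn_gt0.
rewrite [X in _ * X]gtr0_norm ?invr_gt0// -[leRHS]mul1r ler_wpM2r ?invr_ge0 ?(ltW p0)//.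
set a := minn _ _; set c := minn _ _.
have ac : (c <= a <= c.+1)%N by rewrite /a /c; lia.
have /andP[ca ac1] := ac.
by rewrite -natrB// normr_nat -[1]/(1%:R) ler_nat leq_subLR addn1.
Qed.


Hypothesis H01 : forall j, 0 < H ord0 j < 1.

Lemma level_le_growth k n : (level (H ord0 k) n <= level_growth * n.+1)%N.
Proof.
have g : ((level_step (H ord0 k)).+1 <= level_growth)%N.
  exact: (leq_bigmax (F := fun k => (level_step (H ord0 k)).+1) k).
apply: (@leq_trans ((level_step (H ord0 k)).+1 * n.+1)%N); last by rewrite leq_mul2r g orbT.
elim: n => [|n IH].
  by rewrite /level mul0r truncn0 muln1.
rewrite (leq_trans (levelS_le (H01 k) n))//; lia.
Qed.

End GridSteps.

(** * Modulus of continuity *)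

Section Modulus.
Context {R : realType} {N : nat}.
Variables (al : R) (H : 'rV[R]_N).
Hypotheses (al0 : 0 < al) (H01 : forall j, 0 < H ord0 j < 1) (N0 : (0 < N)%N).
Implicit Types s t : 'rV[R]_N.

Lemma coord_le_enorm (u : 'rV[R]_N) k : `|u ord0 k| <= enorm u.
Proof.
rewrite /enorm -sqrtr_sqr ler_wsqrtr// (bigD1 k)//= lerDl.
by apply: sumr_ge0 => l _; exact: sqr_ge0.
Qed.

Lemma powR_le_aniso s t k : `|s ord0 k - t ord0 k| `^ H ord0 k <= anisotropic_dist H s t.
Proof.
by rewrite /anisotropic_dist (bigD1 k)//= lerDl; apply: sumr_ge0 => l _; exact: powR_ge0.
Qed.

Lemma aniso_gt0 s t : 0 < enorm (s - t) -> 0 < anisotropic_dist H s t.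
Proof.
move=> st; have [k sk] : exists k, s ord0 k - t ord0 k <> 0.
  apply/existsNP => e; move: st; rewrite /enorm big1 ?sqrtr0 ?ltxx// => k _.
  by rewrite !mxE e expr0n.
by apply: lt_le_trans (powR_le_aniso s t k); rewrite powR_gt0// normr_gt0; exact/eqP.
Qed.

Variable f : 'rV[R]_N -> R.
Variables (C : R) (n0 : nat).
Hypothesis C0 : 0 <= C.
Hypothesis fC : forall n s t, (n0 <= n)%N -> unit_cube s -> unit_cube t ->
  near_at H n s t -> `|f s - f t| <= C * scale_bound (2 / al) n.
Variable eps : R.
Hypothesis eps0 : 0 < eps.

Let ratio s t := `|f s - f t| / (anisotropic_dist H s t *
  `|ln (anisotropic_dist H s t)| `^ ((2 + eps) / al)).

(** For [2^-(n+2) <= tau <= 2^-(n+1)] the numerator is at most [4 C tau (n+1)^(2/al)] and the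
    denominator at least [tau ((n+1) ln 2)^((2+eps)/al)]. The surplus [(n+1)^(eps/al)] makes the
    ratio small. *)
Lemma ratio_le (e : R) : 0 < e -> exists n1 : nat, forall s t, unit_cube s -> unit_cube t ->
  0 < enorm (s - t) -> anisotropic_dist H s t <= expR (- (n1.+1%:R * ln 2)) ->
  ratio s t <= e.
Proof.
move=> e0.
have l2 : 0 < ln 2 :> R by rewrite ln_gt0// ltr1n.
pose g := (2 + eps) / al; have g0 : 0 < g by rewrite divr_gt0// addr_gt0.
pose r := eps / al; have r0 : 0 < r by rewrite divr_gt0.
have gE : g = 2 / al + r by rewrite /g mulrDl.
have lg : 0 < ln 2 `^ g :> R by rewrite powR_gt0.
(* With [x = y^(1/r)], [n + 1 >= x] yields [4 * C <= e * (ln 2)^g * (n + 1)^r]. *)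
pose y := 4 * C / (e * ln 2 `^ g); have y0 : 0 <= y by rewrite divr_ge0 ?mulr_ge0 ?(ltW e0) ?(ltW lg).
pose x := y `^ r^-1.
exists (n0 + Num.trunc x)%N => s t sU tU st.
set tau := anisotropic_dist H s t => tau_le.
have tau0 : 0 < tau by exact: aniso_gt0.
have h0 : (n0 + Num.trunc x).+1%:R <= - ln tau / ln 2.
  rewrite ler_pdivlMr// lerNr.
  by rewrite -ler_expR lnK// posrE.
have lt0 : 0 <= - ln tau / ln 2 by apply: le_trans h0.
have /andP[k1 k2] := truncn_itv lt0.
set k := Num.trunc (- ln tau / ln 2) in k1 k2.
have nk : (n0 + Num.trunc x < k)%N.
  by rewrite -ltnS -(ltr_nat R) (le_lt_trans h0).
have [n kn] : exists n, k = n.+1 by case: k nk {k1 k2} => // n _; exists n.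
rewrite ler_pdivlMr// kn in k1; rewrite ltr_pdivrMr// kn in k2.
have tau1 : tau <= expR (- (n.+1%:R * ln 2)).
  by rewrite -[leLHS]lnK ?posrE// ler_expR lerNr.
have tau2 : expR (- (n.+2%:R * ln 2)) <= tau.
  by rewrite -[leRHS]lnK ?posrE// ler_expR lerNl ltW.
have nt : near_at H n s t.
  by move=> j; apply: le_mesh => //; rewrite (le_trans (powR_le_aniso s t j)).
have n0n : (n0 <= n)%N.
  by rewrite -ltnS -kn (leq_trans _ nk)// ltnS leq_addr.
have h1 := fC n0n sU tU nt.
have p2 m : expR (- (m%:R * ln 2)) = (2 ^+ m)^-1 :> R.
  by rewrite expRN expRM_natl lnK ?posrE.
have n1 : 0 < n.+1%:R :> R by [].
have h2 : scale_bound (2 / al) n <= 4 * tau * n.+1%:R `^ (2 / al).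
  rewrite /scale_bound mulrC ler_wpM2r ?powR_ge0//.
  have : 4 * expR (- (n.+2%:R * ln 2)) = (2 ^+ n)^-1 :> R.
    by rewrite p2 !exprS; have : 2 ^+ n != 0 :> R by []; move: (2 ^+ n) => z z0; field.
  lra.
have lnt : n.+1%:R * ln 2 <= `|ln tau| by rewrite (le_trans k1)// -normrN ler_norm.
have xn : y <= n.+1%:R `^ r.
  have -> : y = x `^ r by rewrite /x -powRrM mulVf ?gt_eqF// powRr1.
  apply: ge0_ler_powR; rewrite ?nnegrE ?powR_ge0 ?(ltW r0)//.
  by rewrite (le_trans (ltW (truncnS_gt _)))// ler_nat -kn (leq_trans _ nk)// ltnS leq_addl.
have den : 0 < tau * `|ln tau| `^ g.
  by rewrite mulr_gt0// powR_gt0// (lt_le_trans _ lnt)// mulr_gt0.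
rewrite /ratio -/tau -/g ler_pdivrMr// (le_trans h1)//.
rewrite (le_trans (ler_wpM2l C0 h2))//.
have h3 : (n.+1%:R * ln 2) `^ g <= `|ln tau| `^ g.
  by rewrite ge0_ler_powR ?nnegrE ?(ltW g0)// mulr_ge0 ?(ltW l2).
apply: (@le_trans _ _ (e * (tau * (n.+1%:R * ln 2) `^ g))); last first.
  by rewrite ler_wpM2l ?(ltW e0)// ler_wpM2l ?(ltW tau0).
rewrite powRM ?(ltW l2)// gE powRD ?(gt_eqF n1) ?implybT// -gE.
have h4 : 4 * C <= e * ln 2 `^ g * n.+1%:R `^ r.
  by rewrite [leRHS]mulrC -ler_pdivrMr ?mulr_gt0.
have h5 : 0 <= tau * n.+1%:R `^ (2 / al) by rewrite mulr_ge0 ?powR_ge0 ?(ltW tau0).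
have := ler_wpM2r h5 h4.
move: (n.+1%:R `^ (2 / al)) (n.+1%:R `^ r) (ln 2 `^ g) => a1 a2 a3 hh.
rewrite (_ : C * _ = 4 * C * (tau * a1)); last by ring.
by rewrite (_ : e * _ = e * a3 * a2 * (tau * a1)); last by ring.
Qed.

Lemma near0_aniso_le (eta : R) : 0 < eta ->
  \forall h \near 0^'+, forall s t, enorm (s - t) <= h -> anisotropic_dist H s t <= eta.
Proof.
move=> eta0.
have eN : 0 < eta / N%:R by rewrite divr_gt0// ltr0n.
have : \forall h \near (0 : R)^'+, forall k, h `^ H ord0 k <= eta / N%:R.
  apply: filter_forall => k; have /andP[Hk _] := H01 k.
  have /cvgrPdist_le/(_ _ eN) := powR_cvg0 Hk.
  by apply: filterS => h; rewrite sub0r normrN; apply: le_trans; exact: ler_norm.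
apply: filterS => h hk s t st.
rewrite (_ : eta = \sum_(k < N) (eta / N%:R)); last first.
  by rewrite sumr_const card_ord -[_ *+ N]mulr_natr divfK// pnatr_eq0 -lt0n.
apply: ler_sum => k _; apply: le_trans (hk k).
have /andP[Hk _] := H01 k.
have := coord_le_enorm (s - t) k; rewrite !mxE => h1.
by rewrite ge0_ler_powR ?nnegrE ?(ltW Hk)// (le_trans _ (le_trans h1 st)).
Qed.

(** A supremum over the empty set would be [-oo]; a pair of points along one axis shows that the set
    is inhabited. *)
Lemma modulus_ratio_ge0 h : 0 < h -> (0 <= modulus_ratio al eps H f h)%E.
Proof.
move=> h0; pose j := Ordinal N0; pose c := Num.min h 1.
have c0 : 0 < c by rewrite lt_min h0 ltr01.
apply: le_ereal_sup_tmp; exists (ratio (c *: delta_mx ord0 j) 0)%:E; last first.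
  by rewrite lee_fin divr_ge0// mulr_ge0 ?powR_ge0// sumr_ge0// => k _; exact: powR_ge0.
exists (c *: delta_mx ord0 j), 0; split => //.
- move=> k; rewrite !mxE eqxx/=; case: eqP => _; rewrite ?mulr1 ?mulr0 ?lexx ?ler01//.
  by rewrite (ltW c0) ge_min lexx orbT.
- by move=> k; rewrite mxE lexx ler01.
- rewrite subr0 (_ : enorm _ = c); first by rewrite c0 ge_min lexx.
  rewrite /enorm (bigD1 j)//= big1 ?addr0 => [|k kj]; rewrite !mxE eqxx/=.
    by rewrite ?eqxx mulr1 sqrtr_sqr gtr0_norm.
  by rewrite (negbTE kj) mulr0 expr0n.
Qed.

Lemma modulus_ratio_cvg0 : modulus_ratio al eps H f h @[h --> (0 : R)^'+] --> 0%E.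
Proof.
have small e : 0 < e -> \forall h \near (0 : R)^'+,
    (0 <= modulus_ratio al eps H f h <= e%:E)%E.
  move=> e0; have [n1 hn1] := ratio_le e0.
  have := near0_aniso_le (expR_gt0 (- (n1.+1%:R * ln 2))).
  apply: filterS2 (nbhs_right_gt 0) => h h0 hh.
  rewrite modulus_ratio_ge0//=; apply: ge_ereal_sup => _ [s [t [sU tU /andP[st1 st2] ->]]].
  by rewrite lee_fin; apply: hn1 => //; exact: hh.
apply/fine_cvgP; split.
  have := small 1 ltr01; apply: filterS => h /andP[h1 h2].
  by rewrite ge0_fin_numE// (le_lt_trans h2) ?ltry.
apply/cvgrPdist_le => e e0; have := small e e0; apply: filterS => h /andP[h1 h2] /=.
rewrite sub0r normrN ger0_norm ?fine_ge0//.
by rewrite -lee_fin fineK// ge0_fin_numE// (le_lt_trans h2) ?ltry.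
Qed.

End Modulus.

(** * Sample paths *)

Section RandomVariableOf.
Context {R : realType} {d : measure_display} {Omega : measurableType d}.
Variables (f : Omega -> R) (mf : measurable_fun setT f).

(** The measurability proof is kept as an argument so that the structure of measurable function can
    be attached to the term. *)
Definition rv_of (_ : measurable_fun setT f) : Omega -> R := f.

HB.instance Definition _ := isMeasurableFun.Build _ _ _ _ (rv_of mf) mf.

Definition to_rv (P : probability Omega R) : {RV P >-> R} := rv_of mf.

End RandomVariableOf.

Section SamplePaths.
Context {R : realType} {N : nat} {d : measure_display} {Omega : measurableType d}.
Variables (P : probability Omega R) (al : R) (H : 'rV[R]_N) (Z : 'rV[R]_N -> {RV P >-> R}).
Hypotheses (al02 : 0 < al < 2) (H01 : forall j, 0 < H ord0 j < 1).
Hypothesis hZ : is_hfss al H Z.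
Implicit Types s t : 'rV[R]_N.

Let al0 : 0 < al. Proof. by have /andP[] := al02. Qed.

Let be0 : 0 < 2 / al. Proof. by rewrite divr_gt0. Qed.

Let ltr0n_of T : (0 < T)%N -> 0 < T%:R :> R. Proof. by rewrite ltr0n. Qed.

Lemma ae_not (A : set Omega) : measurable A -> P A = 0%E -> {ae P, forall w, ~ A w}.
Proof. by move=> mA A0; exists A; split => // w /= /contrapT. Qed.

Lemma measurable_lim_sup (F : nat -> set Omega) : (forall n, measurable (F n)) ->
  measurable (lim_sup_set F).
Proof.
by move=> mF; apply: bigcap_measurable => // n _; apply: bigcup_measurable => k _.
Qed.

Lemma not_lim_sup (F : nat -> set Omega) w : ~ lim_sup_set F w ->
  exists n, forall k, (n <= k)%N -> ~ F k w.
Proof.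
move=> nF; apply: contrapT => nE; apply: nF => n _; apply: contrapT => nU.
by apply: nE; exists n => k nk Fk; apply: nU; exists k.
Qed.

Definition bad (T : nat) : set Omega := \bigcup_(j in [set: 'I_N])
  lim_sup_set (large_step al Z (growth_rate H T)
    (fun n => @box_start R N H T n) (fun n => @box_end R N H T j n)).

Lemma measurable_bad T : measurable (bad T).
Proof.
apply: fin_bigcup_measurable => // j _; apply: measurable_lim_sup => n.
exact: measurable_large_step.
Qed.

Lemma ae_not_bad T : (0 < T)%N -> {ae P, forall w, ~ bad T w}.
Proof.
move=> T0.
have : {ae P, forall w, forall j, ~ lim_sup_set (large_step al Z (growth_rate H T)
    (fun n => @box_start R N H T n) (fun n => @box_end R N H T j n)) w}.
  apply: filter_forall => j; apply: ae_not.
    by apply: measurable_lim_sup => n; exact: measurable_large_step.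
  apply: (large_step_lim_sup al02 H01 hZ (ltr0n_of T0) (growth_rate_ge0 _ _) (j := j)).
  - by move=> n; exact: card_box_index_le.
  - by move=> n x k; exact: grid_clamp_cube.
  - by move=> n x k; exact: grid_clamp_cube.
  - by move=> n x k; exact: box_start_end_eq.
  - by move=> n x; exact: box_start_end_dist.
by apply: filterS => w nj [j _]; exact: nj.
Qed.

(** Inside the true box clamping changes nothing, so every admissible step is among the enumerated
    ones. *)
Lemma box_index_of T n (i : 'I_N -> nat) : in_box H T n i ->
  exists x : 'I_#|box_index H T n|, box_start x = grid H n i /\
    forall j, in_box H T n (incr i j) -> box_end j x = grid H n (incr i j).
Proof.
move=> bi.
have ik k : (i k < (box_size H T n).+1)%N.
  rewrite ltnS (leq_trans (bi k))// leq_mul2l leq_exp2l// level_le_growth ?orbT//.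
pose y : box_index H T n := [ffun k => inord (i k)].
exists (enum_rank y); split.
  rewrite /box_start enum_rankK; congr grid; apply/funext => k.
  by rewrite /clamp ffunE inordK//; apply/minn_idPl.
move=> j bj; rewrite /box_end enum_rankK; congr grid; apply/funext => k.
rewrite /clamp /incr ffunE inordK//; apply/minn_idPl; exact: bj.
Qed.

Lemma not_bad_steps T w : ~ bad T w -> exists n0, forall n, (n0 <= n)%N ->
  steps_bounded H T (fun t => Z t w) (step_bound al (growth_rate H T)) n.
Proof.
move=> nb.
have /(_ _)/cid-/all_sig[n0 hn0] : forall j : 'I_N, exists n, forall k, (n <= k)%N ->
    ~ large_step al Z (growth_rate H T)
    (fun n => @box_start R N H T n) (fun n => @box_end R N H T j n) k w.
  by move=> j; apply: not_lim_sup => h; apply: nb; exists j.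
exists (\max_j n0 j) => n nn i j bi bj.
have [x [<- /(_ _ bj) <-]] := box_index_of bi.
rewrite leNgt; apply/negP => h.
by apply: (hn0 j n); [exact: leq_trans (leq_bigmax j) nn|apply/existsP; exists x].
Qed.

Lemma step_bound_ge0 la n : 0 <= la -> 0 <= step_bound al la n.
Proof.
by move=> la0; rewrite mulr_ge0 ?(ltW (step_cst_gt0 la0)) ?(ltW (scale_bound_gt0 _ _)).
Qed.

Lemma cvg_step_bound la : step_bound al la n @[n --> \oo] --> 0.
Proof.
rewrite -[X in _ --> X](mulr0 (step_cst la)); apply: cvgMr; exact: cvg_scale_bound.
Qed.

Lemma sum_step_bound : exists S : R, 0 <= S /\ forall la, 0 <= la -> forall n M,
  \sum_(n <= m < M) step_bound al la m.+1 <= S * step_bound al la n.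
Proof.
have [S [S0 hS]] := sum_scale_bound be0; exists S; split => // la la0 n M.
rewrite -mulr_sumr /step_bound mulrCA ler_wpM2l// ltW//; exact: step_cst_gt0.
Qed.

Lemma cubeS (T T' : nat) t : (T <= T')%N -> cube T t -> cube T' t.
Proof.
move=> TT tT k; have /andP[-> h] := tT k; rewrite (le_trans h)// ler_nat//.
Qed.

Lemma orthant_cube t : orthant t -> exists T, (0 < T)%N /\ cube T t.
Proof.
move=> ot; exists (\max_k (Num.trunc (t ord0 k)).+1).+1; split => // k.
rewrite ot/= (le_trans (ltW (truncnS_gt _)))// ler_nat ltnW// ltnS.
exact: (leq_bigmax (F := fun k => (Num.trunc (t ord0 k)).+1) k).
Qed.

Lemma grid_floor_itv n t k : 0 <= t ord0 k ->
  0 <= grid_floor H n t ord0 k <= t ord0 k /\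
  `|t ord0 k - grid_floor H n t ord0 k| <= mesh (H ord0 k) n.
Proof.
move=> t0; rewrite mxE.
have p0 : 0 < 2 ^+ level (H ord0 k) n :> R by rewrite exprn_gt0.
have /andP[h1 h2] := floor_index_itv H n t0.
have h3 : (floor_index H n t k)%:R / 2 ^+ level (H ord0 k) n <= t ord0 k by rewrite ler_pdivrMr.
split; first by rewrite h3 divr_ge0// ltW.
rewrite ger0_norm ?subr_ge0// lerBlDr /mesh -[X in X + _]mul1r -mulrDl ler_pdivlMr//.
by rewrite addrC natr1 ltW.
Qed.

Lemma orthant_grid n i : orthant (grid H n i).
Proof. by move=> k; rewrite mxE divr_ge0// exprn_ge0. Qed.

(* Moving from [t] to its grid approximation one coordinate at a time. *)
Lemma ae_cvg_grid_floor t : orthant t ->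
  {ae P, forall w, Z (grid_floor H n t) w @[n --> \oo] --> Z t w}.
Proof.
move=> ot; have [T [T0 tT]] := orthant_cube ot.
pose pt n l : 'rV[R]_N := \row_k if (k < l)%N then grid_floor H n t ord0 k else t ord0 k.
have ptT n l k : 0 <= pt n l ord0 k <= T%:R.
  rewrite mxE; have [/andP[h1 h2] _] := grid_floor_itv n (ot k).
  have /andP[h3 h4] := tT k.
  by case: ifP => _; rewrite ?h1 ?h3//= (le_trans h2).
(* With a single increment per level the growth rate is 0. *)
have : {ae P, forall w, forall j : 'I_N, ~ lim_sup_set (large_step al Z 0
    (m := fun=> 1%N) (fun n _ => pt n j) (fun n _ => pt n j.+1)) w}.
  apply: filter_forall => j; apply: ae_not.
    by apply: measurable_lim_sup => n; exact: measurable_large_step.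
  apply: (large_step_lim_sup al02 H01 hZ (ltr0n_of T0) (lexx 0) (j := j)) => //.
  - by move=> n; rewrite mulr0 expR0.
  - by move=> n x k kj; rewrite !mxE ltnS [in RHS]leq_eqVlt (_ : (k == j :> nat) = false)//; exact/negbTE.
  - move=> n x; rewrite !mxE ltnSn ltnn distrC.
    by have [_] := grid_floor_itv n (ot j); rewrite mxE.
apply: filterS => w nw.
have /(_ _)/cid-/all_sig[n0 hn0] := fun j => not_lim_sup (nw j).
have dist n : (\max_j n0 j <= n)%N ->
    `|Z (grid_floor H n t) w - Z t w| <= N%:R * step_bound al 0 n.
  move=> nn.
  have main l : (l <= N)%N -> `|Z (pt n l) w - Z (pt n 0%N) w| <= l%:R * step_bound al 0 n.
    elim: l => [_|l IH lN]; first by rewrite subrr normr0 mul0r.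
    rewrite -(subrKA (Z (pt n l) w)) (le_trans (ler_normD _ _))//.
    rewrite -natr1 mulrDl mul1r addrC lerD ?IH ?(ltnW lN)//.
    rewrite leNgt; apply/negP => h.
    apply: (hn0 (Ordinal lN) n); first exact: leq_trans (leq_bigmax (Ordinal lN)) nn.
    by apply/existsP; exists ord0; exact: h.
  have := main N (leqnn N).
  rewrite (_ : pt n N = grid_floor H n t); last by apply/rowP => k; rewrite mxE ltn_ord.
  by rewrite (_ : pt n 0%N = t)//; apply/rowP => k; rewrite mxE.
have : N%:R * step_bound al 0 n @[n --> \oo] --> 0.
  rewrite -[X in _ --> X](mulr0 N%:R); apply: cvgMr; exact: cvg_step_bound.
move=> b0; apply/cvgrPdist_le => e e0.
move/cvgrPdist_le : b0 => /(_ _ e0)[n1 _ h1].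
exists (maxn (\max_j n0 j) n1) => // n /=; rewrite geq_max => /andP[a1 a2].
rewrite distrC (le_trans (dist n a1))//.
by have := h1 n a2; rewrite sub0r normrN; exact: le_trans (ler_norm _).
Qed.

End SamplePaths.

(** * The continuous version and its modulus *)

Section ContinuousVersion.
Context {R : realType} {N : nat} {d : measure_display} {Omega : measurableType d}.
Variables (P : probability Omega R) (al : R) (H : 'rV[R]_N) (Z : 'rV[R]_N -> {RV P >-> R}).
Hypotheses (al02 : 0 < al < 2) (H01 : forall j, 0 < H ord0 j < 1).
Hypothesis hZ : is_hfss al H Z.
Implicit Types s t : 'rV[R]_N.

Let al0 : 0 < al. Proof. by have /andP[] := al02. Qed.

Let be0 : 0 < 2 / al. Proof. by rewrite divr_gt0. Qed.

(** The countable union over cubes makes one null set serve the whole orthant. *)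
Definition exceptional : set Omega := \bigcup_T bad al H Z T.+1.

Lemma measurable_exceptional : measurable exceptional.
Proof. by apply: bigcup_measurable => T _; exact: measurable_bad. Qed.

Lemma ae_not_exceptional : {ae P, forall w, ~ exceptional w}.
Proof.
have : {ae P, forall w, forall T, ~ bad al H Z T.+1 w}.
  by apply: ae_foralln => T; exact: (ae_not_bad al02 H01 hZ).
by apply: filterS => w nb [T _]; exact: nb.
Qed.

Lemma not_exceptional_is_cvg w t : ~ exceptional w -> orthant t ->
  cvgn (fun n => Z (grid_floor H n t) w).
Proof.
move=> nw ot; have [T' [T'0 tT']] := orthant_cube ot.
case: T' T'0 tT' => // T _ tT.
have nb : ~ bad al H Z T.+1 w by move=> h; apply: nw; exists T.
have [n0 hn0] := not_bad_steps H01 nb.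
have [S [S0 hS]] := sum_step_bound al02.
have g0 := growth_rate_ge0 H T.+1.
have := is_cvg_grid_floor H01 (fun n => step_bound_ge0 al n g0) (hS _ g0) tT hn0.

by apply; exact: cvg_step_bound.
Qed.

Lemma not_exceptional_chain w T : ~ exceptional w -> exists C n0, 0 <= C /\
  forall n s t ls lt, (n0 <= n)%N -> cube T.+1 s -> cube T.+1 t -> near_at H n s t ->
  Z (grid_floor H M s) w @[M --> \oo] --> ls -> Z (grid_floor H M t) w @[M --> \oo] --> lt ->
  `|ls - lt| <= C * scale_bound (2 / al) n.
Proof.
move=> nw; have nb : ~ bad al H Z T.+1 w by move=> h; apply: nw; exists T.
have [n0 hn0] := not_bad_steps H01 nb.
have [S [S0 hS]] := sum_step_bound al02.
have g0 := growth_rate_ge0 H T.+1.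
exists (chain_cst H S * step_cst (growth_rate H T.+1)), n0; split.
  rewrite mulr_ge0 ?(ltW (step_cst_gt0 g0))// addr_ge0// mulr_ge0// mulr_ge0//.
move=> n s t ls lt nn sT tT st cs ct; rewrite -mulrA.
apply: (chaining H01 (fun n => step_bound_ge0 al n g0) (hS _ g0) sT tT _ st cs ct) => m nm.
by apply: hn0; exact: leq_trans nm.
Qed.

(** The indicator makes the sequence converge at every outcome, hence a measurable limit, and makes
    the path vanish on the null set, so that continuity holds for all outcomes. *)
Definition limit_path t (w : Omega) : R :=
  if `[< orthant t >] then lim (Z (grid_floor H n t) w * \1_(~` exceptional) w @[n --> \oo]) else 0.

Lemma limit_path_exceptional t w : exceptional w -> limit_path t w = 0.
Proof.
move=> ew; rewrite /limit_path; case: asboolP => // _.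
rewrite (_ : (fun n => _) = fun=> 0); first exact: lim_cst.
by apply/funext => n; rewrite indicE memNset ?mulr0//= => /(_ ew).
Qed.

Lemma cvg_limit_path t w : orthant t -> ~ exceptional w ->
  Z (grid_floor H n t) w @[n --> \oo] --> limit_path t w.
Proof.
move=> ot nw; rewrite /limit_path asboolT//.
rewrite (_ : (fun n => _) = (fun n => Z (grid_floor H n t) w)).
  exact: not_exceptional_is_cvg.
by apply/funext => n; rewrite indicE mem_set ?mulr1.
Qed.

Lemma measurable_limit_path t : measurable_fun setT (limit_path t).
Proof.
have [ot|ot] := pselect (orthant t); last first.
  rewrite /limit_path; under eq_fun do rewrite asboolF//; exact: measurable_cst.
apply: (@measurable_fun_cvg _ _ _ _ (fun n w => Z (grid_floor H n t) w * \1_(~` exceptional) w)).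
  move=> n; apply: measurable_funM; first exact: measurable_funPT.
  by apply: measurable_indic; apply: measurableC; exact: measurable_exceptional.
move=> w _; have [ew|nw] := pselect (exceptional w).
  rewrite limit_path_exceptional//.
  rewrite (_ : (fun n => _) = fun=> 0); first exact: cvg_cst.
  by apply/funext => n; rewrite indicE memNset ?mulr0//= => /(_ ew).
rewrite (_ : (fun n => _) = (fun n => Z (grid_floor H n t) w)); first exact: cvg_limit_path.
by apply/funext => n; rewrite indicE mem_set ?mulr1.
Qed.

Definition continuous_version t : {RV P >-> R} := to_rv (measurable_limit_path t) P.

Lemma continuous_version_is_version : is_version continuous_version Z.
Proof.
move=> t ot; have := ae_cvg_grid_floor al02 H01 hZ ot.
apply: filterS2 ae_not_exceptional => w nw ct.
exact: (cvg_unique _ (cvg_limit_path ot nw) ct).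
Qed.

Lemma near_mesh n t : \forall s \near t, near_at H n s t /\ (forall k, `|s ord0 k - t ord0 k| <= 1).
Proof.
apply/nbhs_ballP.
(* At most every mesh of level [n], and at most 1. *)
pose r : R := (2 ^+ (level_growth H * n.+1))^-1.
have r0 : 0 < r by rewrite invr_gt0 exprn_gt0.
exists r => //= s [_ st].
have h k : `|s ord0 k - t ord0 k| <= r by rewrite distrC ltW//; exact: st.
split=> k; rewrite (le_trans (h k))//.
  by rewrite /r /mesh lef_pV2 ?posrE ?exprn_gt0// ler_eXn2l ?ltr1n// level_le_growth.
by rewrite /r invf_le1 ?exprn_gt0// exprn_ege1// ler1n.
Qed.

Lemma continuous_version_continuous : continuous_paths continuous_version.
Proof.
move=> w; have [ew|nw] := pselect (exceptional w).
  rewrite (_ : (fun t => _) = fun=> 0); last first.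
    by apply/funext => t; exact: limit_path_exceptional.
  exact: cst_continuous.
apply/subspace_continuousP => t ot; apply/cvgrPdist_le => e e0.
have [T [T0 tT]] := orthant_cube ot.
(* The bound holds on the cube of side [T + 1], which contains the points of the orthant within
   distance 1 of [t]. *)
have [C [n0 [C0 hC]]] := not_exceptional_chain T nw.
have : C * scale_bound (2 / al) n @[n --> \oo] --> 0.
  rewrite -[X in _ --> X](mulr0 C); apply: cvgMr; exact: cvg_scale_bound.
move=> /cvgrPdist_le/(_ _ e0)[n1 _ hn1].
pose n := maxn n0 n1.
rewrite /prop_near1 /within/=; have := near_mesh n t; apply: filterS => s [st s1] os.
rewrite distrC (le_trans (hC n s t _ _ _ _ _ st (cvg_limit_path os nw) (cvg_limit_path ot nw)))//.
- exact: leq_maxl.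
- move=> k; rewrite os/= -natr1; have /andP[_ h1] := tT k.
  have := s1 k; rewrite ler_norml => /andP[_ h2]; lra.
- exact: cubeS tT.
- by have := hn1 n (leq_maxr _ _); rewrite sub0r normrN; exact: le_trans (ler_norm _).
Qed.

(** Almost sure equality at each point extends to all grid points at once: each level has finitely
    many in the cube, and the levels are countable. *)
Lemma version_eq_grid (Y : 'rV[R]_N -> {RV P >-> R}) T : is_version Y Z ->
  {ae P, forall w, forall n t, cube T t -> Y (grid_floor H n t) w = Z (grid_floor H n t) w}.
Proof.
move=> vY.
have : {ae P, forall w, forall n, forall x : 'I_#|box_index H T n|, Y (box_start x) w = Z (box_start x) w}.
  apply: ae_foralln => n; apply: filter_forall => x; apply: vY; exact: orthant_grid.
apply: filterS => w hw n t tT.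
have [x [xg _]] := box_index_of H01 (in_box_floor H n tT).
by rewrite /grid_floor -xg; exact: hw.
Qed.

(** Every mesh is at most [2^-n] because the components of [H] are below 1; the scale with exponent
    1 is a null sequence above it. *)
Lemma continuous_path_cvg_grid (f : 'rV[R]_N -> R) t : {within orthant, continuous f} ->
  orthant t -> f (grid_floor H n t) @[n --> \oo] --> f t.
Proof.
move=> /subspace_continuousP cf ot; apply: cvg_trans (cf t ot).
move=> A /=; rewrite /within/= => /nbhs_ballP[e /= e0 hA].
have := cvg_scale_bound (ltr01 : (0 : R) < 1).
move=> /cvgrPdist_lt/(_ _ e0)[n1 _ hn1].
exists n1 => // n /= nn; apply: hA; last exact: orthant_grid.
split => // i k; rewrite ord1 /ball/=.
have [_ h] := grid_floor_itv H n (ot k).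
rewrite (le_lt_trans h)//.
have := hn1 n nn; rewrite sub0r normrN gtr0_norm ?scale_bound_gt0//; apply: le_lt_trans.
rewrite /mesh /scale_bound powRr1// -[leLHS]mul1r.
apply: ler_pM; rewrite ?invr_ge0 ?exprn_ge0 ?ler1n//.
rewrite lef_pV2 ?posrE ?exprn_gt0// ler_eXn2l ?ltr1n//.
have /andP[h1 _] := level_bounds (H01 k) n.
have /andP[h2 h3] := H01 k.
by rewrite -(ler_nat R) (le_trans h1)// ler_piMr// ltW.
Qed.

(** By continuity a value of [Y] is the limit of [Y], hence of [Z], along the grid floors, so the
    chaining bound for [Z] holds for [Y]. *)
Lemma version_modulus (Y : 'rV[R]_N -> {RV P >-> R}) : (0 < N)%N ->
  is_version Y Z -> continuous_paths Y -> forall eps : R, 0 < eps ->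
  {ae P, forall w,
    modulus_ratio al eps H (fun t => Y t w) h @[h --> (0 : R)^'+] --> 0%E}.
Proof.
move=> N0 vY cY eps eps0.
apply: filterS2 (version_eq_grid 1 vY) ae_not_exceptional => w YZ nw.
have [C [n0 [C0 hC]]] := not_exceptional_chain 0 nw.
have lim t : unit_cube t -> Z (grid_floor H n t) w @[n --> \oo] --> Y t w.
  move=> ut; have ot : orthant t by move=> k; have /andP[] := ut k.
  rewrite (_ : (fun n => _) = (fun n => Y (grid_floor H n t) w)).
    exact: continuous_path_cvg_grid (cY w) ot.
  by apply/funext => n; rewrite YZ.
apply: (modulus_ratio_cvg0 al0 H01 N0 C0 (n0 := n0)) => // n s t nn us ut st.
exact: (hC n s t _ _ nn us ut st (lim s us) (lim t ut)).
Qed.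

End ContinuousVersion.

Theorem theorem4p6 (R : realType) (d : measure_display)
    (Omega : measurableType d) (P : probability Omega R)
    (N : nat) (alpha : R) (H : 'rV[R]_N) (Z : 'rV[R]_N -> {RV P >-> R}) :
  (0 < N)%N ->
  0 < alpha < 2 ->
  (forall j, 0 < H ord0 j < 1) ->
  is_hfss alpha H Z ->
  (exists Y : 'rV[R]_N -> {RV P >-> R}, is_version Y Z /\ continuous_paths Y) /\
  (forall Y : 'rV[R]_N -> {RV P >-> R}, is_version Y Z -> continuous_paths Y ->
    forall eps : R, 0 < eps ->
    {ae P, forall w,
      modulus_ratio alpha eps H (fun t => Y t w) h @[h --> (0 : R)^'+] --> 0%E}).
Proof.
move=> N0 al02 H01 hZ; split.
  exists (continuous_version Z al02 H01); split.
    exact: continuous_version_is_version.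
  exact: continuous_version_continuous.
by move=> Y vY cY eps eps0; exact: (version_modulus al02 H01 hZ N0 vY cY eps0).
Qed.
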